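(* Let $y_0,y_f\in X$ and $T>0$, and let $\tilde y_T:=y_f-S_Ty_0$. The state $y_f$ is exactly reachable from $y_0$ in time $T$ under the constraints $P_r=\mathrm{cone}(\mathcal U_r)$ with controls in $L^2_{\mathcal U_r}$ if and only if $$\exists c>0,\ \forall p_f\in X,\qquad \langle\tilde y_T,p_f\rangle_X\le c\,F^*(L_T^*p_f)^{1/2}. \qquad(\ast)$$ Now assume that $(\ast)$ holds, i.e. $c^\star<+\infty$. Then $J_0$ admits a minimiser over $X$ if and only if $c^\star$ is attained, and if so, for any such minimiser $p_f^\star$, at least one control $u\in\partial F^*(L_T^*p_f^\star)$ steers the solution of $\dot y=Ay+Bu$ from $y_0$ to $y_f$ in time $T$. Furthermore: - there exists a unique control $u\in\partial F^*(L_T^*p_f^\star)$ if and only if $$\text{for a.e. } t\in(0,T),\qquad L_T^*p_f^\star(t)\notin \mathrm{sing}(\mathcal U_r)\cap (P_r^\circ)^c; \qquad (H)$$ - if in addition to $(H)$ one has $\mathrm{ext}(\mathcal U_r)\subset\mathcal U$, then this unique control takes values in the original cone $P=\mathrm{cone}(\mathcal U)$ (for a.e. $t\in(0,T)$).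
   Context: Setting. $X$ and $U$ are real Hilbert spaces, $T>0$, $E:=L^2(0,T;U)$. $A:\mathcal D(A)\to X$ is an (unbounded) operator generating a $C_0$-semigroup $(S_t)_{t\ge0}$ on $X$, and $B\in L(U,X)$ is bounded linear. The control system is $\dot y=Ay+Bu$, $y(0)=y_0$, $u\in E$, with (mild) solution satisfying $y(T)=S_Ty_0+L_Tu$, where $L_T\in L(E,X)$, $L_Tu:=\int_0^TS_{T-t}Bu(t)\,dt$. Its adjoint $L_T^*\in L(X,E)$ is $L_T^*p_f(t)=B^*S_{T-t}^*p_f$. A control $u$ steers $y_0$ to $y_f$ in time $T$ if $y(T)=y_f$. Constraints. $\mathcal U\subset U$ is a fixed bounded set with $0\in\mathcal U$ (the generating set). For a set $K$, $\mathrm{cone}(K):=\{\lambda p:\ p\in K,\lambda>0\}$. Put $P:=\mathrm{cone}(\mathcal U)$, $\mathcal U_r:=\overline{\mathrm{conv}}(\mathcal U)$ (closed convex hull), $P_r:=\mathrm{cone}(\mathcal U_r)$. The polar cone is $P_r^\circ:=\{y\in U:\ \langle x,y\rangle\le0\ \forall x\in P_r\}$, and $(\cdot)^c$ is the complement in $U$. $\mathrm{ext}(\mathcal U_r)$ is the set of extreme points of $\mathcal U_r$. The support function is $\sigma_{\mathcal U_r}(x):=\sup_{v\in\mathcal U_r}\langle x,v\rangle$, the gauge is $j_{\mathcal U_r}(x):=\inf\{\alpha>0:\ x\in\alpha\,\mathcal U_r\}\in[0,+\infty]$, and $\mathrm{sing}(\mathcal U_r)$ is the set of vectors $x\in U$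 for which the maximum defining $\sigma_{\mathcal U_r}(x)$ is attained at more than one point of $\mathcal U_r$. $L^2_{\mathcal U_r}:=\{u\in E:\ t\mapsto j_{\mathcal U_r}(u(t))\in L^2(0,T)\}$. Reachability. $y_f$ is exactly reachable from $y_0$ in time $T$ under the constraints $Q\subset U$ with controls in $L^2_{\mathcal U_r}$ if there is $u\in L^2_{\mathcal U_r}$ with $u(t)\in Q$ for a.e. $t\in(0,T)$ such that the solution with $y(0)=y_0$ and control $u$ satisfies $y(T)=y_f$. Functionals. For $p\in E$, $F^*(p):=\frac12\int_0^T\sigma_{\mathcal U_r}(p(t))^2\,dt$ (a finite convex function on $E$), and $\partial F^*$ denotes its convex subdifferential. For $p_f\in X$, $J_0(p_f):=F^*(L_T^*p_f)-\langle\tilde y_T,p_f\rangle_X$. Moreover $$c^\star:=\inf\{c\ge0:\ \forall p_f\in X,\ \langle\tilde y_T,p_f\rangle_X\le cF^*(L_T^*p_f)^{1/2}\}=\sup_{\|p_f\|_X=1}\frac{\langle\tilde y_T,p_f\rangle_X}{F^*(L_T^*p_f)^{1/2}}\in[0,+\infty],$$ with the conventions $0/0=0$, $\alpha/0=+\infty$ for $\alpha>0$, and $\alpha/0=-\infty$ for $\alpha<0$. ''$c^\star$ is attained'' means that the supremum is a maximum.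
   Formalization: The implication ''unique control in ∂F*(L_T^*p_f^⋆) ⇒ (H)'' is proved for separable U (it fails for some nonseparable U), and ''J_0 has a minimiser iff c^⋆ is attained'' is proved for X ≠ {0} (it fails for X = {0}). *)

(* Defs.v *)
From HB Require Import structures.
From mathcomp Require Import all_boot all_order all_algebra.
From mathcomp Require Import all_classical all_reals all_analysis.
From mathcomp Require Import measurable_realfun.

Set Implicit Arguments.
Unset Strict Implicit.
Unset Printing Implicit Defensive.

Import Order.TTheory GRing.Theory Num.Theory.
Import numFieldNormedType.Exports.

Local Open Scope classical_set_scope.
Local Open Scope ring_scope.

HB.mixin Record isHilbert (R : realType) H of CompleteNormedModule R H := {
  inner : H -> H -> R ;
  innerC : forall x y, inner x y = inner y x ;
  innerDl : forall x y z, inner (x + y) z = inner x z + inner y z ;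
  innerZl : forall (a : R) x y, inner (a *: x) y = a * inner x y ;
  inner_norm : forall x, inner x x = `|x| ^+ 2
}.

#[short(type="hilbertType")]
HB.structure Definition Hilbert (R : realType) :=
  { H of isHilbert R H & CompleteNormedModule R H }.

Definition separable_space (V : topologicalType) :=
  exists2 D : set V, countable D & dense D.

(* The Hilbert-space adjoint of a bounded linear f: by the Riesz representation
   theorem, the x selected by xget exists and is unique. *)
Definition adjoint (R : realType) (V W : hilbertType R) (f : V -> W) : W -> V :=
  fun y => xget 0 [set x | forall z, inner (f z) y = inner z x].

Section Bochner.
Context {R : realType} {V : normedModType R}.
Local Notation mu := (@lebesgue_measure R).

Definition simple_fun (s : R -> V) :=
  finite_set (range s) /\ forall x, measurable (s @^-1` [set x]).

(* Convergence is required everywhere on D, not just almost everywhere; every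
   a.e. class of strongly measurable functions has such a representative. *)
Definition strongly_measurable (D : set R) (f : R -> V) :=
  exists s : (R -> V)^nat, (forall n, simple_fun (s n)) /\
    forall t, D t -> s n t @[n --> \oo] --> f t.

Definition simple_integral (D : set R) (s : R -> V) : V :=
  \sum_(x \in range s) fine (mu (D `&` s @^-1` [set x])) *: x.

Definition is_bochner_integral (D : set R) (f : R -> V) (z : V) :=
  strongly_measurable D f /\
  exists s : (R -> V)^nat,
    [/\ forall n, simple_fun (s n),
        (\int[mu]_(t in D) (`|f t - s n t|%:E))%E @[n --> \oo] --> 0%E &
        simple_integral D (s n) @[n --> \oo] --> z].

(* 0 when f is not Bochner integrable on D *)
Definition bochner_integral (D : set R) (f : R -> V) : V :=
  xget 0 (is_bochner_integral D f).

End Bochner.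

Section ConvexSets.
Context {R : realType} {V : hilbertType R}.
Implicit Types (K : set V) (x y v : V).

Definition closed_convex_hull K : set V :=
  closure (smallest (@convex_set R V) K).

Definition cone K : set V :=
  [set x | exists2 v, K v & exists2 l : R, 0 < l & x = l *: v].

Definition polar K : set V := [set y | forall x, K x -> inner x y <= 0].

Definition ext K : set V :=
  [set v | K v /\ forall a b (l : R), K a -> K b -> 0 < l -> l < 1 ->
     v = l *: a + (1 - l) *: b -> a = v /\ b = v].

Definition support_fun K x : R := sup [set inner x v | v in K].

(* +oo when x lies in no a *: K with a > 0 *)
Definition gauge K x : \bar R :=
  ereal_inf [set a%:E | a in [set a : R | 0 < a /\
                                exists2 v, K v & x = a *: v]].

Definition sing K : set V :=
  [set x | exists v w, [/\ K v, K w, v <> w,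
                           inner x v = support_fun K x & inner x w = support_fun K x]].

End ConvexSets.

(* Elements of E = L^2(0,T;U) are represented by functions R -> U, of which only
   the restriction to ]0, T[ matters, up to equality almost everywhere. *)
Section L2.
Context {R : realType} {U : hilbertType R}.
Variable T : R.
Local Notation mu := (@lebesgue_measure R).
Local Notation I := (`]0%R, T[%classic : set R).

Definition ae_on (P : R -> Prop) := {ae mu, forall t, I t -> P t}.

Definition L2 (u : R -> U) :=
  strongly_measurable I u /\
  (\int[mu]_(t in I) ((`|u t| ^+ 2)%:E) < +oo)%E.

Definition L2_inner (u v : R -> U) : R :=
  \int[mu]_(t in I) inner (u t) (v t).

Definition L2_gauge (K : set U) (u : R -> U) :=
  [/\ L2 u, measurable_fun I (gauge K \o u) &
      (\int[mu]_(t in I) (gauge K (u t) ^+ 2) < +oo)%E].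

Definition subdiff (F : (R -> U) -> R) (p : R -> U) : set (R -> U) :=
  [set u | L2 u /\
     forall q, L2 q -> F p + L2_inner u (fun t => q t - p t) <= F q].

Definition Fstar (K : set U) (p : R -> U) : R :=
  2^-1 * \int[mu]_(t in I) (support_fun K (p t) ^+ 2).

Definition ex_unique_ae (C : set (R -> U)) :=
  exists2 u, C u & forall v, C v -> ae_on (fun t => v t = u t).

End L2.

Section Semigroup.
Context {R : realType} {X : normedModType R}.

Record C0_semigroup (S : R -> X -> X) : Prop := {
  C0_linear : forall t, 0 <= t -> linear (S t) ;
  C0_bounded : forall t, 0 <= t -> continuous (S t) ;
  C0_id : forall x, S 0 x = x ;
  C0_add : forall s t x, 0 <= s -> 0 <= t -> S (s + t) x = S s (S t x) ;
  C0_continuous : forall x, S t x @[t --> 0^'+] --> x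
}.

(* The operator A with domain DA, values of A outside DA being irrelevant *)
Definition generator (S : R -> X -> X) (DA : set X) (A : X -> X) :=
  forall x z, (DA x /\ A x = z) <->
    (h^-1 *: (S h x - x) @[h --> 0^'+] --> z).

End Semigroup.

Section Control.
Context {R : realType} {X U : hilbertType R}.
Variables (S : R -> X -> X) (B : U -> X) (T : R).

Definition Lop (t : R) (u : R -> U) : X :=
  bochner_integral `]0, t[ (fun s => S (t - s) (B (u s))).

Definition Ladj (p : X) : R -> U :=
  fun t => adjoint B (adjoint (S (T - t)) p).

Definition mild_solution (y0 : X) (u : R -> U) (t : R) : X :=
  S t y0 + Lop t u.

Definition steers (y0 yf : X) (u : R -> U) := mild_solution y0 u T = yf.

(* K is the set whose gauge defines the space of controls *)
Definition reachable (Q K : set U) (y0 yf : X) :=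
  exists u, [/\ L2_gauge T K u, ae_on T (fun t => Q (u t)) & steers y0 yf u].

Variables (K : set U) (ytilde : X).

Definition sqrtF (p : X) : R := Num.sqrt (Fstar T K (Ladj p)).

Definition J0 (p : X) : R := Fstar T K (Ladj p) - inner ytilde p.

Definition minimiser (p : X) := forall q, J0 p <= J0 q.

Definition cbound (c : R) := forall p, inner ytilde p <= c * sqrtF p.

Definition cstar : \bar R :=
  ereal_inf [set c%:E | c in [set c : R | 0 <= c /\ cbound c]].

Definition cquot (p : X) : \bar R :=
  let a := inner ytilde p in
  if sqrtF p == 0 then
    if a == 0 then 0%E else if 0 < a then +oo%E else -oo%E
  else (a / sqrtF p)%:E.

(* The supremum of cquot over the unit sphere, which equals cstar as soon as X
   is nonzero, is a maximum. *)
Definition cstar_attained :=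
  exists2 p, `|p| = 1 & forall q, `|q| = 1 -> (cquot q <= cquot p)%E.

Definition condH (p : X) :=
  ae_on T (fun t => ~ (sing K `&` ~` polar (cone K)) (Ladj p t)).

End Control.

(* Main.v *)
Require Import Defs.
From HB Require Import structures.
From mathcomp Require Import all_boot all_order all_algebra.
From mathcomp Require Import all_classical all_reals all_analysis.
From mathcomp Require Import measurable_realfun.
From mathcomp Require Import ring lra.

(** Write [K] for the closed convex hull of the generating set, [s] for its support
    function, [L] for the input-to-state map, [y] for the target [yf - S T y0] and
    [F p] for the value of the conjugate cost at [L^* p].

    Reachability.  If [u = a w] with [w] valued in [K] and [a] square integrable, then
    [<u, q> <= a s(q) <= (a^2 + s(q)^2) / 2] pointwise; integrated at [q = L^* p] this
    bounds [<L u, p>] by a constant plus [F p], and scaling [p] turns it into the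
    inequality with the square root ([fenchel_young], [sqrt_bound_of_quadratic]).
    Conversely, consider the convex set of pairs [(u, a)] with [u t] in [a t *: K] and
    [\int a^2 <= c^2 / 2].  Its image under [u |-> L u] has [y] in its closure, since a
    separating vector [p] would contradict the inequality when tested against controls
    close to [l s(L^* p) v], where [v t] nearly maximises the pairing with [L^* p t]
    over [K] ([target_in_closure]).  To reach [y] itself, take among the pairs steering
    within [1/n] of [y] one of nearly least energy: by the parallelogram law these
    form a Cauchy sequence, whose limit is still admissible ([target_reached]).

    Minimisers.  [F] is positively homogeneous of degree two.  On rays, minimising
    [F p - <y, p>] is the same as maximising the ratio [<y, p> / sqrt (F p)]; a
    minimiser [p] satisfies [<y, p> = 2 F p], and the inequality holds with the constant
    [c = 2 sqrt (F p)].  The control that the first part provides for this [c] has a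
    cost at most [F p], so that it realises the equality case of Fenchel's inequality:
    it lies in the subdifferential ([minimiser_control]).

    Uniqueness.  The subdifferential is computed pointwise: [u] belongs to it if and
    only if, for almost every [t], [u t] is [s(q t)] times a maximiser of the pairing
    with [q t] over [K] ([subdiffP]).  Where the maximiser is unique, so is [u t], and
    the maximiser is an extreme point.  For the converse, the point closest to a
    vector [d] in the face of maximisers at [q t] is a pointwise limit of projections
    onto [K] of [d + n q t], hence depends measurably on [t]; letting [d] run through a
    countable dense set separates any two maximisers ([unique_nonsingular]).

    Measurability of [t |-> L^* p t] rests on the strong continuity of the adjoint
    semigroup, which holds on a closed subspace containing the averages of its orbits,
    hence on the whole space ([adjoint_strongly_continuous]). *)

Set Implicit Arguments.
Unset Strict Implicit.
Unset Printing Implicit Defensive.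
Import Order.TTheory GRing.Theory Num.Theory.
Import numFieldNormedType.Exports.
Local Open Scope classical_set_scope.
Local Open Scope ring_scope.

(** * Hilbert space geometry *)

Section InnerProduct.
Context {R : realType} {H : hilbertType R}.
Implicit Types x y z : H.

Lemma inner0l x : inner 0 x = 0.
Proof. by rewrite -(scale0r (0 : H)) innerZl mul0r. Qed.

Lemma inner0r x : inner x 0 = 0.
Proof. by rewrite innerC inner0l. Qed.

Lemma innerNl x y : inner (- x) y = - inner x y.
Proof. by rewrite -scaleN1r innerZl mulN1r. Qed.

Lemma innerNr x y : inner x (- y) = - inner x y.
Proof. by rewrite innerC innerNl innerC. Qed.

Lemma innerDr x y z : inner x (y + z) = inner x y + inner x z.
Proof. by rewrite innerC innerDl !(innerC x). Qed.

Lemma innerZr (a : R) x y : inner x (a *: y) = a * inner x y.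
Proof. by rewrite innerC innerZl innerC. Qed.

Lemma innerBl x y z : inner (x - y) z = inner x z - inner y z.
Proof. by rewrite innerDl innerNl. Qed.

Lemma innerBr x y z : inner x (y - z) = inner x y - inner x z.
Proof. by rewrite innerDr innerNr. Qed.

Definition innerE :=
  (@innerDl R H, innerDr, innerNl, innerNr, @innerZl R H, innerZr).

Lemma normD_sq x y : `|x + y| ^+ 2 = `|x| ^+ 2 + 2 * inner x y + `|y| ^+ 2.
Proof. by rewrite -!inner_norm !innerE (innerC y x); ring. Qed.

Lemma normB_sq x y : `|x - y| ^+ 2 = `|x| ^+ 2 - 2 * inner x y + `|y| ^+ 2.
Proof. by rewrite -!inner_norm !innerE (innerC y x); ring. Qed.

Lemma inner_le_norm x y : inner x y <= `|x| * `|y|.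
Proof.
have [->|x0] := eqVneq x 0; first by rewrite inner0l normr0 mul0r.
have [->|y0] := eqVneq y 0; first by rewrite inner0r normr0 mulr0.
have xp : 0 < `|x| by rewrite normr_gt0.
have yp : 0 < `|y| by rewrite normr_gt0.
have := sqr_ge0 `| `|y| *: x - `|x| *: y |.
rewrite normB_sq !innerE !normrZ !normr_id => h.
have : 0 <= (2 * (`|x| * `|y|)) * (`|x| * `|y| - inner x y) by nra.
by rewrite pmulr_rge0 ?subr_ge0// !mulr_gt0.
Qed.

Lemma abs_inner_le_norm x y : `|inner x y| <= `|x| * `|y|.
Proof.
by rewrite ler_norml inner_le_norm andbT lerNl -innerNl -(normrN x) inner_le_norm.
Qed.

Lemma inner_polar x y : inner x y = 2^-1 * (`|x + y| ^+ 2 - `|x| ^+ 2 - `|y| ^+ 2).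
Proof. by rewrite normD_sq; field. Qed.

Lemma cvg_inner (I : Type) (F : set_system I) {FF : Filter F} (f g : I -> H) x y :
  f @ F --> x -> g @ F --> y -> inner (f i) (g i) @[i --> F] --> inner x y.
Proof.
move=> fx gy; rewrite inner_polar.
under eq_fun do rewrite inner_polar.
apply: cvgM; first exact: cvg_cst.
by apply: cvgB; [apply: cvgB|]; rewrite !expr2; apply: cvgM; apply: cvg_norm => //;
  apply: cvgD.
Qed.

Lemma inner_ext x y : (forall z, inner z x = inner z y) -> x = y.
Proof.
move=> h; apply/eqP; rewrite -subr_eq0 -normr_eq0 -sqrf_eq0 -inner_norm.
by rewrite innerBr h subrr.
Qed.

End InnerProduct.

(* A linear identity between vectors becomes one between reals when tested against an
   arbitrary vector. *)
Ltac vec := apply: inner_ext => ?; rewrite ?innerE; field.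

Section Parallelogram.
Context {R : realType} {H : hilbertType R}.
Implicit Types x y w : H.

(** Parallelogram law written for distances to a common point [w]; with [w] to be
    approached by a convex set, the last term is at least [4] times the squared
    distance, which is what makes minimising sequences Cauchy. *)
Lemma parallelogram w x y :
  `|x - y| ^+ 2 = 2 * `|w - x| ^+ 2 + 2 * `|w - y| ^+ 2
     - 4 * `|w - (2^-1 *: x + 2^-1 *: y)| ^+ 2.
Proof.
have -> : x - y = (w - y) - (w - x) by vec.
have -> : w - (2^-1 *: x + 2^-1 *: y) = 2^-1 *: ((w - y) + (w - x)) by vec.
rewrite normrZ exprMn normB_sq (normD_sq (w - y)) normfV.
by rewrite (ger0_norm (ler0n _ 2)); field.
Qed.

End Parallelogram.

Section Completeness.
Context {R : realType} {V : completeNormedModType R}.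

Lemma cauchy_tail_cvg (u : nat -> V) (e : nat -> R) :
  (forall n m, (n <= m)%N -> `|u n - u m| <= e n) -> e @ \oo --> (0 : R) ->
  cvg (u @ \oo).
Proof.
move=> ue e0; apply/cauchy_cvgP/cauchy_exP => r r0.
have /cvgrPdist_lt /(_ r r0)[N _ hN] := e0.
exists (u N), N => // n /= Nn; rewrite -ball_normE /=.
apply: le_lt_trans (ue _ _ Nn) _; apply: le_lt_trans (hN N (leqnn N)).
by rewrite sub0r normrN ler_norm.
Qed.

Lemma cauchy_sq_cvg (u : nat -> V) (e : nat -> R) :
  (forall n m, (n <= m)%N -> `|u n - u m| ^+ 2 <= e n) -> e @ \oo --> (0 : R) ->
  cvg (u @ \oo).
Proof.
move=> ue e0; apply: (@cauchy_tail_cvg u (fun n => Num.sqrt (e n))).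
  by move=> n m nm; rewrite -(ger0_norm (normr_ge0 (u n - u m))) -sqrtr_sqr ler_sqrt
    ?ue// (le_trans _ (ue _ _ nm))// sqr_ge0.
rewrite -[X in _ --> X](@sqrtr0 R).
exact: cvg_comp e0 (@sqrt_continuous R 0).
Qed.

End Completeness.

Lemma closed_seq_lim {V : topologicalType} (K : set V) (u : nat -> V) x :
  closed K -> (forall n, K (u n)) -> u @ \oo --> x -> K x.
Proof. by move=> Kc Ku ux; apply: (closed_cvg K) ux => //; near=> n. Unshelve. all: end_near. Qed.

Lemma subseq_cvg {V : topologicalType} (x : nat -> V) (phi : nat -> nat) (l : V) :
  (forall k, (k <= phi k)%N) -> x @ \oo --> l -> x (phi k) @[k --> \oo] --> l.
Proof.
move=> hphi xl; apply: cvg_comp xl => A [N _ hN].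
by exists N => // k /= Nk; apply: hN; exact: leq_trans (hphi k).
Qed.

Lemma cvg_invn {R : realType} (c : R) : c * (n.+1%:R)^-1 @[n --> \oo] --> (0 : R).
Proof. by rewrite -(mulr0 c); apply: cvgM; [exact: cvg_cst|exact: cvg_harmonic]. Qed.

(** How first-order optimality conditions are extracted: an inequality holding to first
    order in [l], up to a remainder of second order, survives division by [l]. *)
Lemma quadratic_le0 {R : realType} (a b : R) :
  (forall l, 0 < l -> l <= 1 -> a <= l * b) -> a <= 0.
Proof.
move=> h; rewrite leNgt; apply/negP => a0.
have ab : a <= b by have := h 1 ltr01 (lexx _); rewrite mul1r.
have b0 : 0 < b by apply: lt_le_trans ab.
have := h (a / (2 * b)).
rewrite divr_gt0// ?mulr_gt0// ler_pdivrMr ?mulr_gt0//.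
rewrite (_ : a / _ * b = a / 2); last by field; rewrite gt_eqF.
by move=> /(_ isT ltac:(lra)); lra.
Qed.

Lemma sqr_le {R : realType} (a b : R) : 0 <= a -> a <= b -> a ^+ 2 <= b ^+ 2.
Proof. by move=> a0 ab; rewrite ler_pXn2r ?nnegrE ?(le_trans a0 ab). Qed.

Section Projection.
Context {R : realType} {H : hilbertType R}.
Implicit Types (K : set H) (x y v w z : H).

Definition convex_subset K :=
  forall x y (l : R), K x -> K y -> 0 <= l -> l <= 1 -> K (l *: x + (1 - l) *: y).

Definition is_proj K w z := K z /\ forall v, K v -> inner (w - z) (v - z) <= 0.

Lemma is_projP K w z : convex_subset K -> K z ->
  (forall v, K v -> `|w - z| <= `|w - v|) -> is_proj K w z.
Proof.
move=> Kc Kz h; split=> // v Kv.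
apply: (@quadratic_le0 _ _ (2^-1 * `|v - z| ^+ 2)) => l l0 l1.
have := h _ (Kc _ _ _ Kv Kz (ltW l0) l1).
rewrite -(@ler_pXn2r _ 2)// ?nnegrE//.
have -> : w - (l *: v + (1 - l) *: z) = (w - z) - l *: (v - z) by vec.
rewrite (normB_sq (w - z) (l *: _)) innerZr normrZ (gtr0_norm l0) exprMn => {}h.
by rewrite -(ler_pM2l l0); lra.
Qed.

Lemma proj_exists K w : closed K -> convex_subset K -> K !=set0 ->
  exists z, is_proj K w z.
Proof.
move=> Kcl Kcv [k0 Kk0].
pose D := [set `|w - v| ^+ 2 | v in K].
have infD : has_inf D.
  split; first by exists (`|w - k0| ^+ 2), k0.
  by exists 0 => _ [v _ <-]; rewrite sqr_ge0.
have Dlb v : K v -> inf D <= `|w - v| ^+ 2.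
  by move=> Kv; apply: ge_inf; [case: infD|exists v].
have /choice[u uP] (n : nat) : exists v, K v /\ `|w - v| ^+ 2 < inf D + n.+1%:R^-1.
  have [_ [v Kv <-] ?] := @inf_adherent _ D n.+1%:R^-1 ltac:(by []) infD.
  by exists v.
have Ku n : K (u n) by have [] := uP n.
have uc : cvg (u @ \oo).
  apply: (@cauchy_sq_cvg _ _ _ (fun n => 4 * n.+1%:R^-1)); last exact: cvg_invn.
  move=> n m nm; rewrite (parallelogram w).
  have [_ h1] := uP n; have [_ h2] := uP m.
  have h3 : m.+1%:R^-1 <= n.+1%:R^-1 :> R by rewrite lef_pV2 ?posrE ?ler_nat.
  have := Dlb _ (Kcv _ _ 2^-1 (Ku n) (Ku m) ltac:(lra) ltac:(lra)).
  rewrite (_ : 1 - 2^-1 = 2^-1 :> R); last by field.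
  by move: h1 h2 h3; move: (_^-1) (m.+1%:R^-1) => e e'; lra.
exists (lim (u @ \oo)); apply: is_projP => //; first exact: closed_seq_lim uc.
move=> v Kv; rewrite -(@ler_pXn2r _ 2)// ?nnegrE//.
have h1 : `|w - u n| ^+ 2 @[n --> \oo] --> `|w - lim (u @ \oo)| ^+ 2.
  by rewrite !expr2; apply: cvgM; apply: cvg_norm; apply: cvgB => //; exact: cvg_cst.
have h2 : inf D + 1 * n.+1%:R^-1 @[n --> \oo] --> inf D + 0.
  by apply: cvgD; [exact: cvg_cst|exact: cvg_invn].
apply: le_trans (Dlb v Kv); rewrite -[leRHS]addr0.
apply: ler_cvg_to h1 h2 _; near=> n; have [_ /ltW] := uP n.
by rewrite mul1r.
Unshelve. all: end_near. Qed.

Definition proj K w : H := xget 0 [set z | is_proj K w z].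

Lemma projP K w : closed K -> convex_subset K -> K !=set0 -> is_proj K w (proj K w).
Proof.
by move=> Kcl Kcv Kn0; apply: xgetPex; exact: proj_exists.
Qed.

Lemma is_proj_lip K w w' z z' : is_proj K w z -> is_proj K w' z' ->
  `|z - z'| <= `|w - w'|.
Proof.
move=> [Kz h] [Kz' h'].
have h1 : `|z - z'| ^+ 2 <= inner (w - w') (z - z').
  have := h _ Kz'; have := h' _ Kz; rewrite -inner_norm !innerE.
  by rewrite (innerC z' z); lra.
have := le_trans h1 (inner_le_norm _ _); rewrite expr2.
have [->|n0] := eqVneq (z - z') 0; first by rewrite !normr0.
by rewrite ler_pM2r// normr_gt0.
Qed.

End Projection.

Section ConvexBody.
Context {R : realType} {H : hilbertType R}.
Implicit Types (K : set H) (x y v w z d : H).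

Record convex_body K (M : R) : Prop := {
  body_closed : closed K ;
  body_convex : convex_subset K ;
  body0 : K 0 ;
  body_bound : forall v, K v -> `|v| <= M }.

Variables (K : set H) (M : R).
Hypothesis bK : convex_body K M.
Local Notation s := (support_fun K).

Lemma body_M_ge0 : 0 <= M.
Proof. by have := body_bound bK (body0 bK); rewrite normr0. Qed.

Lemma body_projP w : is_proj K w (proj K w).
Proof.
by apply: projP; [case: bK|case: bK|exists 0; case: bK].
Qed.

Lemma body_scale v l : K v -> 0 <= l -> l <= 1 -> K (l *: v).
Proof.
by move=> Kv l0 l1; have := body_convex bK Kv (body0 bK) l0 l1; rewrite scaler0 addr0.
Qed.

Lemma support_has_sup x : has_sup [set inner x v | v in K].
Proof.
split; first by exists (inner x 0), 0 => //; case: bK.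
exists (`|x| * M) => _ [v Kv <-]; apply: le_trans (inner_le_norm _ _) _.
by rewrite ler_wpM2l// (body_bound bK).
Qed.

Lemma support_ge x v : K v -> inner x v <= s x.
Proof. by move=> Kv; apply: ub_le_sup; [case: (support_has_sup x)|exists v]. Qed.

Lemma support_le x c : (forall v, K v -> inner x v <= c) -> s x <= c.
Proof.
move=> h; apply: ge_sup; first by case: (support_has_sup x).
by move=> _ [v Kv <-]; exact: h.
Qed.

Lemma support_approx x e : 0 < e -> exists2 v, K v & s x - e < inner x v.
Proof.
by move=> e0; have [_ [v Kv <-] ?] := sup_adherent e0 (support_has_sup x); exists v.
Qed.

Lemma support_ge0 x : 0 <= s x.
Proof. by have := support_ge x (body0 bK); rewrite inner0r. Qed.

Lemma support_le_norm x : s x <= M * `|x|.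
Proof.
apply: support_le => v Kv; apply: le_trans (inner_le_norm _ _) _.
by rewrite mulrC ler_wpM2r// (body_bound bK).
Qed.

Lemma supportD x y : s (x + y) <= s x + s y.
Proof.
by apply: support_le => v Kv; rewrite innerDl lerD// support_ge.
Qed.

Lemma supportZ (l : R) x : 0 <= l -> s (l *: x) = l * s x.
Proof.
have h (m : R) y : 0 <= m -> s (m *: y) <= m * s y.
  by move=> m0; apply: support_le => v Kv; rewrite innerZl ler_wpM2l// support_ge.
move=> l0; apply/eqP; rewrite eq_le h//=.
have [->|n0] := eqVneq l 0; first by rewrite mul0r support_ge0.
have lp : 0 < l by rewrite lt_def n0.
have := h l^-1 (l *: x); rewrite invr_ge0 scalerA mulVf// scale1r => /(_ l0).
by rewrite -(ler_pM2l lp) mulrA mulfV// mul1r.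
Qed.

Lemma support_lip x y : `|s x - s y| <= M * `|x - y|.
Proof.
have h a b : s a - s b <= M * `|a - b|.
  rewrite lerBlDl; apply: le_trans (lerD (lexx _) (support_le_norm (a - b))).
  by rewrite -[X in s X <= _](subrK b) addrC supportD.
by rewrite ler_norml h andbT lerNl opprB -normrN opprB h.
Qed.

(** The support function is nonnegative, [K] containing [0]. *)
Lemma support_eq0 x : s x = 0 <-> polar (cone K) x.
Proof.
split=> [s0 _ [v Kv [l l0 ->]]|px].
  by rewrite innerZl pmulr_rle0// innerC -s0 support_ge.
apply/eqP; rewrite eq_le support_ge0 andbT; apply: support_le => v Kv.
by rewrite innerC; apply: px; exists v => //; exists 1 => //; rewrite scale1r.
Qed.

(** The infimum defining the gauge is attained: at the value [0] because [K] is
    bounded, at positive values because it is closed. *)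
Lemma gauge_leP x (a : R) : 0 <= a ->
  (gauge K x <= a%:E)%E <-> exists2 v, K v & x = a *: v.
Proof.
move=> a0; split; last first.
  move=> [v Kv ->]; apply/lee_addgt0Pr => e e0; rewrite -EFinD.
  have ae : 0 < a + e by rewrite ltr_wpDl.
  apply: ereal_inf_lbound; exists (a + e) => //; split => //.
  exists ((a / (a + e)) *: v); last by rewrite scalerA mulrCA mulfV ?mulr1// gt_eqF.
  apply: body_scale => //; first by rewrite divr_ge0// ltW.
  by rewrite ler_pdivrMr// mul1r lerDl ltW.
move=> ga.
have h e : 0 < e -> exists2 v, K v & x = (a + e) *: v.
  move=> e0.
  have ae : 0 < a + e by rewrite ltr_wpDl.
  have : (gauge K x < (a + e)%:E)%E by apply: le_lt_trans ga _; rewrite lte_fin ltrDl.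
  move=> /ereal_inf_lt[_ [b [b0 [v Kv ->]] <-]]; rewrite lte_fin => bae.
  exists ((b / (a + e)) *: v); last by rewrite scalerA mulrCA mulfV ?mulr1// gt_eqF.
  apply: body_scale => //; first by rewrite divr_ge0// ltW.
  by rewrite ler_pdivrMr// mul1r ltW.
have [a_eq0|n0] := eqVneq a 0.
  exists 0; first by case: bK.
  rewrite scaler0; apply/eqP; rewrite -normr_le0.
  apply: (@quadratic_le0 _ _ M) => l l0 _.
  have [v Kv ->] := h _ l0; rewrite a_eq0 add0r normrZ gtr0_norm//.
  by rewrite ler_pM2l// (body_bound bK).
have ap : 0 < a by rewrite lt_def n0.
exists (a^-1 *: x); last by rewrite scalerA mulfV// scale1r.
apply: (@closed_seq_lim _ K (fun n => (a + 1 * n.+1%:R^-1)^-1 *: x)).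
- by case: bK.
- move=> n; have np : 0 < 1 * n.+1%:R^-1 :> R by rewrite mul1r.
  have [v Kv ->] := h _ np; rewrite scalerA mulVf ?scale1r//.
  by rewrite gt_eqF// ltr_wpDl.
- apply: cvgZr_tmp; apply: cvgV => //; rewrite -[X in _ --> X]addr0.
  by apply: cvgD; [exact: cvg_cst|exact: cvg_invn].
Qed.

Lemma gauge_ge0 x : (0 <= gauge K x)%E.
Proof. by apply/ereal_infP => _ [b [b0 _] <-]; rewrite lee_fin ltW. Qed.

(** Nothing prevents the limit scale from being [0]; the points are then at most
    [M * a n] in norm and tend to [0]. *)
Lemma scaled_lim (u : nat -> H) (a : nat -> R) x (b : R) :
  (forall n, 0 <= a n) -> (forall n, exists2 v, K v & u n = a n *: v) ->
  u @ \oo --> x -> a @ \oo --> b -> exists2 v, K v & x = b *: v.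
Proof.
move=> a0 ua ux ab.
have b0 : 0 <= b.
  by apply: ler_cvg_to (cvg_cst (0 : R)) ab _; near=> n; exact: a0.
have [b_eq0|n0] := eqVneq b 0.
  exists 0; first by case: bK.
  rewrite scaler0; apply/eqP; rewrite -normr_le0.
  have Ma : a n * M @[n --> \oo] --> 0 * M.
    by rewrite -b_eq0; apply: cvgM => //; exact: cvg_cst.
  rewrite -(mul0r M); apply: ler_cvg_to (cvg_norm ux) Ma _; near=> n.
  have [v Kv ->] := ua n.
  by rewrite normrZ ger0_norm// ler_wpM2l// (body_bound bK).
exists (b^-1 *: x); last by rewrite scalerA mulfV// scale1r.
have bp : 0 < b by rewrite lt_def n0.
have xc : (a n)^-1 *: u n @[n --> \oo] --> b^-1 *: x.
  by apply: cvgZ => //; exact: cvgV.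
apply: (closed_cvg K _ _ _ xc); first by case: bK.
have /cvgrPdist_lt /(_ _ bp) := ab; apply: filterS => n.
have [v Kv ->] := ua n; rewrite ltr_norml => /andP[_ h].
have an : 0 < a n by lra.
by rewrite scalerA mulVf ?scale1r// gt_eqF.
Unshelve. all: end_near. Qed.

(** The projection onto [a *: K], also when [a = 0]. *)
Definition scaled_proj (a : R) w : H := a *: proj K (a^-1 *: w).

Lemma scaled_projP (a : R) w v : 0 <= a -> K v ->
  inner (w - scaled_proj a w) (a *: v - scaled_proj a w) <= 0.
Proof.
rewrite /scaled_proj le_eqVlt => /orP[/eqP <-|a0] Kv.
  by rewrite !scale0r !subr0 inner0r.
have [_ /(_ v Kv)] := body_projP (a^-1 *: w); set z := proj _ _ => h.
have -> : w - a *: z = a *: (a^-1 *: w - z).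
  by rewrite scalerBr scalerA mulfV ?gt_eqF// scale1r.
by rewrite -scalerBr innerZl innerZr !pmulr_rle0.
Qed.

(** Projections onto a fixed convex set are contractions; changing the scale from [c] to
    [d] is controlled by adding the variational inequalities of the two projections. *)
Lemma scaled_proj_lip (a b : R) w w' : 0 <= a -> 0 <= b ->
  `|scaled_proj a w - scaled_proj b w'| <= `|w - w'| + 2 * M * `|a - b|.
Proof.
move=> a0 b0.
have Kp x : K (proj K x) by have [] := body_projP x.
have M0 := body_M_ge0.
have first_arg : `|scaled_proj a w - scaled_proj a w'| <= `|w - w'|.
  rewrite /scaled_proj -scalerBr normrZ ger0_norm//.
  have [->|n0] := eqVneq a 0; first by rewrite mul0r.
  have ap : 0 < a by rewrite lt_def n0.
  have := is_proj_lip (body_projP (a^-1 *: w)) (body_projP (a^-1 *: w')).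
  by rewrite -scalerBr normrZ gtr0_norm ?invr_gt0// ler_pdivlMl.
have second_arg (c d : R) x : 0 <= c -> 0 <= d -> c <= d ->
    `|scaled_proj c x - scaled_proj d x| <= 2 * M * `|c - d|.
  move=> c0 d0 cd; rewrite /scaled_proj.
  have := scaled_projP x c0 (Kp (d^-1 *: x)).
  have := scaled_projP x d0 (Kp (c^-1 *: x)).
  rewrite /scaled_proj; move: (proj _ _) (proj _ _) (Kp (c^-1 *: x)) (Kp (d^-1 *: x)).
  move=> z' z Kz Kz' hd hc.
  have dc : `|c - d| = d - c by rewrite distrC ger0_norm// subr_ge0.
  have [c_eq0|cn0] := eqVneq c 0.
    rewrite dc c_eq0 scale0r sub0r normrN subr0 normrZ ger0_norm//.
    have := body_bound bK Kz'; nra.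
  have cp : 0 < c by rewrite lt_def cn0.
  have dp : 0 < d by apply: lt_le_trans cd.
  have {}hc : inner (x - c *: z) (z' - z) <= 0.
    by rewrite -(pmulr_rle0 _ cp) -innerZr scalerBr.
  have {}hd : inner (x - d *: z') (z - z') <= 0.
    by rewrite -(pmulr_rle0 _ dp) -innerZr scalerBr.
  have hz : d * `|z' - z| <= (d - c) * M.
    have h : d * `|z' - z| ^+ 2 <= (d - c) * (M * `|z' - z|).
      have h1 : d * `|z' - z| ^+ 2 <= (d - c) * inner z (z - z').
        by move: hc hd; rewrite -inner_norm !innerE (innerC z z'); nra.
      apply: le_trans h1 _; rewrite ler_wpM2l ?subr_ge0//.
      apply: le_trans (inner_le_norm _ _) _.
      by rewrite distrC ler_wpM2r// (body_bound bK).
    have [e|n0] := eqVneq (`|z' - z|) 0; first by rewrite e mulr0 mulr_ge0// subr_ge0.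
    have zp : 0 < `|z' - z| by rewrite lt_def n0/=.
    by rewrite -(ler_pM2r zp) -mulrA -expr2 -(mulrA (d - c)).
  have -> : c *: z - d *: z' = (c - d) *: z - d *: (z' - z) by vec.
  apply: le_trans (ler_normB _ _) _; rewrite !normrZ dc (ger0_norm d0).
  have := body_bound bK Kz; nra.
have h2 : `|scaled_proj a w' - scaled_proj b w'| <= 2 * M * `|a - b|.
  case: (leP a b) => [|/ltW] ab; first exact: second_arg.
  by rewrite distrC (distrC a) second_arg.
rewrite -(subrK (scaled_proj a w') (scaled_proj a w)) -addrA.
by apply: le_trans (ler_normD _ _) _; exact: lerD.
Qed.

(** Tikhonov regularisation of the linear programme [max <x, v>] over [K]: the
    maximiser over [K] of [(n + 1) * <x, v> - |v - d|^2 / 2]. *)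
Definition tikhonov d x (n : nat) : H := proj K (d + n.+1%:R *: x).

(** The point closest to [d] of the face of [K] on which the pairing with [x] is
    maximal. *)
Definition face_proj d x : H := lim (tikhonov d x @ \oo).

Lemma tikhonov_in d x n : K (tikhonov d x n).
Proof. by have [] := body_projP (d + n.+1%:R *: x). Qed.

Lemma tikhonov_var d x n v : K v ->
  inner (d - tikhonov d x n) (v - tikhonov d x n)
    + n.+1%:R * inner x (v - tikhonov d x n) <= 0.
Proof.
move=> Kv; have [_ /(_ v Kv)] := body_projP (d + n.+1%:R *: x).
rewrite -/(tikhonov d x n); congr (_ <= _).
by rewrite -innerZl -innerDl addrAC.
Qed.

Lemma tikhonov_pythagoras d x n v : K v -> inner x (tikhonov d x n) <= inner x v ->
  `|v - tikhonov d x n| ^+ 2 + `|tikhonov d x n - d| ^+ 2 <= `|v - d| ^+ 2.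
Proof.
move=> Kv h; have := tikhonov_var d x n Kv; move: h; set t := tikhonov d x n => h.
have h2 : 0 <= n.+1%:R * inner x (v - t) by rewrite mulr_ge0// innerBr subr_ge0.
have -> : v - d = (v - t) + (t - d) by vec.
rewrite (normD_sq (v - t)) (_ : inner (v - t) (t - d) = - inner (d - t) (v - t)); first lra.
by rewrite !innerE (innerC v d) (innerC v t) (innerC t d); ring.
Qed.

Lemma tikhonov_homo d x n m : (n <= m)%N ->
  inner x (tikhonov d x n) <= inner x (tikhonov d x m).
Proof.
rewrite leq_eqVlt => /orP[/eqP->//|nm].
have := tikhonov_var d x n (tikhonov_in d x m).
have := tikhonov_var d x m (tikhonov_in d x n).
set t := tikhonov d x n; set t' := tikhonov d x m => h1 h2.
have mn : n.+1%:R < m.+1%:R :> R by rewrite ltr_nat.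
have : 0 <= (m.+1%:R - n.+1%:R) * inner x (t' - t).
  have : 0 <= inner (t' - t) (t' - t) by rewrite inner_norm sqr_ge0.
  move: h1 h2; move: (m.+1%:R : R) (n.+1%:R : R) => a b.
  by rewrite !innerE (innerC t' t); lra.
by rewrite pmulr_rge0 ?subr_gt0// innerBr subr_ge0.
Qed.

(** The values of the pairing increase with [n], so that by the Pythagorean inequality
    the squared distances to [d] increase as well, and their increments bound the
    squared distances between the points: the convergence is strong. *)
Lemma tikhonov_cvg d x : tikhonov d x @ \oo --> face_proj d x.
Proof.
pose A n := `|tikhonov d x n - d| ^+ 2.
have h n m : (n <= m)%N -> `|tikhonov d x n - tikhonov d x m| ^+ 2 <= A m - A n.
  move=> nm; rewrite distrC.
  by have := tikhonov_pythagoras (tikhonov_in d x m) (tikhonov_homo d x nm); rewrite /A; lra.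
have Ahomo : nondecreasing_seq A.
  by move=> n m nm; rewrite -subr_ge0; apply: le_trans (h _ _ nm); rewrite sqr_ge0.
have Aub : has_ubound (range A).
  exists ((M + `|d|) ^+ 2) => _ [n _ <-].
  rewrite /A ler_pXn2r ?nnegrE// ?addr_ge0 ?body_M_ge0//.
  apply: le_trans (ler_normB _ _) _.
  by rewrite lerD2r (body_bound bK)//; exact: tikhonov_in.
have Ac := nondecreasing_is_cvgn Ahomo Aub.
apply: (@cauchy_sq_cvg _ _ _ (fun n => lim (A @ \oo) - A n)).
  move=> n m nm; apply: le_trans (h _ _ nm) _; rewrite lerD2r.
  exact: nondecreasing_cvgn_le.
by rewrite -[X in _ --> X](subrr (lim (A @ \oo))); apply: cvgB => //; exact: cvg_cst.
Qed.

Lemma face_proj_in d x : K (face_proj d x).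
Proof.
exact: (closed_seq_lim (body_closed bK) (tikhonov_in d x) (@tikhonov_cvg d x)).
Qed.

(** The variational inequality bounds the loss at step [n] by a constant over [n + 1]. *)
Lemma face_proj_max d x : inner x (face_proj d x) = s x.
Proof.
apply/eqP; rewrite eq_le support_ge//=; last exact: face_proj_in.
apply: support_le => v Kv.
pose C := (M + `|d|) * (M + M).
have h1 : inner x (tikhonov d x n) + C * n.+1%:R^-1 @[n --> \oo] -->
    inner x (face_proj d x) + 0.
  apply: cvgD; last exact: cvg_invn.
  by apply: cvg_inner; [exact: cvg_cst|exact: tikhonov_cvg].
rewrite -[leRHS]addr0; apply: ler_cvg_to (cvg_cst (inner x v)) h1 _.
near=> n; have h := tikhonov_var d x n Kv.
have Kt := tikhonov_in d x n; set t := tikhonov d x n in h Kt *.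
rewrite -lerBlDl -innerBr ler_pdivlMr// [_ * n.+1%:R]mulrC.
have : inner (t - d) (v - t) <= C.
  apply: le_trans (inner_le_norm _ _) _; apply: ler_pM => //.
    by apply: le_trans (ler_normB _ _) _; rewrite lerD2r (body_bound bK).
  by apply: le_trans (ler_normB _ _) _; rewrite lerD// (body_bound bK).
by rewrite -(opprB d t) innerNl; lra.
Unshelve. all: end_near. Qed.

Lemma face_proj_near d x v : K v -> inner x v = s x ->
  `|v - face_proj d x| <= `|v - d|.
Proof.
move=> Kv xv.
have h n : `|v - tikhonov d x n| <= `|v - d|.
  rewrite -(@ler_pXn2r _ 2)// ?nnegrE//.
  have := @tikhonov_pythagoras d x n v Kv.
  rewrite xv => /(_ (support_ge x (tikhonov_in d x n))).
  by have := sqr_ge0 `|tikhonov d x n - d|; lra.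
have h1 : `|v - tikhonov d x n| @[n --> \oo] --> `|v - face_proj d x|.
  by apply: cvg_norm; apply: cvgB; [exact: cvg_cst|exact: tikhonov_cvg].
by apply: ler_cvg_to h1 (cvg_cst _) _; near=> n.
Unshelve. all: end_near. Qed.

End ConvexBody.

Section Duality.
Context {R : realType}.
Implicit Types H V W X : hilbertType R.

Lemma closure_normP {V : normedModType R} (A : set V) x :
  closure A x <-> forall e : R, 0 < e -> exists2 y, A y & `|x - y| < e.
Proof.
split=> [cA e e0|h B /nbhs_ballP[e /= e0 eB]].
  have [y [Ay]] := cA _ (nbhsx_ballx x e e0).
  by rewrite -ball_normE /= => ?; exists y.
have [y Ay xy] := h e e0; exists y; split=> //; apply: eB.
by rewrite -ball_normE.
Qed.

Lemma convex_closure H (C : set H) : convex_subset C -> convex_subset (closure C).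
Proof.
move=> Cc x y l /closure_normP xC /closure_normP yC l0 l1; apply/closure_normP => e e0.
have [x' Cx' xx'] := xC e e0; have [y' Cy' yy'] := yC e e0.
exists (l *: x' + (1 - l) *: y'); first exact: Cc.
have -> : l *: x + (1 - l) *: y - (l *: x' + (1 - l) *: y') =
  l *: (x - x') + (1 - l) *: (y - y') by vec.
apply: le_lt_trans (ler_normD _ _) _; rewrite !normrZ !ger0_norm ?subr_ge0//.
have [->|l_neq0] := eqVneq l 0; first by rewrite mul0r subr0 mul1r add0r.
have lp : 0 < l by rewrite lt_def l_neq0.
by nra.
Qed.

(** The separating direction joins the projection of [y] onto the closure to [y]. *)
Lemma separation H (C : set H) y : convex_subset C -> C !=set0 -> ~ closure C y ->
  exists p a, a < inner y p /\ forall v, C v -> inner v p <= a.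
Proof.
move=> Cc [c Cc0] yC.
have [z [Kz h]] : exists z, is_proj (closure C) y z.
  apply: proj_exists; [exact: closed_closure|exact: convex_closure|].
  by exists c; exact: subset_closure.
exists (y - z), (inner z (y - z)); split.
  rewrite -subr_gt0 -innerBl inner_norm exprn_gt0// normr_gt0 subr_eq0.
  by apply/eqP => yz; apply: yC; rewrite yz.
move=> v Cv; rewrite -subr_le0 -innerBl innerC; apply: h; exact: subset_closure.
Qed.

(** Riesz representation: [f] is a multiple of the pairing with the point of least
    norm of the affine hyperplane [f = 1]. *)
Lemma riesz H (f : H -> R) (M : R) :
  (forall a x y, f (a *: x + y) = a * f x + f y) -> (forall x, `|f x| <= M * `|x|) ->
  exists z, forall x, f x = inner x z.
Proof.
move=> fl fb.
have f0 : f 0 = 0 by have := fl (-1) 0 0; rewrite scaler0 addr0 mulN1r addNr.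
have fZ a x : f (a *: x) = a * f x by have := fl a x 0; rewrite !addr0 f0 addr0.
have fB x y : f (x - y) = f x - f y by rewrite [x - y]addrC -scaleN1r fl mulN1r addrC.
have [[x0 fx0]|f_eq0] := pselect (exists x, f x != 0); last first.
  exists 0 => x; rewrite inner0r; apply/eqP/negPn/negP => fx.
  by apply: f_eq0; exists x.
pose A := [set x | f x = 1].
have [z [fz h]] : exists z, is_proj A 0 z.
  apply: proj_exists.
  - move=> x /closure_normP cA; rewrite /A /=.
    apply/eqP; rewrite -subr_eq0 -normr_le0.
    apply: (@quadratic_le0 _ _ M) => l l0 _.
    have [y <- xy] := cA l l0.
    rewrite -fB.
    apply: le_trans (fb _) _; rewrite mulrC.
    have [M0|M0] := leP 0 M; first by rewrite ler_wpM2r// ltW.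
    have := fb x0; have : 0 < `|f x0| by rewrite normr_gt0.
    by have := normr_ge0 x0; nra.
  - by move=> x y l; rewrite /A /= => fx fy _ _; rewrite fl fZ fx fy; ring.
  - by exists ((f x0)^-1 *: x0); rewrite /A /= fZ mulVf.
have zn : inner z z != 0.
  rewrite inner_norm sqrf_eq0 normr_eq0; apply: contraPneq fz => ->.
  by rewrite /A /= f0; apply/eqP; rewrite eq_sym oner_eq0.
have ker k : f k = 0 -> inner k z = 0.
  move=> fk.
  have h1 := h (z + k); have h2 := h (z - k); move: h1 h2; rewrite /A /=.
  have -> : f (z + k) = 1 by rewrite -[z]scale1r fl fk fz addr0 mulr1.
  have -> : f (z - k) = 1 by rewrite fB fk fz subr0.
  move=> /(_ erefl) + /(_ erefl); rewrite !innerE (innerC k z) !inner0l; lra.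
exists ((inner z z)^-1 *: z) => x.
have /ker : f (x - f x *: z) = 0 by rewrite fB fZ fz mulr1 subrr.
rewrite innerBl innerZl innerZr => /eqP.
by rewrite subr_eq0 => /eqP ->; rewrite mulrCA mulVf// mulr1.
Qed.

Section LinearMaps.
Context {V W : lmodType R} {f : V -> W}.
Hypothesis fl : linear f.

Lemma linear_zero : f 0 = 0.
Proof. by have := fl (-1) 0 0; rewrite scaler0 addr0 scaleN1r addNr. Qed.

Lemma linear_scale a x : f (a *: x) = a *: f x.
Proof. by have := fl a x 0; rewrite !addr0 linear_zero addr0. Qed.

Lemma linear_sub x y : f (x - y) = f x - f y.
Proof. by rewrite addrC -scaleN1r fl scaleN1r addrC. Qed.

End LinearMaps.

Definition bounded_op {V W : normedModType R} (f : V -> W) (M : R) :=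
  forall x, `|f x| <= M * `|x|.

Lemma linear_bounded {V W : normedModType R} (f : V -> W) :
  linear f -> continuous f -> exists2 M, 0 <= M & bounded_op f M.
Proof.
move=> fl fc; have f0 := linear_zero fl; have fZ := linear_scale fl.
have /cvgrPdist_lt /(_ 1 ltr01) := fc 0.
move=> /nbhs_ballP[e /= e0 eB].
exists (2 / e); first by rewrite divr_ge0// ltW.
move=> x; have [->|x0] := eqVneq x 0; first by rewrite f0 !normr0 mulr0.
have xp : 0 < `|x| by rewrite normr_gt0.
have := eB ((e / 2 / `|x|) *: x).
rewrite -ball_normE /= sub0r normrN normrZ !normrM !normfV !normr_id.
rewrite (gtr0_norm e0) (ger0_norm (ler0n _ 2)) mulfVK ?gt_eqF// fZ f0 sub0r normrN.
have -> : e / 2 < e by lra.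
move=> /(_ isT); rewrite normrZ gtr0_norm ?divr_gt0//.
move: (`|f x|) => r h; apply: ltW.
have -> : r = 2 / e * `|x| * (e / 2 / `|x| * r) by field; rewrite !gt_eqF.
by rewrite -[ltRHS]mulr1 ltr_pM2l// mulr_gt0// divr_gt0.
Qed.

Section Adjoint.
Context {V W : hilbertType R}.
Variables (f : V -> W) (M : R).
Hypotheses (M0 : 0 <= M) (fl : linear f) (fM : bounded_op f M).

Lemma adjointP y z : inner (f z) y = inner z (adjoint f y).
Proof.
have [x xP] : exists x, forall z, inner (f z) y = inner z x.
  apply: (@riesz _ _ (M * `|y|)).
    by move=> a u v; rewrite fl innerDl innerZl.
  move=> u; apply: le_trans (abs_inner_le_norm _ _) _.
  by rewrite mulrAC ler_wpM2r.
by have /(_ z) := @xgetPex _ 0 [set x | forall z, inner (f z) y = inner z x] (ex_intro _ x xP).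
Qed.

Lemma adjoint_linear : linear (adjoint f).
Proof.
move=> a x y; apply: inner_ext => z.
by rewrite -adjointP !innerE -!adjointP.
Qed.

Lemma adjoint_bounded : bounded_op (adjoint f) M.
Proof.
move=> y; have [->|n0] := eqVneq (adjoint f y) 0.
  by rewrite normr0 mulr_ge0.
have ap : 0 < `|adjoint f y| by rewrite normr_gt0.
rewrite -(ler_pM2l ap) -expr2 -inner_norm -adjointP.
apply: le_trans (inner_le_norm _ _) _.
by rewrite mulrA (mulrC `|adjoint f y|) ler_wpM2r.
Qed.

End Adjoint.
End Duality.

(** * Strong measurability *)

Section SimpleFunctions.
Context {R : realType}.
Implicit Types V W Z : normedModType R.

Lemma simple_preimage {V} (s : R -> V) (Y : set V) : simple_fun s -> measurable (s @^-1` Y).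
Proof.
move=> [sf sm].
have -> : s @^-1` Y = \bigcup_(x in range s `&` Y) s @^-1` [set x].
  apply/seteqP; split=> [t Yt|t [x [_ Yx] /= ->//]].
  by exists (s t) => //; split=> //; exists t.
apply: fin_bigcup_measurable => [|x _]; last exact: sm.
exact: finite_setIl.
Qed.

Lemma simple_comp2 {V W Z} (g : V -> W -> Z) (a : R -> V) (b : R -> W) :
  simple_fun a -> simple_fun b -> simple_fun (fun t => g (a t) (b t)).
Proof.
move=> sa sb; split.
  have h : finite_set (range a `*` range b).
    by apply: finite_setX; [case: sa|case: sb].
  apply: sub_finite_set (finite_image (fun p => g p.1 p.2) h).
  by move=> _ [t _ <-]; exists (a t, b t) => //; split; exists t.
move=> z.
have -> : (fun t => g (a t) (b t)) @^-1` [set z] =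
  \bigcup_(x in range a) (a @^-1` [set x] `&` b @^-1` [set y | g x y = z]).
  apply/seteqP; split=> [t /= <-|t [x _ [/= ->]]//].
  by exists (a t) => //; exists t.
apply: fin_bigcup_measurable => [|x _]; first by case: sa.
by apply: measurableI; [case: sa|exact: simple_preimage].
Qed.

Lemma simple_comp {V W} (g : V -> W) (a : R -> V) :
  simple_fun a -> simple_fun (fun t => g (a t)).
Proof. by move=> sa; exact: (simple_comp2 (fun x _ => g x) sa sa). Qed.

Lemma simple_cst {V} (x : V) : simple_fun (fun _ : R => x).
Proof.
split; first by apply: sub_finite_set (finite_set1 x) => _ [t _ <-].
move=> y; have [->|xy] := pselect (x = y).
  by rewrite (_ : _ @^-1` _ = setT)//; apply/seteqP; split.
by rewrite (_ : _ @^-1` _ = set0)//; apply/seteqP; split.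
Qed.

Lemma simple_if {V} (A : set R) (s s' : R -> V) : measurable A ->
  simple_fun s -> simple_fun s' -> simple_fun (fun t => if t \in A then s t else s' t).
Proof.
move=> mA ss ss'; split.
  apply: (@sub_finite_set _ _ (range s `|` range s')).
    by move=> _ [t _ <-]; case: ifP => _; [left|right]; exists t.
  by rewrite finite_setU; split; [case: ss|case: ss'].
move=> x; rewrite (_ : _ @^-1` _ = (A `&` s @^-1` [set x]) `|` (~` A `&` s' @^-1` [set x])).
  apply: measurableU; apply: measurableI => //; first by case: ss.
    exact: measurableC.
  by case: ss'.
apply/seteqP; split=> t /=.
  by case: ifPn => [/set_mem|/negP At]; [left|right; split=> // /mem_set].
by move=> [[/mem_set -> //]|[At <-]]; rewrite memNset.
Qed.

Lemma simple_measurable {V} (phi : V -> R) (s : R -> V) (D : set R) : simple_fun s ->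
  measurable_fun D (fun t => phi (s t)).
Proof.
move=> ss mD Y mY; apply: measurableI => //.
exact: (@simple_preimage _ s [set x | Y (phi x)]).
Qed.

End SimpleFunctions.

Section StrongMeasurability.
Context {R : realType}.
Implicit Types V W Z : normedModType R.
Variable D : set R.
Hypothesis mD : measurable D.

Lemma sm_eq {V} (f g : R -> V) : (forall t, D t -> f t = g t) ->
  strongly_measurable D f -> strongly_measurable D g.
Proof.
by move=> fg [s [ss sf]]; exists s; split=> // t Dt; rewrite -fg//; exact: sf.
Qed.

Lemma sm_comp2 {V W Z} (h : V -> W -> Z) (f : R -> V) (g : R -> W) :
  (forall t (x : nat -> V) (y : nat -> W), D t -> x @ \oo --> f t -> y @ \oo --> g t ->
     h (x n) (y n) @[n --> \oo] --> h (f t) (g t)) ->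
  strongly_measurable D f -> strongly_measurable D g ->
  strongly_measurable D (fun t => h (f t) (g t)).
Proof.
move=> hc [s [ss sf]] [s' [ss' sg]]; exists (fun n t => h (s n t) (s' n t)); split.
  by move=> n; exact: simple_comp2.
by move=> t Dt; apply: hc => //; [exact: sf|exact: sg].
Qed.

Lemma sm_comp {V W} (h : V -> W) (f : R -> V) :
  continuous h -> strongly_measurable D f -> strongly_measurable D (fun t => h (f t)).
Proof.
move=> hc mf; apply: (@sm_comp2 _ V _ (fun x _ => h x) f f) => // t x y Dt xf _.
by apply: cvg_comp xf _; exact: hc.
Qed.

Lemma sm_cst {V} (x : V) : strongly_measurable D (fun=> x).
Proof. by exists (fun _ _ => x); split=> *; [exact: simple_cst|exact: cvg_cst]. Qed.

Lemma smD {V} (f g : R -> V) : strongly_measurable D f -> strongly_measurable D g ->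
  strongly_measurable D (fun t => f t + g t).
Proof.
by apply: (@sm_comp2 _ _ _ (fun x y => x + y) f g) => t x y Dt xf yg; exact: cvgD.
Qed.

Lemma smZ {V} (a : R) (f : R -> V) : strongly_measurable D f ->
  strongly_measurable D (fun t => a *: f t).
Proof. by apply: sm_comp => x; exact: scaler_continuous. Qed.

Lemma smB {V} (f g : R -> V) : strongly_measurable D f -> strongly_measurable D g ->
  strongly_measurable D (fun t => f t - g t).
Proof.
by apply: (@sm_comp2 _ _ _ (fun x y => x - y) f g) => t x y Dt xf yg; exact: cvgB.
Qed.

Lemma sm_if {V} (A : set R) (f g : R -> V) : measurable A ->
  strongly_measurable D f -> strongly_measurable D g ->
  strongly_measurable D (fun t => if t \in A then f t else g t).
Proof.
move=> mA [s [ss sf]] [s' [ss' sg]]; exists (fun n t => if t \in A then s n t else s' n t).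
split=> [n|t Dt]; first exact: simple_if.
by case: ifP => _; [exact: sf|exact: sg].
Qed.

Lemma sm_measurable {V} (phi : V -> R) (f : R -> V) : continuous phi ->
  strongly_measurable D f -> measurable_fun D (fun t => phi (f t)).
Proof.
move=> pc [s [ss sf]].
apply: (@measurable_fun_cvg _ _ _ _ (fun n t => phi (s n t))) => [n|t Dt].
  exact: simple_measurable.
by apply: cvg_comp (sf _ Dt) _; exact: pc.
Qed.

Lemma sm_norm {V} (f : R -> V) : strongly_measurable D f ->
  measurable_fun D (fun t => `|f t|).
Proof. by apply: sm_measurable => x; exact: norm_continuous. Qed.

(** The [n]-th simple approximation takes the value closest to [f t] among
    [d 0, ..., d n]; comparing distances is a measurable operation. *)
Lemma sm_pettis {V} (d : nat -> V) (f : R -> V) :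
  (forall t e, D t -> 0 < e -> exists k, `|f t - d k| < e) ->
  (forall k, measurable_fun D (fun t => `|f t - d k|)) ->
  strongly_measurable D f.
Proof.
move=> fd fm.
pose fix m n t {struct n} := if n is n'.+1 then Num.min (m n' t) `|f t - d n| else `|f t - d 0%N|.
pose A n := D `&` [set t | `|f t - d n.+1| < m n t].
pose fix s n t {struct n} := if n is n'.+1 then if t \in A n' then d n else s n' t else d 0%N.
have mm n : measurable_fun D (m n).
  by elim: n => [|n IH] /=; [exact: fm|apply: measurable_minr => //; exact: fm].
have mA n : measurable (A n).
  have := measurable_fun_ltr (fm n.+1) (mm n) mD (Y := [set true]).
  by apply.
have ms n : simple_fun (s n).
  elim: n => [|n IH] /=; first exact: simple_cst.
  by apply: simple_if => //; exact: simple_cst.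
exists s; split=> // t Dt.
have sm_eq_min n : `|f t - s n t| = m n t.
  elim: n => [//|n IH] /=; rewrite minEle; case: ifPn => [/set_mem[_ /=]|tA].
    by rewrite ltNge => /negbTE ->.
  rewrite IH; case: leP => // h; exfalso; move/negP: tA; apply.
  by apply/mem_set; split.
have m_le k n : (k <= n)%N -> m n t <= `|f t - d k|.
  elim: n => [|n IH]; first by rewrite leqn0 => /eqP ->.
  rewrite leq_eqVlt => /orP[/eqP ->|]; first by rewrite /= ge_min lexx orbT.
  by rewrite ltnS => /IH h; rewrite /= ge_min h.
apply/cvgrPdist_lt => e e0; have [k hk] := fd t e Dt e0.
exists k => // n /= kn; rewrite sm_eq_min.
exact: le_lt_trans (m_le _ _ kn) hk.
Qed.

(** All the values taken by the simple functions approximating all the [f_ n] form a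
    countable set, and its closure contains the values of [f]. *)
Lemma sm_lim {V} (f_ : nat -> R -> V) (f : R -> V) :
  (forall n, strongly_measurable D (f_ n)) ->
  (forall t, D t -> f_ n t @[n --> \oo] --> f t) -> strongly_measurable D f.
Proof.
move=> mf ff.
have /choice[s sP] := mf.
have /choice[r rP] (kn : nat * nat) : exists r : seq V, range (s kn.1 kn.2) `<=` [set` r].
  have [/(_ kn.2)[/finite_seqP[r rE] _] _] := sP kn.1.
  by exists r; rewrite rE.
pose d (i : nat) : V := if @unpickle (nat * nat * nat)%type i is Some p
  then nth 0 (r p.1) p.2 else 0.
apply: (@sm_pettis _ d).
  move=> t e Dt e0.
  have /cvgrPdist_lt /(_ (e / 2)) := ff _ Dt; rewrite divr_gt0// => /(_ isT)[k _ hk].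
  have [_ /(_ t Dt)/cvgrPdist_lt /(_ (e / 2))] := sP k.
  rewrite divr_gt0// => /(_ isT)[n _ hn].
  have : s k n t \in r (k, n) by apply: (rP (k, n)); exists t.
  move=> h; exists (pickle (k, n, index (s k n t) (r (k, n)))).
  rewrite /d pickleK /= nth_index// (splitr e).
  rewrite -(subrK (f_ k t) (f t)) -addrA.
  by apply: le_lt_trans (ler_normD _ _) _; apply: ltrD; [apply: hk|apply: hn] => /=.
move=> k; apply: (@measurable_fun_cvg _ _ _ _ (fun n t => `|f_ n t - d k|)).
  move=> n; apply: (@sm_measurable _ (fun y => `|y - d k|) _ _ (mf n)) => x.
  by apply: cvg_norm; apply: cvgB; [exact: cvg_id|exact: cvg_cst].
by move=> t Dt; apply: cvg_norm; apply: cvgB; [exact: ff|exact: cvg_cst].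
Qed.

Lemma sm_id : strongly_measurable D (fun t : R => t : R^o).
Proof.
pose d (i : nat) : R := if @unpickle rat i is Some q then ratr q else 0.
apply: (@sm_pettis _ d).
  move=> t e Dt e0; have [q] := @rat_in_itvoo R (t - e) (t + e) ltac:(lra).
  rewrite in_itv /= => /andP[h1 h2]; exists (pickle q); rewrite /d pickleK.
  by rewrite distrC ltr_distl h1 h2.
by move=> k; apply: measurableT_comp => //; apply: measurable_funB.
Qed.

End StrongMeasurability.

(** * Integrals of real functions *)

Section RealIntegral.
Context {R : realType}.
Local Notation mu := (@lebesgue_measure R).
Variable D : set R.
Hypothesis mD : measurable D.
Implicit Types (f g : R -> R) (P Q S : R -> Prop).

Definition integ (f : R -> R) := mu.-integrable D (EFin \o f).
Definition aeD P := {ae mu, forall t, D t -> P t}.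

Lemma integ_measurable f : integ f -> measurable_fun D f.
Proof. by move=> /measurable_int /measurable_EFinP. Qed.

Lemma measurable_EFin f : measurable_fun D f ->
  @measurable_fun _ _ (measurableTypeR R) _ D (fun t => (f t)%:E).
Proof. by move/measurable_EFinP. Qed.

Lemma integ_le f g : measurable_fun D f -> (forall t, D t -> `|f t| <= g t) ->
  integ g -> integ f.
Proof.
move=> mf fg; apply: le_integrable => //; first exact/measurable_EFinP.
move=> t Dt /=; rewrite lee_fin; apply: le_trans (fg t Dt) _.
exact: ler_norm.
Qed.

Lemma integ_eq f g : (forall t, D t -> f t = g t) -> integ f -> integ g.
Proof.
by move=> fg; apply: eq_integrable => // t /set_mem Dt /=; rewrite fg.
Qed.

Lemma integD f g : integ f -> integ g -> integ (fun t => f t + g t).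
Proof. exact: integrableD. Qed.

Lemma integB f g : integ f -> integ g -> integ (fun t => f t - g t).
Proof. exact: integrableB. Qed.

Lemma integZ (a : R) f : integ f -> integ (fun t => a * f t).
Proof. exact: (@integrableZl _ _ _ mu D mD a (EFin \o f)). Qed.

Lemma integ_norm f : integ f -> integ (fun t => `|f t|).
Proof. exact: integrable_norm. Qed.

Lemma integ_ge0P f : measurable_fun D f -> (forall t, D t -> 0 <= f t) ->
  (\int[mu]_(t in D) (f t)%:E < +oo)%E -> integ f.
Proof.
move=> mf f0 h; apply/integrableP; split; first exact/measurable_EFinP.
rewrite (@eq_integral _ _ _ mu D (fun t => (f t)%:E))// => t /set_mem Dt /=.
by rewrite ger0_norm// f0.
Qed.

Lemma Rint_EFin f : integ f -> (\int[mu]_(t in D) (f t)%:E = (\int[mu]_(t in D) f t)%:E)%E.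
Proof. by move=> fi; rewrite fineK// integrable_fin_num. Qed.

Lemma RintD f g : integ f -> integ g ->
  \int[mu]_(t in D) (f t + g t) = \int[mu]_(t in D) f t + \int[mu]_(t in D) g t.
Proof. exact: RintegralD. Qed.

Lemma RintB f g : integ f -> integ g ->
  \int[mu]_(t in D) (f t - g t) = \int[mu]_(t in D) f t - \int[mu]_(t in D) g t.
Proof. exact: RintegralB. Qed.

Lemma RintZ (a : R) f : integ f ->
  \int[mu]_(t in D) (a * f t) = a * \int[mu]_(t in D) f t.
Proof. exact: RintegralZl. Qed.

Lemma Rint_le f g : integ f -> integ g -> (forall t, D t -> f t <= g t) ->
  \int[mu]_(t in D) f t <= \int[mu]_(t in D) g t.
Proof. exact: le_Rintegral. Qed.

Lemma Rint_eq f g : (forall t, D t -> f t = g t) ->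
  \int[mu]_(t in D) f t = \int[mu]_(t in D) g t.
Proof. by move=> h; apply: eq_Rintegral => t /set_mem; exact: h. Qed.

Lemma aeD_forall P : (forall t, D t -> P t) -> aeD P.
Proof. by move=> h; exact: aeW. Qed.

Let aeF := ae_filter_ringOfSetsType mu.

Lemma aeD_imp (P Q : R -> Prop) : (forall t, D t -> P t -> Q t) -> aeD P -> aeD Q.
Proof. by move=> PQ; apply: (@filterS _ _ aeF) => t h Dt; apply: PQ => //; exact: h. Qed.

Lemma aeD_imp2 (P Q S : R -> Prop) : (forall t, D t -> P t -> Q t -> S t) ->
  aeD P -> aeD Q -> aeD S.
Proof.
by move=> PQ; apply: (@filterS2 _ _ aeF) => t h h' Dt; apply: PQ => //; [exact: h|exact: h'].
Qed.

Lemma aeD_all (P : nat -> R -> Prop) : (forall n, aeD (P n)) -> aeD (fun t => forall n, P n t).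
Proof.
by move=> h; apply: (@filterS _ _ aeF) (ae_foralln h) => t ht Dt n; exact: ht.
Qed.

Lemma Rint_ge0_ae f : integ f -> aeD (fun t => 0 <= f t) -> 0 <= \int[mu]_(t in D) f t.
Proof.
move=> fi f0; rewrite /Rintegral (@ae_eq_integral _ _ _ mu D (fun t => `|f t|%:E))//.
- by rewrite fine_ge0// integral_ge0// => t _; rewrite lee_fin.
- exact: measurable_int fi.
- by apply/measurable_EFinP; apply: measurableT_comp => //; exact: integ_measurable.
- by move: f0; apply: aeD_imp => t Dt h /=; rewrite ger0_norm.
Qed.

Lemma Rint_le_ae f g : integ f -> integ g -> aeD (fun t => f t <= g t) ->
  \int[mu]_(t in D) f t <= \int[mu]_(t in D) g t.
Proof.
move=> fi gi fg; rewrite -subr_ge0 -RintegralB//.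
by apply: Rint_ge0_ae; [exact: integB|apply: aeD_imp fg => t _; rewrite subr_ge0].
Qed.

Lemma Rint_eq_ae f g : integ f -> integ g -> aeD (fun t => f t = g t) ->
  \int[mu]_(t in D) f t = \int[mu]_(t in D) g t.
Proof.
move=> fi gi fg; apply/eqP; rewrite eq_le !Rint_le_ae//;
  by apply: aeD_imp fg => t _ ->.
Qed.

Lemma Rint_abs_le f : integ f -> `|\int[mu]_(t in D) f t| <= \int[mu]_(t in D) `|f t|.
Proof. exact: le_normr_Rintegral. Qed.

Lemma Rint_eq0_ae f : integ f -> (forall t, D t -> 0 <= f t) ->
  \int[mu]_(t in D) f t <= 0 -> aeD (fun t => f t = 0).
Proof.
move=> fi f0 h.
have e : (\int[mu]_(t in D) `|(f t)%:E| = 0)%E.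
  rewrite (@eq_integral _ _ _ mu D (fun t => (f t)%:E)); last first.
    by move=> t /set_mem Dt /=; rewrite ger0_norm// f0.
  rewrite Rint_EFin//; congr EFin; apply/eqP; rewrite eq_le h/=.
  by apply: Rint_ge0_ae => //; exact: aeD_forall.
have /ae_eq_integral_abs := e.
move=> /(_ mD (measurable_int _ fi)); apply: aeD_imp => t Dt /=.
by move=> -[].
Qed.

Lemma Rint_dominated (f_ : nat -> R -> R) (f g : R -> R) :
  (forall n, measurable_fun D (f_ n)) -> (forall t, D t -> f_ n t @[n --> \oo] --> f t) ->
  integ g -> (forall n t, D t -> `|f_ n t| <= g t) ->
  integ f /\ \int[mu]_(t in D) f_ n t @[n --> \oo] --> \int[mu]_(t in D) f t.
Proof.
move=> mf ff gi fg.
have f_i n : integ (f_ n) by apply: integ_le (fg n) gi.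
have mf' : measurable_fun D f by exact: measurable_fun_cvg ff.
have fi : integ f.
  apply: integ_le gi => // t Dt.
  by apply: ler_cvg_to (cvg_norm (ff t Dt)) (cvg_cst _) _; near=> n; exact: fg.
split=> //.
have h := @dominated_cvg _ _ _ mu D mD (fun n t => (f_ n t)%:E) (EFin \o f) (EFin \o g).
have {}h : (\int[mu]_(t in D) (f_ n t)%:E @[n --> \oo] --> \int[mu]_(t in D) (f t)%:E)%E.
  apply: h => //.
  - by move=> n; exact: measurable_int (f_i n).
  - move=> t Dt; apply/cvg_EFin; first by near=> n.
    exact: ff.
rewrite Rint_EFin// in h.
by apply: fine_cvg h.
Unshelve. all: end_near. Qed.

Lemma aeD_null P : aeD P ->
  exists N : set R, [/\ measurable N, mu N = 0 & forall t, D t -> ~ N t -> P t].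
Proof.
move=> [N [mN N0 h]]; exists N; split=> // t Dt Nt.
by apply: contrapT => Pt; apply: Nt; apply: h => /= /(_ Dt).
Qed.

Lemma null_aeD (N : set R) P : measurable N -> mu N = 0 ->
  (forall t, D t -> ~ N t -> P t) -> aeD P.
Proof.
move=> mN N0 h; exists N; split=> // t /= nP; apply: contrapT => Nt.
by apply: nP => Dt; exact: h.
Qed.

Lemma limn_einf_le (u : (\bar R)^nat) (c : \bar R) :
  (forall n, (u n <= c)%E) -> (limn_einf u <= c)%E.
Proof.
move=> uc; rewrite limn_einf_lim; apply: lime_le; first exact: is_cvg_einfs.
by apply: nearW => n; apply: ge_ereal_inf; exists (u n) => //; exists n => //=.
Qed.

Lemma measurable_if_mem (N : set R) f g : measurable N -> measurable_fun D f ->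
  measurable_fun D g -> measurable_fun D (fun t => if t \in N then f t else g t).
Proof.
move=> mN mf mg _ Y mY.
rewrite (_ : _ `&` _ = ((D `&` f @^-1` Y) `&` N) `|` ((D `&` g @^-1` Y) `&` ~` N)).
  apply: measurableU; apply: measurableI => //;
    [exact: mf|exact: mg|exact: measurableC].
apply/seteqP; split=> t /=.
  move=> [Dt]; case: ifPn => [/set_mem ? ?|/negP Nt ?]; [by left|right].
  by split=> // Nt'; apply: Nt; exact/mem_set.
by move=> [[[? ?] /mem_set ->]//|[[? ?] Nt]]; rewrite memNset.
Qed.

(** Fatou's lemma, after replacing the functions by their limit on a measurable null set
    outside which they converge. *)
Lemma Rint_fatou (f_ : nat -> R -> R) f (c : R) :
  measurable_fun D f -> (forall t, D t -> 0 <= f t) ->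
  (forall n, integ (f_ n)) -> (forall n t, D t -> 0 <= f_ n t) ->
  aeD (fun t => f_ n t @[n --> \oo] --> f t) ->
  (forall n, \int[mu]_(t in D) f_ n t <= c) ->
  integ f /\ \int[mu]_(t in D) f t <= c.
Proof.
move=> mf f0 fi fn0 /aeD_null[N [mN N0 ff]] fc.
pose h (n : nat) (t : R) : R := if t \in N then f t else f_ n t.
have mh n : measurable_fun D (h n).
  by apply: measurable_if_mem => //; exact: integ_measurable.
have hE n : (\int[mu]_(t in D) (h n t)%:E = \int[mu]_(t in D) (f_ n t)%:E)%E.
  apply: ae_eq_integral => //; [exact: measurable_EFin|exact: measurable_int (fi n)|].
  by apply: (null_aeD mN N0) => t Dt Nt; rewrite /h memNset.
have H : (\int[mu]_(t in D) (f t)%:E <= c%:E)%E.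
  rewrite (@eq_integral _ _ _ mu D (fun t => limn_einf (fun n => (h n t)%:E))); last first.
    move=> t /set_mem Dt; symmetry.
    suff H : (h n t)%:E @[n --> \oo] --> (f t)%:E by have [-> _] := cvg_limn_einf_sup H.
    apply/cvg_EFin; first by near=> n.
    have [Nt|/negP Nt] := boolP (t \in N); rewrite /comp /h.
      by rewrite Nt; exact: cvg_cst.
    rewrite (negbTE (introN idP Nt)); apply: ff => // Nt'.
    by apply: Nt; exact/mem_set.
  apply: (le_trans (@fatou _ _ _ mu D mD (fun n t => (h n t)%:E) _ _)).
  - by move=> n; exact: measurable_EFin.
  - by move=> n t Dt; rewrite lee_fin /h; case: ifP => _; [exact: f0|exact: fn0].
  - apply: limn_einf_le => n; rewrite hE Rint_EFin// lee_fin; exact: fc.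
have fint : integ f by apply: integ_ge0P => //; apply: le_lt_trans H _; rewrite ltry.
by split=> //; rewrite -lee_fin -Rint_EFin.
Unshelve. all: end_near. Qed.

End RealIntegral.

Section StrongApproximation.
Context {R : realType}.
Local Notation mu := (@lebesgue_measure R).
Variable D : set R.
Hypothesis mD : measurable D.
Local Notation integ := (integ D).
Local Notation aeD := (aeD D).

Lemma simple_sm {V : normedModType R} (s : R -> V) : simple_fun s -> strongly_measurable D s.
Proof. by move=> ss; exists (fun _ => s); split=> // t _; exact: cvg_cst. Qed.

(** The approximations are cut off where they exceed [2 |f|], which happens for finitely
    many indices at each point where [f] does not vanish. *)
Lemma sm_dominated_approx {V : normedModType R} (f : R -> V) :
  strongly_measurable D f ->
  exists s : nat -> R -> V, [/\ forall n, simple_fun (s n),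
    forall t, D t -> s n t @[n --> \oo] --> f t &
    forall n t, D t -> `|s n t| <= 2 * `|f t|].
Proof.
move=> mf; have [s [ss sf]] := mf.
pose A n := D `&` [set t | `|s n t| <= 2 * `|f t|].
have mA n : measurable (A n).
  have mf2 : measurable_fun D (fun t => 2 * `|f t|).
    by apply: measurable_funM => //; exact: sm_norm mf.
  by apply: measurable_fun_le => //; exact: simple_measurable.
exists (fun n t => if t \in A n then s n t else 0); split=> [n|t Dt|n t Dt].
- by apply: simple_if => //; exact: simple_cst.
- have [ft0|ft0] := eqVneq (f t) 0.
    rewrite ft0 (_ : (fun n => _) = cst 0); first exact: cvg_cst.
    apply/funext => n /=; case: ifP => // /set_mem[_ /=].
    by rewrite ft0 normr0 mulr0 normr_le0 => /eqP.
  apply/cvgrPdist_lt => e e0.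
  have fp : 0 < `|f t| by rewrite normr_gt0.
  have /cvgrPdist_lt /(_ (Num.min e `|f t|)) := sf t Dt.
  rewrite lt_min e0 fp => /(_ isT); apply: filterS => n; rewrite lt_min => /andP[h1 h2].
  rewrite mem_set//; split=> //=.
  have := ler_distD (f t) (s n t) 0; rewrite !subr0 distrC => h3.
  by apply: le_trans h3 _; rewrite mulr_natl mulr2n lerD2r ltW.
- case: ifP => [/set_mem[_ //]|_]; by rewrite normr0 mulr_ge0.
Qed.

Lemma half_pow_cvg (c : R) : c * 2^-1 ^+ n @[n --> \oo] --> (0 : R).
Proof.
rewrite -(mulr0 c); apply: cvgM; first exact: cvg_cst.
by apply: cvg_expr; rewrite gtr0_norm ?invr_gt0// invf_lt1// ltr1n.
Qed.

(** The heart of the completeness of the spaces [L^1] and [L^2]: a sequence whose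
    consecutive differences have geometrically decreasing [L^1] norms converges
    almost everywhere and in [L^1]. *)
Lemma fast_cauchy_ae {V : completeNormedModType R} (w : nat -> R -> V) (c : R) :
  (forall n, strongly_measurable D (w n)) ->
  (forall n, integ (fun t => `|w n.+1 t - w n t|)) ->
  (forall n, \int[mu]_(t in D) `|w n.+1 t - w n t| <= c * 2^-1 ^+ n) ->
  exists w' : R -> V, [/\ strongly_measurable D w',
    aeD (fun t => w n t @[n --> \oo] --> w' t) &
    forall n, integ (fun t => `|w' t - w n t|) /\
      \int[mu]_(t in D) `|w' t - w n t| <= 2 * c * 2^-1 ^+ n].
Proof.
move=> mw iw cw.
pose d (n : nat) (t : R) : R := `|w n.+1 t - w n t|.
have d0 n t : 0 <= d n t by exact: normr_ge0.
have c0 : 0 <= c.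
  by have := cw 0%N; rewrite expr0 mulr1; apply: le_trans; exact: Rintegral_ge0.
(* the total variation of the sequence has a finite integral *)
have d_fin : aeD (fun t => (\sum_(0 <= n <oo) (d n t)%:E < +oo)%E).
  pose G (t : R) := (\sum_(0 <= n <oo) (d n t)%:E)%E.
  have mG : @measurable_fun _ _ (measurableTypeR R) _ D G.
    apply: (@ge0_emeasurable_sum _ (measurableTypeR R) _ D (fun n t => (d n t)%:E) xpredT) => [n t Dt _|n _].
      by rewrite lee_fin d0.
    exact: measurable_int (iw n).
  have G0 t : (0 <= G t)%E by apply: nneseries_ge0 => n _ _; rewrite lee_fin d0.
  have intG : (\int[mu]_(t in D) G t <= (2 * c)%:E)%E.
    rewrite /G (@integral_nneseries _ _ _ mu D mD (fun n t => (d n t)%:E))//; first last.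
    - by move=> n t _; rewrite lee_fin d0.
    - by move=> n; exact: measurable_int (iw n).
    apply: lime_le.
      by apply: is_cvg_nneseries => n _ _; apply: integral_ge0 => t _; rewrite lee_fin d0.
    apply: nearW => N.
    have : (\sum_(0 <= n < N) \int[mu]_(t in D) (d n t)%:E
              <= (2 * c - 2 * c * 2^-1 ^+ N)%:E)%E.
      elim: N => [|N IH]; first by rewrite big_nil expr0 mulr1 subrr.
      rewrite big_nat_recr//=.
      have h : (\int[mu]_(t in D) (d N t)%:E <= (c * 2^-1 ^+ N)%:E)%E.
        by rewrite (Rint_EFin mD (iw N)) lee_fin; exact: cw.
      apply: le_trans (leeD IH h) _; rewrite -EFinD lee_fin exprS.
      by move: (2^-1 ^+ N) => x; lra.
    move/le_trans; apply; rewrite lee_fin lerBlDl lerDr.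
    by rewrite mulr_ge0 ?exprn_ge0// mulr_ge0.
  have iG : mu.-integrable D G.
    apply/integrableP; split=> //.
    rewrite (@eq_integral _ _ _ mu D G); first by apply: le_lt_trans intG _; rewrite ltry.
    by move=> t _; rewrite gee0_abs.
  have := @integrable_ae _ _ _ mu D mD G iG.
  by apply: (@aeD_imp _ D (fun t => G t \is a fin_num)) => t Dt; rewrite ge0_fin_numE.
have [N [mN N0 hN]] := aeD_null d_fin.
pose w' (t : R) : V := if t \in N then 0 else lim (w n t @[n --> \oo]).
have wc t : D t -> ~ N t -> w n t @[n --> \oo] --> lim (w n t @[n --> \oo]).
  move=> Dt Nt; pose s n := \sum_(0 <= k < n) d k t.
  have s_homo : nondecreasing_seq s.
    apply/nondecreasing_seqP => n; rewrite /s big_nat_recr//= lerDl; exact: normr_ge0.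
  have s_cvg : cvgn s.
    apply: nondecreasing_is_cvgn => //.
    have Gt := hN t Dt Nt.
    exists (fine (\sum_(0 <= n <oo) (d n t)%:E)%E) => _ [n _ <-].
    rewrite -lee_fin fineK; last first.
      by rewrite ge0_fin_numE//; apply: nneseries_ge0 => k _ _; rewrite lee_fin d0.
    rewrite /s -sumEFin; by apply: nneseries_lim_ge => k _ _; rewrite lee_fin d0.
  apply: (@cauchy_tail_cvg _ _ _ (fun n => lim (s @ \oo) - s n)); last first.
    by rewrite -[X in _ --> X](subrr (lim (s @ \oo))); apply: cvgB => //; exact: cvg_cst.
  move=> n m nm; apply: (@le_trans _ _ (s m - s n)); last first.
    by rewrite lerD2r; exact: nondecreasing_cvgn_le.
  rewrite -(subnK nm); elim: (m - n)%N => [|k IH]; first by rewrite !subrr normr0.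
  rewrite addSn [s _.+1]big_nat_recr//= -/(s _) addrAC.
  apply: le_trans (ler_distD (w (k + n)%N t) _ _) _; apply: lerD => //.
  by rewrite distrC.
have w'c : aeD (fun t => w n t @[n --> \oo] --> w' t).
  by apply: (null_aeD mN N0) => t Dt Nt; rewrite /w' memNset//; exact: wc.
have mw' : strongly_measurable D w'.
  apply: (@sm_lim _ D mD _ (fun n t => if t \in N then 0 else w n t)).
    by move=> n; apply: sm_if => //; exact: sm_cst.
  move=> t Dt; rewrite /w'; have [tN|tN] := boolP (t \in N); first exact: cvg_cst.
  by apply: wc => // /mem_set tN'; rewrite tN' in tN.
exists w'; split=> // n.
have step m : integ (fun t => `|w (m + n)%N t - w n t|) /\
    \int[mu]_(t in D) `|w (m + n)%N t - w n t| <=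
      2 * c * 2^-1 ^+ n - 2 * c * 2^-1 ^+ (m + n).
  elim: m => [|m [IH1 IH2]].
    rewrite add0n subrr (_ : (fun t => _) = cst 0); last first.
      by apply/funext => t /=; rewrite subrr normr0.
    split; first exact: integrable0.
    by rewrite Rintegral_cst// mul0r.
  have tri t : `|w (m.+1 + n)%N t - w n t| <= `|w (m + n)%N t - w n t| + d (m + n)%N t.
    by rewrite addSn [leRHS]addrC; exact: (ler_distD (w (m + n)%N t)).
  have isum := integD mD IH1 (iw (m + n)%N).
  have i1 : integ (fun t => `|w (m.+1 + n)%N t - w n t|).
    apply: integ_le isum => //; first by apply: sm_norm => //; exact: smB.
    by move=> t Dt; rewrite normr_id.
  split=> //.
  apply: (@le_trans _ _ (\int[mu]_(t in D) (`|w (m + n)%N t - w n t| + d (m + n)%N t))).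
    by apply: le_Rintegral => // t Dt; exact: tri.
  rewrite (RintD mD IH1 (iw (m + n)%N)); apply: le_trans (lerD IH2 (cw (m + n)%N)) _.
  by rewrite addSn exprS; move: (2^-1 ^+ (m + n)) (2^-1 ^+ n) => x y; lra.
apply: (@Rint_fatou _ D mD (fun m t => `|w (m + n)%N t - w n t|)) => //.
- by apply: sm_norm => //; exact: smB.
- by move=> m; have [] := step m.
- apply: aeD_imp w'c => t Dt h; apply: cvg_norm; apply: cvgB; last exact: cvg_cst.
  by move: h; rewrite -(cvg_shiftn n).
- move=> m; have [_ h] := step m; apply: le_trans h _.
  by rewrite lerBlDl lerDr mulr_ge0 ?exprn_ge0// mulr_ge0.
Qed.

End StrongApproximation.

(** * The Bochner integral in a Hilbert space *)

Section Bochner.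
Context {R : realType} {H : hilbertType R}.
Local Notation mu := (@lebesgue_measure R).
Variable D : set R.
Hypotheses (mD : measurable D) (finD : (mu D < +oo)%E).
Local Notation integ := (integ D).

Lemma integ_cst (c : R) : integ (fun=> c).
Proof.
apply: measurable_bounded_integrable => //.
by exists `|c|; split; [exact: num_real|move=> x cx t _ /=; exact: ltW].
Qed.

Lemma integ_bounded (f : R -> R) (c : R) : measurable_fun D f ->
  (forall t, D t -> `|f t| <= c) -> integ f.
Proof. by move=> mf fc; apply: integ_le (integ_cst c). Qed.

Lemma measurable_inner (f g : R -> H) : strongly_measurable D f ->
  strongly_measurable D g -> measurable_fun D (fun t => inner (f t) (g t)).
Proof.
move=> mf mg; under eq_fun do rewrite inner_polar.
apply: measurable_funM => //.
by apply: measurable_funB; [apply: measurable_funB|];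
  apply: measurable_funX; apply: sm_norm => //; exact: smD.
Qed.

Lemma simple_bounded (s : R -> H) : simple_fun s -> exists c, forall t, `|s t| <= c.
Proof.
move=> [sf _].
have [c hc] : exists c, forall x, range s x -> `|x| <= c.
  have /finite_seqP[r rE] := sf.
  exists (\sum_(x <- r) `|x|) => x; rewrite rE /= => xr.
  by rewrite (big_rem _ xr)/= lerDl sumr_ge0.
by exists c => t; apply: hc; exists t.
Qed.

Lemma simple_integral_weak (s : R -> H) p : simple_fun s ->
  inner (simple_integral D s) p = \int[mu]_(t in D) inner (s t) p.
Proof.
move=> ss; rewrite /simple_integral fsbig_finite; last by case: ss.
set r : seq H := finmap.enum_fset _.
have ur : uniq r by exact: finmap.fset_uniq.
have mem_r x : (x \in r) = (x \in range s) by apply: in_fset_set; case: ss.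
have ms x : measurable (D `&` s @^-1` [set x]) by apply: measurableI => //; case: ss.
rewrite (_ : inner _ p =
  \sum_(x <- r) fine (mu (D `&` s @^-1` [set x])) * inner x p); last first.
  elim/big_rec2: _ => [|x a b _ <-]; first by rewrite inner0l.
  by rewrite innerDl innerZl.
pose h (x : H) (t : R) : R := inner x p * \1_(s @^-1` [set x]) t.
have ih x : integ (h x).
  apply: (@integ_bounded _ `|inner x p|).
    apply: measurable_funM => //; apply: measurable_indic; by case: ss.
  by move=> t _; rewrite /h normrM indicE; case: (_ \in _); rewrite ?normr1 ?normr0 ?mulr1 ?mulr0.
have Rint_h x : \int[mu]_(t in D) h x t = fine (mu (D `&` s @^-1` [set x])) * inner x p.
  rewrite /h (RintZ mD); last first.
    apply: (@integ_bounded _ 1); first by apply: measurable_indic; case: ss.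
    by move=> t _; rewrite indicE; case: (_ \in _); rewrite ?normr1 ?normr0.
  rewrite mulrC; congr (_ * _).
  have mx : measurable (s @^-1` [set x]) by case: ss.
  by rewrite /Rintegral (@integral_indic _ _ _ mu D mD _ mx) setIC.
rewrite (eq_bigr (fun x => \int[mu]_(t in D) h x t)) => [|x _]; last by rewrite Rint_h.
have sum_h (l : seq H) : integ (fun t => \sum_(x <- l) h x t) /\
    \sum_(x <- l) \int[mu]_(t in D) h x t = \int[mu]_(t in D) \sum_(x <- l) h x t.
  elim: l => [|x l [IH1 IH2]].
    under [fun t => _]eq_fun do rewrite big_nil; rewrite big_nil.
    split; first exact: integ_cst.
    by rewrite (@Rint_eq _ D _ (cst 0)) ?Rintegral_cst ?mul0r// => t _; rewrite big_nil.
  split.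
    by under eq_fun do rewrite big_cons; exact: integD.
  rewrite big_cons IH2 -(RintD mD (ih x) IH1); apply: Rint_eq => t _.
  by rewrite big_cons.
have [_ ->] := sum_h r; apply: Rint_eq => t _.
have tr : s t \in r by rewrite mem_r inE; exists t.
rewrite (big_rem (s t) tr)/= big1_seq ?addr0.
  by rewrite /h indicE mem_set// mulr1.
move=> x /andP[_]; rewrite mem_rem_uniq// => /andP[xs _].
rewrite /h indicE memNset ?mulr0//= => xs'; by rewrite xs' eqxx in xs.
Qed.

Lemma integ_inner_l (f : R -> H) p : strongly_measurable D f ->
  integ (fun t => `|f t|) -> integ (fun t => inner (f t) p).
Proof.
move=> mf fi; apply: (@integ_le _ D mD _ (fun t => `|p| * `|f t|)).
- by apply: measurable_inner => //; exact: sm_cst.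
- by move=> t _; rewrite mulrC abs_inner_le_norm.
- exact: integZ.
Qed.

(** Pairing with a fixed vector commutes with the integral of simple functions, and
    passes to the limit on both sides. *)
Lemma bochner_weak (f : R -> H) z p : is_bochner_integral D f z ->
  integ (fun t => `|f t|) -> inner z p = \int[mu]_(t in D) inner (f t) p.
Proof.
move=> [mf [s [ss sf sz]]] fi.
have si n : integ (fun t => `|s n t|).
  have [c hc] := simple_bounded (ss n).
  by apply: (@integ_bounded _ c) => [|t _]; rewrite ?normr_id//; exact: simple_measurable.
have di n : integ (fun t => `|f t - s n t|).
  apply: (@integ_le _ D mD _ (fun t => `|f t| + `|s n t|)).
  - by apply: sm_norm => //; apply: smB => //; exact: simple_sm.
  - by move=> t _; rewrite normr_id ler_normB.
  - exact: integD.
have lim1 : \int[mu]_(t in D) inner (s n t) p @[n --> \oo] --> inner z p.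
  under eq_fun do rewrite -simple_integral_weak//.
  by apply: cvg_inner => //; exact: cvg_cst.
have lim0 : \int[mu]_(t in D) `|f t - s n t| * `|p| @[n --> \oo] --> 0 * `|p|.
  apply: cvgM; last exact: cvg_cst.
  by apply: fine_cvg; move: sf; rewrite /=.
have lim2 : \int[mu]_(t in D) inner (s n t) p @[n --> \oo] -->
    \int[mu]_(t in D) inner (f t) p.
  apply/cvgrPdist_le => e e0.
  rewrite mul0r in lim0; have /cvgrPdist_le /(_ e e0) := lim0.
  apply: filterS => n; rewrite sub0r normrN => h.
  have i1 := integ_inner_l p mf fi.
  have i2 := integ_inner_l p (simple_sm D (ss n)) (si n).
  rewrite -(RintB mD i1 i2); apply: le_trans (Rint_abs_le mD (integB mD i1 i2)) _.
  apply: le_trans (le_trans (ler_norm _) h).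
  rewrite mulrC -(RintZ mD _ (di n)); apply: Rint_le => //.
  - by apply: integ_norm => //; exact: integB.
  - exact: integZ.
  - by move=> t _; rewrite -innerBl mulrC abs_inner_le_norm.
exact: (cvg_unique _ lim1 lim2).
Qed.

(** The approximations are dominated by [2 |f|], and their integrals are seen to form
    a Cauchy sequence by pairing them with their own differences. *)
Lemma bochner_exists (f : R -> H) : strongly_measurable D f ->
  integ (fun t => `|f t|) -> exists z, is_bochner_integral D f z.
Proof.
move=> mf fi; have [s [ss sf s2]] := sm_dominated_approx mD mf.
have si n : integ (fun t => `|s n t|).
  apply: (@integ_le _ D mD _ (fun t => 2 * `|f t|)).
  - exact: simple_measurable.
  - by move=> t Dt; rewrite normr_id s2.
  - exact: integZ.
have md n : strongly_measurable D (fun t => f t - s n t).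
  by apply: smB => //; exact: simple_sm.
have [_ d0] : integ (cst 0) /\
    \int[mu]_(t in D) `|f t - s n t| @[n --> \oo] --> \int[mu]_(t in D) cst 0 t.
  apply: (@Rint_dominated _ D mD (fun n t => `|f t - s n t|) _ (fun t => 3 * `|f t|)).
  - by move=> n; exact: sm_norm.
  - move=> t Dt; rewrite -(@normr0 _ H) -(subrr (f t)).
    by apply: cvg_norm; apply: cvgB; [exact: cvg_cst|exact: sf].
  - exact: integZ.
  - move=> n t Dt; rewrite normr_id; apply: le_trans (ler_normB _ _) _.
    by have := s2 n t Dt; lra.
rewrite Rintegral_cst// mul0r in d0.
have di n : integ (fun t => `|f t - s n t|).
  apply: (@integ_le _ D mD _ (fun t => `|f t| + `|s n t|)).
  - exact: sm_norm.
  - by move=> t _; rewrite normr_id ler_normB.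
  - exact: integD.
pose z n := simple_integral D (s n).
have zn n m : `|z n - z m| <= \int[mu]_(t in D) `|f t - s n t| +
    \int[mu]_(t in D) `|f t - s m t|.
  set c := (X in _ <= X).
  have c0 : 0 <= c by apply: addr_ge0; apply: Rintegral_ge0.
  have h p : inner (z n - z m) p <= `|p| * c.
    rewrite innerBl !simple_integral_weak//.
    have i1 := integ_inner_l p (simple_sm D (ss n)) (si n).
    have i2 := integ_inner_l p (simple_sm D (ss m)) (si m).
    rewrite -(RintB mD i1 i2) /c -(RintD mD (di n) (di m)) -(RintZ mD _ (integD mD (di n) (di m))).
    apply: Rint_le => //; first exact: integB.
      by apply: integZ => //; exact: integD.
    move=> t _; rewrite -innerBl; apply: le_trans (inner_le_norm _ _) _.
    rewrite mulrC ler_wpM2l//; apply: le_trans (ler_distD (f t) _ _) _.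
    by rewrite distrC.
  have [->|zn0] := eqVneq (z n - z m) 0; first by rewrite normr0.
  have zp : 0 < `|z n - z m| by rewrite normr_gt0.
  by have := h (z n - z m); rewrite inner_norm expr2 ler_pM2l.
have zc : cvg (z @ \oo).
  apply/cauchy_cvgP/cauchy_exP => e e0.
  have /cvgrPdist_lt /(_ (e / 2)) := d0; rewrite divr_gt0// => /(_ isT)[N _ hN].
  have hN' n : (N <= n)%N -> \int[mu]_(t in D) `|f t - s n t| < e / 2.
    move=> /hN /=; rewrite sub0r normrN; apply: le_lt_trans; exact: ler_norm.
  exists (z N), N => // n /= Nn; rewrite -ball_normE /=.
  by apply: le_lt_trans (zn _ _) _; rewrite (splitr e) ltrD// hN'.
exists (lim (z @ \oo)); split=> //; exists s; split=> //.
have -> : (fun n => \int[mu]_(t in D) `|f t - s n t|%:E)%E =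
    (fun n => (\int[mu]_(t in D) `|f t - s n t|)%:E).
  by apply/funext => n; rewrite (Rint_EFin mD (di n)).
by apply/cvg_EFin => //; exact: nearW.
Qed.

(** As pairings determine a vector, this identity characterises the integral. *)
Lemma bochner_integral_weak (f : R -> H) p : strongly_measurable D f ->
  integ (fun t => `|f t|) ->
  inner (bochner_integral D f) p = \int[mu]_(t in D) inner (f t) p.
Proof.
move=> mf fi; apply: bochner_weak => //.
by apply: xgetPex; exact: bochner_exists.
Qed.

End Bochner.

(** * Semigroups and their adjoints *)

Section Semigroup.
Context {R : realType} {X : hilbertType R}.
Variable S : R -> X -> X.
Hypothesis HS : C0_semigroup S.

Lemma sg_bounded_op t : 0 <= t -> exists2 M, 0 <= M & bounded_op (S t) M.
Proof.
by move=> t0; apply: linear_bounded; [exact: (C0_linear HS)|exact: (C0_bounded HS)].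
Qed.

Lemma sg_near0 x (e : R) : 0 < e -> exists2 d : R, 0 < d &
  forall t, 0 <= t -> t < d -> `|S t x - x| < e.
Proof.
move=> e0; have /cvgrPdist_lt /(_ e e0) := @C0_continuous _ _ _ HS x.
move=> [d /= d0 hd].
exists d => // t; rewrite le_eqVlt => /orP[/eqP <-|t0] td.
  by rewrite (C0_id HS) subrr normr0.
by rewrite distrC; apply: hd => //; rewrite /ball /= sub0r normrN gtr0_norm.
Qed.

(** Uniform boundedness: were there no bound near [0], a sequence of times tending to [0]
    would carry operators of unbounded norms that are pointwise bounded by strong
    continuity. *)
Lemma sg_bound_near0 : exists d M : R, [/\ 0 < d, 0 <= M &
  forall t, 0 <= t -> t <= d -> bounded_op (S t) M].
Proof.
apply: contrapT => nh.
have /choice[u uP] (n : nat) : exists tx : R * X,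
    [/\ 0 <= tx.1, tx.1 <= n.+1%:R^-1 & n%:R * `|tx.2| < `|S tx.1 tx.2| ].
  apply: contrapT => hn; apply: nh; exists n.+1%:R^-1, n%:R; split=> // t t0 tn x.
  by rewrite leNgt; apply/negP => h; apply: hn; exists (t, x).
pose F := [set S (u n).1 | n in [set: nat]].
have FB : forall f, F f -> bounded_fun_norm f /\ linear f.
  move=> _ [n _ <-]; have [un0 _ _] := uP n; split; last exact: (C0_linear HS).
  move=> r; have [M M0 hM] := sg_bounded_op un0; exists (M * r) => x xr.
  by apply: le_trans (hM x) _; rewrite ler_wpM2l.
have FP : pointwise_bounded F.
  move=> x; have [d d0 hd] := sg_near0 x (@ltr01 R).
  have [N _ hN] : \forall n \near \oo, (n.+1%:R^-1 : R) < d.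
    have /cvgrPdist_lt /(_ d d0) := @cvg_invn R 1.
    by apply: filterS => n; rewrite sub0r normrN mul1r ger0_norm.
  pose c := 1 + `|x| + \sum_(i < N) `|S (u i).1 x|; exists c => _ [n _ <-].
  have s0 : 0 <= \sum_(i < N) `|S (u i).1 x| by apply: sumr_ge0.
  have [nN|Nn] := ltnP n N.
    rewrite /c (bigD1 (Ordinal nN))//= addrCA lerDl addr_ge0 ?addr_ge0//.
    exact: sumr_ge0.
  have [un0 un1 _] := uP n.
  have := hd _ un0 (le_lt_trans un1 (hN n Nn)).
  have := ler_distD x (S (u n).1 x) 0; rewrite !subr0 /c; lra.
have [M hM] := Banach_Steinhauss FB FP 1.
have [N _ hN] : \forall n \near \oo, M < n%:R.
  by have /cvgryPgt := @cvgr_idn R; apply.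
have [uN0 _ uN] := uP N; set x := (u N).2 in uN.
have xp : 0 < `|x|.
  rewrite normr_gt0; apply/eqP => x0; move: uN; rewrite x0.
  by rewrite (linear_zero (C0_linear HS uN0)) normr0 mulr0 ltxx.
have := hM (S (u N).1) (ex_intro2 _ _ N I erefl) (`|x|^-1 *: x).
rewrite normrZ normfV normr_id mulVf ?gt_eqF// lexx => /(_ isT).
rewrite (linear_scale (C0_linear HS uN0)) normrZ normfV normr_id ler_pdivrMl// => h.
have := hN N (leqnn N) => /= h2.
by nra.
Qed.

(** Powers of the bound near [0], by the semigroup law. *)
Lemma sg_bound (T : R) : exists2 M, 0 <= M &
  forall t, 0 <= t -> t <= T -> bounded_op (S t) M.
Proof.
have [d [M [d0 M0 hM]]] := sg_bound_near0.
pose N := Num.max 1 M.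
have N1 : 1 <= N by rewrite le_max lexx.
have N0 : 0 <= N by apply: le_trans N1.
have hN t : 0 <= t -> t <= d -> bounded_op (S t) N.
  by move=> t0 td x; apply: le_trans (hM t t0 td x) _; rewrite ler_wpM2r// le_max lexx orbT.
have step n t : 0 <= t -> t <= n%:R * d -> bounded_op (S t) (N ^+ n).
  elim: n t => [|n IH] t t0 tn x.
    have -> : t = 0 by apply/eqP; rewrite eq_le t0 andbT; move: tn; rewrite mul0r.
    by rewrite (C0_id HS) expr0 mul1r.
  have [td|dt] := leP t d.
    apply: le_trans (hN t t0 td x) _; rewrite ler_wpM2r// exprS ler_peMr//.
    exact: exprn_ege1.
  have td0 : 0 <= t - d by rewrite subr_ge0 ltW.
  rewrite -(subrK d t) (C0_add HS x td0 (ltW d0)) exprSr -mulrA.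
  apply: le_trans (IH _ td0 _ (S d x)) _.
    by rewrite lerBlDr -[X in _ + X]mul1r -mulrDl natr1.
  by rewrite ler_wpM2l ?exprn_ge0// hN// ltW.
pose n := (Num.truncn (T / d)).+1.
exists (N ^+ n); first exact: exprn_ge0.
move=> t t0 tT; apply: step => //; apply: le_trans tT _.
by rewrite -ler_pdivrMr// ltW// truncnS_gt.
Qed.

Lemma sg_dist (T M a b : R) x : (forall t, 0 <= t -> t <= T -> bounded_op (S t) M) ->
  0 <= a -> a <= T -> 0 <= b -> b <= T -> `|S a x - S b x| <= M * `|S `|a - b| x - x|.
Proof.
have h c d : 0 <= c -> c <= d -> d <= T ->
    (forall t, 0 <= t -> t <= T -> bounded_op (S t) M) ->
    `|S c x - S d x| <= M * `|S `|c - d| x - x|.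
  move=> c0 cd dT hM; rewrite (distrC c) ger0_norm ?subr_ge0//.
  have dc : 0 <= d - c by rewrite subr_ge0.
  have -> : S d x = S c (S (d - c) x) by rewrite -(C0_add HS x c0 dc) addrC subrK.
  rewrite -(linear_sub (C0_linear HS c0)) (distrC _ x); apply: hM => //; exact: le_trans dT.
move=> hM a0 aT b0 bT; case: (leP a b) => [ab|/ltW ab]; first exact: h.
by rewrite distrC (distrC a); exact: h.
Qed.

(** By joint continuity of [(t, x) |-> S t x], times being clamped to [[0, T]] to have
    continuity on the whole line. *)
Lemma semigroup_sm (T : R) (g : R -> X) : 0 < T ->
  strongly_measurable `]0, T[ g -> strongly_measurable `]0, T[ (fun t => S (T - t) (g t)).
Proof.
move=> T0 mg; have [M M0 hM] := sg_bound T.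
pose clamp (t : R) : R := Num.max 0 (Num.min t T).
have clampP t : 0 <= T - clamp t /\ T - clamp t <= T.
  rewrite subr_ge0 lerBlDr lerDl /clamp le_max lexx ge_max ge_min lexx orbT andbT.
  by split=> //; exact: ltW.
have clamp_id t : `]0, T[%classic t -> clamp t = t.
  rewrite /= in_itv /= => /andP[t0 tT].
  by rewrite /clamp (min_idPl (ltW tT)) (max_idPr (ltW t0)).
have clamp_cont : continuous clamp.
  move=> t; apply: (@continuous_max _ _ (cst 0) (fun t => Num.min t T)); first exact: cvg_cst.
  by apply: (@continuous_min _ _ id (cst T)); [exact: cvg_id|exact: cvg_cst].
apply: (@sm_eq _ _ _ (fun t => S (T - clamp t) (g t))).
  by move=> t /clamp_id ->.
apply: (@sm_comp2 _ _ R^o X X (fun (t : R^o) x => S (T - clamp t) x) id g) => //.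
  move=> t a x _ at_ xg; apply/cvgrPdist_le => e e0.
  have M1 : 0 < M + 1 by rewrite ltr_wpDl.
  have e2 : 0 < e / 2 / (M + 1) by rewrite !divr_gt0.
  have [d d0 hd] := sg_near0 (g t) e2.
  have clc : clamp (a n) @[n --> \oo] --> clamp t.
    by apply: cvg_comp at_ _; exact: clamp_cont.
  have /cvgrPdist_lt /(_ d d0) h1 := clc.
  have /cvgrPdist_lt /(_ _ e2) h2 := xg.
  near=> n.
  have d1 : `|clamp t - clamp (a n)| < d by near: n; exact: h1.
  have d2 : `|g t - x n| < e / 2 / (M + 1) by near: n; exact: h2.
  have [c1 c2] := clampP t; have [c3 c4] := clampP (a n).
  apply: le_trans (ler_distD (S (T - clamp (a n)) (g t)) _ _) _.
  have b1 : `|S (T - clamp t) (g t) - S (T - clamp (a n)) (g t)| <= e / 2.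
    apply: le_trans (sg_dist _ hM c1 c2 c3 c4) _.
    have -> : T - clamp t - (T - clamp (a n)) = clamp (a n) - clamp t by lra.
    rewrite (distrC (clamp (a n))); have := hd _ (normr_ge0 _) d1.
    move: (`|S _ _ - _|) (normr_ge0 (S `|clamp t - clamp (a n)| (g t) - g t)) => r r0.
    by rewrite ltr_pdivlMr// => h; nra.
  have b2 : `|S (T - clamp (a n)) (g t) - S (T - clamp (a n)) (x n)| <= e / 2.
    rewrite -(linear_sub (C0_linear HS c3)); apply: le_trans (hM _ c3 c4 _) _.
    move: d2; rewrite ltr_pdivlMr//; move: (`|g t - x n|) (normr_ge0 (g t - x n)) => r r0 h.
    by nra.
  by rewrite (splitr e) lerD.
exact: sm_id.
Unshelve. all: end_near. Qed.

End Semigroup.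

Lemma bounded_op_continuous {R : realType} {V W : normedModType R} (f : V -> W) (M : R) :
  linear f -> bounded_op f M -> continuous f.
Proof.
move=> fl fM x; apply/cvgrPdist_le => e e0.
pose N := Num.max M 1.
have N0 : 0 < N by rewrite lt_max ltr01 orbT.
have h : x' @[x' --> x] --> x by exact: cvg_id.
have /cvgrPdist_lt /(_ (e / N)) := h.
rewrite divr_gt0// => /(_ isT); apply: filterS => y /=.
rewrite ltr_pdivlMr// => xy.
rewrite -(linear_sub fl); apply: le_trans (fM _) _; apply: le_trans (ltW xy).
by rewrite mulrC ler_wpM2l// le_max lexx.
Qed.

Section AdjointSemigroup.
Context {R : realType} {X : hilbertType R}.
Local Notation mu := (@lebesgue_measure R).
Variable S : R -> X -> X.
Hypothesis HS : C0_semigroup S.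
Local Notation Sa t := (adjoint (S t)).

Lemma sg_adjointP t x y : 0 <= t -> inner (S t x) y = inner x (Sa t y).
Proof.
move=> t0; have [M M0 hM] := sg_bounded_op HS t0.
by rewrite (adjointP (C0_linear HS t0) hM).
Qed.

Lemma sg_adjoint_linear t : 0 <= t -> linear (Sa t).
Proof.
move=> t0; have [M M0 hM] := sg_bounded_op HS t0.
exact: (adjoint_linear (C0_linear HS t0) hM).
Qed.

Lemma sg_adjoint_bounded t M : 0 <= t -> 0 <= M -> bounded_op (S t) M -> bounded_op (Sa t) M.
Proof. by move=> t0 M0 hM; exact: (adjoint_bounded M0 (C0_linear HS t0) hM). Qed.

Lemma orbit_inner_continuous x y : continuous (fun s : R => inner (S `|s| x) y : R^o).
Proof.
move=> s.
have Sc : (fun s : R => S `|s| x) @ s --> S `|s| x.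
  have [M M0 hM] := sg_bound HS (`|s| + 1).
  apply/cvgrPdist_le => e e0.
  have M1 : 0 < M + 1 by rewrite ltr_wpDl.
  have [d d0 hd] := sg_near0 HS x (divr_gt0 e0 M1).
  have /cvgrPdist_lt h : t @[t --> s] --> s by exact: cvg_id.
  have {}h := h (Num.min d 1) _.
  have := h ltac:(by rewrite lt_min d0 ltr01); apply: filterS => t.
  rewrite lt_min => /andP[st1 st2].
  have ts : `|t| <= `|s| + 1.
    by have := ler_distD s t 0; rewrite !subr0 distrC; lra.
  apply: le_trans (sg_dist HS x hM _ _ _ _) _ => //; first by rewrite lerDl.
  have := hd `| `|s| - `|t| | (normr_ge0 _) (le_lt_trans (ler_dist_dist _ _) st1).
  rewrite ltr_pdivlMr//; move: (`|S _ _ - x|) (normr_ge0 (S `| `|s| - `|t| | x - x)) => r r0.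
  by nra.
by apply: cvg_inner => //; exact: cvg_cst.
Qed.

Lemma integ_continuous (g : R -> R) (a b : R) : continuous (g : R -> R^o) ->
  integ `[a, b] g.
Proof.
move=> gc; apply: continuous_compact_integrable; first exact: segment_compact.
by apply: continuous_subspaceT.
Qed.

Lemma Rint_itv_le (g : R -> R) (a b c : R) : continuous (g : R -> R^o) -> a <= b ->
  (forall s, a <= s -> s <= b -> `|g s| <= c) ->
  `|\int[mu]_(s in `[a, b]) g s| <= (b - a) * c.
Proof.
move=> gc ab gc'; have gi := integ_continuous a b gc.
have mitv : measurable (`[a, b]%classic : set R) by exact: measurable_itv.
apply: le_trans (Rint_abs_le mitv gi) _.
apply: (@le_trans _ _ (\int[mu]_(s in `[a, b]) cst c s)).
  apply: Rint_le => //; first exact: integ_norm.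
    apply: integ_cst => //; rewrite lebesgue_measure_itv/=.
    by case: ifP => _; rewrite ltry.
  by move=> s /=; rewrite in_itv/= => /andP[? ?]; exact: gc'.
rewrite Rintegral_cst//= lebesgue_measure_itv/= lte_fin mulrC.
have [ab'|ab'] := ltP a b; first by rewrite -EFinB.
by rewrite (@le_anti _ _ a b) ?ab// subrr !mul0r.
Qed.

Lemma Rint_shift (g : R -> R) (a h : R) : continuous (g : R -> R^o) -> 0 <= a ->
  \int[mu]_(s in `[0, a]) g (s + h) = \int[mu]_(s in `[h, a + h]) g s.
Proof.
move=> gc a0; pose F (s : R) : R := s + h.
have [->|an0] := eqVneq a 0.
  by rewrite add0r !set_itv1 !Rintegral_set1.
have dF : derive1 F = cst 1.
  by apply/funext => s; rewrite derive1E deriveD// derive_id derive_cst addr0.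
have Fc : continuous F by move=> s; apply: cvgD; [exact: cvg_id|exact: cvg_cst].
have := @integration_by_substitution_increasing R F g 0 a a0.
rewrite dF /F add0r /Rintegral => ->.
- by congr fine; apply: eq_integral => s _ /=; rewrite mulr1.
- by move=> s t _ _ st; rewrite ltrD2r.
- by move=> s _; exact: cvg_cst.
- by apply/cvg_ex; exists 1; exact: cvg_cst.
- by apply/cvg_ex; exists 1; exact: cvg_cst.
- split=> [s _||]; first exact: derivableD.
    by apply: cvg_at_right_filter; exact: Fc.
  by apply: cvg_at_left_filter; exact: Fc.
- exact: continuous_subspaceT.
Qed.

(* A priori the orbits of the adjoint semigroup are only weakly continuous; this subspace
   will turn out to be the whole space. *)
Let Z := [set p | Sa t p @[t --> 0^'+] --> p].

Lemma at_right_lt (d : R) : 0 < d -> \forall t \near 0^'+, 0 < t < d.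
Proof.
move=> d0; near=> t; apply/andP; split; first by near: t; exact: nbhs_right_gt.
by near: t; exact: nbhs_right_lt.
Unshelve. all: end_near. Qed.

Lemma strong_continuity_lin (a b : R) x y : Z x -> Z y -> Z (a *: x + b *: y).
Proof.
move=> Zx Zy; rewrite /Z /=.
have lim : a *: Sa t x + b *: Sa t y @[t --> 0^'+] --> a *: x + b *: y.
  by apply: cvgD; apply: cvgZ => //; exact: cvg_cst.
apply: cvg_trans lim; apply: near_eq_cvg.
apply: filterS (nbhs_right_gt (0 : R)) => t t0.
by rewrite (sg_adjoint_linear (ltW t0)) (linear_scale (sg_adjoint_linear (ltW t0))).
Qed.

(** [w] is the weak average over [[0, a]] of the orbit of [x] under the adjoint
    semigroup.  Translating the integral by [h] changes it by two integrals over
    intervals of length [h], hence by [O(h)]. *)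
Lemma average_strongly_continuous x (a : R) : 0 < a -> exists2 w, Z w &
  forall y, inner y w = \int[mu]_(s in `[0, a]) inner (S `|s| y) x.
Proof.
move=> a0; have [M M0 hM] := sg_bound HS (a + a).
have aa : a <= a + a by rewrite lerDl ltW.
pose g y (s : R) : R := inner (S `|s| y) x.
have gc y : continuous (g y : R -> R^o) by exact: orbit_inner_continuous.
have gM y s : 0 <= s -> s <= a + a -> `|g y s| <= M * `|y| * `|x|.
  move=> s0 sa; rewrite /g (ger0_norm s0); apply: le_trans (abs_inner_le_norm _ _) _.
  by rewrite ler_wpM2r// hM.
have mitv : measurable (`[0, a]%classic : set R) by exact: measurable_itv.
have [w wP] : exists w, forall y, \int[mu]_(s in `[0, a]) g y s = inner y w.
  apply: (@riesz _ _ _ (a * (M * `|x|))).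
    move=> k u v; have i := integ_continuous 0 a (gc _).
    rewrite -(RintZ mitv _ (i u)) -(RintD mitv (integZ mitv _ (i u)) (i v)).
    apply: Rint_eq => s _; rewrite /g (C0_linear HS (normr_ge0 s)).
    by rewrite innerDl innerZl.
  move=> y; apply: le_trans (Rint_itv_le (gc y) (ltW a0) _) _.
    by move=> s s0 sa; apply: gM => //; exact: le_trans aa.
  by rewrite subr0 -!mulrA (mulrC `|x|).
exists w; last by move=> y; rewrite -wP.
have wZ h : 0 < h -> h <= a -> `|Sa h w - w| <= h * (2 * M * `|x|).
  move=> h0 ha; have h0' := ltW h0.
  have key y : inner y (Sa h w - w) <= `|y| * (h * (2 * M * `|x|)).
    rewrite innerBr -sg_adjointP// -!wP.
    have -> : \int[mu]_(s in `[0, a]) g (S h y) s = \int[mu]_(s in `[h, a + h]) g y s.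
      rewrite -Rint_shift//; last exact: ltW.
      apply: Rint_eq => s /=; rewrite in_itv/= => /andP[s0 _].
      by rewrite /g (ger0_norm s0) (ger0_norm (addr_ge0 s0 h0')) (C0_add HS).
    have i b c := integ_continuous b c (gc y).
    have e1 : \int[mu]_(s in `[0, a + h]) g y s - \int[mu]_(s in `[0, h]) g y s =
        \int[mu]_(s in `[h, a + h]) g y s.
      rewrite Rintegral_itvB; [|exact: i|by rewrite bnd_simp|by rewrite bnd_simp lerDr ltW].
      rewrite Rintegral_itv_obnd_cbnd//.
      by apply: (@integrableS _ _ _ mu `[h, a + h]) (i _ _) => //; exact: subset_itv_oc_cc.
    have e2 : \int[mu]_(s in `[0, a + h]) g y s - \int[mu]_(s in `[0, a]) g y s =
        \int[mu]_(s in `[a, a + h]) g y s.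
      rewrite Rintegral_itvB; [|exact: i|by rewrite bnd_simp ltW|by rewrite bnd_simp lerDl ltW].
      rewrite Rintegral_itv_obnd_cbnd//.
      by apply: (@integrableS _ _ _ mu `[a, a + h]) (i _ _) => //; exact: subset_itv_oc_cc.
    have b1 : `|\int[mu]_(s in `[0, h]) g y s| <= (h - 0) * (M * `|y| * `|x|).
      by apply: Rint_itv_le => // s s0 sh; apply: gM => //; exact: le_trans (le_trans sh ha) aa.
    have b2 : `|\int[mu]_(s in `[a, a + h]) g y s| <= (a + h - a) * (M * `|y| * `|x|).
      apply: Rint_itv_le => //; first by rewrite lerDl.
      move=> s s0 sh; apply: gM; first exact: le_trans (ltW a0) s0.
      by apply: le_trans sh _; rewrite lerD2l.
    move: b1 b2; rewrite !ler_norml => /andP[b1 _] /andP[_ b2].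
    rewrite (_ : `|y| * _ = (h - 0) * (M * `|y| * `|x|) + (a + h - a) * (M * `|y| * `|x|)).
      move: e1 e2 b1 b2; move: (Rintegral _ _ _) (Rintegral _ _ _) (Rintegral _ _ _).
      by move=> i1 i2 i3; move: (Rintegral _ _ _) (Rintegral _ _ _) => i4 i5; lra.
    by ring.
  have [->|n0] := eqVneq (Sa h w - w) 0; first by rewrite normr0 !mulr_ge0.
  have np : 0 < `|Sa h w - w| by rewrite normr_gt0.
  by have := key (Sa h w - w); rewrite inner_norm expr2 ler_pM2l.
apply/cvgrPdist_le => e e0.
pose c := 2 * M * `|x| + 1.
have c0 : 0 < c by rewrite ltr_wpDl// !mulr_ge0.
have d0 : 0 < Num.min a (e / c) by rewrite lt_min a0 divr_gt0.
apply: filterS (at_right_lt d0) => h /andP[h0]; rewrite lt_min => /andP[ha hec].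
rewrite distrC; apply: le_trans (wZ h h0 (ltW ha)) _.
apply: (@le_trans _ _ (h * c)); first by rewrite ler_pM2l// lerDl.
by rewrite -ler_pdivlMr// ltW.
Qed.

(** The vectors of strong continuity form a closed subspace; a vector [x] orthogonal
    to it is orthogonal to its own averages, which converge to [x], and so vanishes. *)
Lemma adjoint_strongly_continuous p : Z p.
Proof.
have Z0 : Z 0.
  rewrite /Z /=; apply: cvg_trans (near_eq_cvg _) (cvg_cst (0 : X)).
  apply: filterS (nbhs_right_gt (0 : R)) => t t0.
  by rewrite (linear_zero (sg_adjoint_linear (ltW t0))).
have Zconv : convex_subset Z by move=> x y l Zx Zy _ _; exact: strong_continuity_lin.
have Zcl : closed Z.
  move=> x /closure_normP cx; have [M M0 hM] := sg_bound HS 1.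
  apply/cvgrPdist_le => e e0.
  have c0 : 0 < M + 2 by rewrite ltr_wpDl.
  have [y Zy xy] := cx _ (divr_gt0 e0 c0).
  have /cvgrPdist_lt /(_ _ (divr_gt0 e0 c0)) yc : Sa t y @[t --> 0^'+] --> y by exact: Zy.
  near=> t.
  have /andP[t0 t1] : 0 < t < 1 by near: t; exact: at_right_lt.
  have h : `|y - Sa t y| < e / (M + 2) by near: t; exact: yc.
  have -> : x - Sa t x = (x - y) + (y - Sa t y) + Sa t (y - x).
    by rewrite (linear_sub (sg_adjoint_linear (ltW t0))); vec.
  apply: le_trans (ler_normD _ _) _; apply: le_trans (lerD (ler_normD _ _) (lexx _)) _.
  have := sg_adjoint_bounded (ltW t0) M0 (hM _ (ltW t0) (ltW t1)) (y - x).
  rewrite (distrC y x); move: xy h; rewrite !ltr_pdivlMr//.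
  by move: (`|x - y|) (`|y - _|) (`|Sa _ _|) (normr_ge0 (x - y)) => r1 r2 r3; nra.
have [z [Zz hz]] := proj_exists p Zcl Zconv (ex_intro _ 0 Z0).
suff -> : p = z by [].
apply/eqP; rewrite -subr_eq0; apply/negPn/negP; set x := p - z => x0.
have orth w : Z w -> inner x w = 0.
  move=> Zw; have h k : inner x (k *: w) <= 0.
    have := hz (1 *: z + k *: w) (@strong_continuity_lin _ _ _ _ Zz Zw).
    by rewrite scale1r addrAC subrr add0r.
  have := h 1; have := h (-1); rewrite scale1r scaleN1r innerNr => h1 h2; lra.
pose g (s : R) : R := inner (S `|s| x) x.
have gc : continuous (g : R -> R^o) by exact: orbit_inner_continuous.
pose c := `|x| ^+ 2 / 2.
have cp : 0 < c by rewrite divr_gt0// exprn_gt0// normr_gt0.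
have g0 : g 0 = `|x| ^+ 2 by rewrite /g normr0 (C0_id HS) inner_norm.
have /cvgrPdist_lt /(_ c cp) [a /= a0 ha] := gc 0.
have a2 : 0 < a / 2 by rewrite divr_gt0.
have [w Zw wP] := average_strongly_continuous x a2.
have := orth w Zw; rewrite wP => Ig0.
have mitv : measurable (`[0, a / 2]%classic : set R) by exact: measurable_itv.
have fI : (mu `[0%R, (a / 2)%R] < +oo)%E.
  by rewrite lebesgue_measure_itv/=; case: ifP => _; rewrite ltry.
have : \int[mu]_(s in `[0, a / 2]) cst c s <= \int[mu]_(s in `[0, a / 2]) g s.
  apply: Rint_le => //; [exact: integ_cst|exact: integ_continuous|].
  move=> s /=; rewrite in_itv/= => /andP[s0 sa].
  have : `|g 0 - g s| < c.
    by apply: ha; rewrite /= sub0r normrN ger0_norm//; lra.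
  by rewrite g0 ltr_norml => /andP[_]; rewrite /c; lra.
rewrite Rintegral_cst//= lebesgue_measure_itv/= lte_fin a2.
by rewrite [\int[mu]_(s in _) g s]Ig0 -EFinD /= subr0 leNgt mulr_gt0.
Unshelve. all: end_near. Qed.

Lemma adjoint_semigroup : C0_semigroup (fun t => Sa t).
Proof.
split=> [t t0|t t0|x|s t x s0 t0|x].
- exact: sg_adjoint_linear.
- have [M M0 hM] := sg_bounded_op HS t0.
  exact: bounded_op_continuous (sg_adjoint_linear t0) (sg_adjoint_bounded t0 M0 hM).
- by apply: inner_ext => y; rewrite -sg_adjointP// (C0_id HS).
- apply: inner_ext => y; rewrite -!sg_adjointP ?addr_ge0//.
  by rewrite addrC (C0_add HS).
- exact: adjoint_strongly_continuous.
Qed.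

End AdjointSemigroup.

(** * Square-integrable functions on a bounded interval *)

Section L2.
Context {R : realType} {U : hilbertType R}.
Local Notation mu := (@lebesgue_measure R).
Variable T : R.
Local Notation I := (`]0, T[%classic : set R).
Local Notation integ := (integ I).
Implicit Types u v w : R -> U.

Lemma mitv : measurable I.
Proof. exact: measurable_itv. Qed.
Hint Resolve mitv : core.

Lemma finitv : (mu I < +oo)%E.
Proof. by rewrite lebesgue_measure_itv/=; case: ifP => _; rewrite ltry. Qed.
Hint Resolve finitv : core.

Lemma L2_sm u : L2 T u -> strongly_measurable I u.
Proof. by case. Qed.

Lemma L2_sq u : L2 T u -> integ (fun t => `|u t| ^+ 2).
Proof.
move=> [um fu]; apply: integ_ge0P => //.
by apply: measurable_funX; exact: sm_norm.
Qed.

Lemma L2P u : strongly_measurable I u -> integ (fun t => `|u t| ^+ 2) -> L2 T u.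
Proof.
by move=> um iu; split=> //; rewrite Rint_EFin// ltry.
Qed.

Lemma L2_dom u (g : R -> R) : strongly_measurable I u -> integ g ->
  (forall t, I t -> `|u t| ^+ 2 <= g t) -> L2 T u.
Proof.
move=> um ig ug; apply: L2P => //; apply: integ_le ig => //.
  by apply: measurable_funX; exact: sm_norm.
by move=> t It; rewrite ger0_norm ?sqr_ge0// ug.
Qed.

Lemma L2_bounded u (c : R) : strongly_measurable I u -> (forall t, I t -> `|u t| <= c) ->
  L2 T u.
Proof.
move=> um uc; apply: (@L2_dom _ (fun=> c ^+ 2)) => //; first exact: integ_cst.
by move=> t It; rewrite ler_pXn2r ?nnegrE ?uc// (le_trans _ (uc t It)).
Qed.

Lemma L2D u v : L2 T u -> L2 T v -> L2 T (fun t => u t + v t).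
Proof.
move=> Lu Lv; apply: (@L2_dom _ (fun t => 2 * `|u t| ^+ 2 + 2 * `|v t| ^+ 2)).
- by apply: smD; exact: L2_sm.
- by apply: integD => //; apply: integZ => //; exact: L2_sq.
- move=> t _; apply: (@le_trans _ _ ((`|u t| + `|v t|) ^+ 2)).
    by rewrite ler_pXn2r ?nnegrE ?addr_ge0 ?ler_normD.
  by have := sqr_ge0 (`|u t| - `|v t|); nra.
Qed.

Lemma L2Z (a : R) u : L2 T u -> L2 T (fun t => a *: u t).
Proof.
move=> Lu; apply: (@L2_dom _ (fun t => `|a| ^+ 2 * `|u t| ^+ 2)).
- by apply: smZ; exact: L2_sm.
- by apply: integZ => //; exact: L2_sq.
- by move=> t _; rewrite normrZ exprMn.
Qed.

Lemma L2B u v : L2 T u -> L2 T v -> L2 T (fun t => u t - v t).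
Proof.
move=> Lu Lv; have := L2D Lu (L2Z (-1) Lv).
by under [X in L2 T X -> _]eq_fun do rewrite scaleN1r.
Qed.

Lemma L2_integ_inner u v : L2 T u -> L2 T v -> integ (fun t => inner (u t) (v t)).
Proof.
move=> Lu Lv; apply: (@integ_le _ I mitv _ (fun t => `|u t| ^+ 2 + `|v t| ^+ 2)).
- by apply: measurable_inner => //; exact: L2_sm.
- move=> t _; apply: le_trans (abs_inner_le_norm _ _) _.
  by have := sqr_ge0 (`|u t| - `|v t|); nra.
- by apply: integD => //; exact: L2_sq.
Qed.

Lemma L2_integ_norm u : L2 T u -> integ (fun t => `|u t|).
Proof.
move=> Lu; apply: (@integ_le _ I mitv _ (fun t => 1 + `|u t| ^+ 2)).
- by apply: sm_norm => //; exact: L2_sm.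
- by move=> t _; rewrite normr_id; have := sqr_ge0 (`|u t| - 1); have := normr_ge0 (u t); nra.
- by apply: integD => //; [exact: integ_cst|exact: L2_sq].
Qed.

Section SupportFunction.
Variables (K : set U) (M : R).
Hypothesis bK : convex_body K M.
Local Notation s := (support_fun K).

Lemma support_continuous : continuous (s : U -> R^o).
Proof.
move=> x; have M0 := body_M_ge0 bK; apply/cvgrPdist_le => e e0.
have h : y @[y --> x] --> x by exact: cvg_id.
have M1 : 0 < M + 1 by rewrite ltr_wpDl.
have /cvgrPdist_lt /(_ _ (divr_gt0 e0 M1)) := h; apply: filterS => y /=.
rewrite ltr_pdivlMr// => xy; apply: le_trans (support_lip bK x y) _.
by have := normr_ge0 (x - y); nra.
Qed.

Lemma support_measurable q : strongly_measurable I q -> measurable_fun I (fun t => s (q t)).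
Proof. by move=> mq; exact: (@sm_measurable _ _ U s q (@support_continuous) mq). Qed.

Lemma support_sm q : strongly_measurable I q -> strongly_measurable I (fun t => s (q t) : R^o).
Proof. by move=> mq; apply: (sm_comp (h := s : U -> R^o)) => //; exact: support_continuous. Qed.

Lemma support_sq_integ q : L2 T q -> integ (fun t => s (q t) ^+ 2).
Proof.
move=> Lq; apply: (@integ_le _ I mitv _ (fun t => M ^+ 2 * `|q t| ^+ 2)).
- by apply: measurable_funX; apply: support_measurable; exact: L2_sm.
- move=> t _; rewrite ger0_norm ?sqr_ge0// -exprMn ler_pXn2r// ?nnegrE.
  + exact: (support_le_norm bK).
  + exact: (support_ge0 bK).
  + by rewrite mulr_ge0// (body_M_ge0 bK).
- by apply: integZ => //; exact: L2_sq.
Qed.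

Lemma Fstar_ge0 q : 0 <= Fstar T K q.
Proof. by rewrite mulr_ge0// ?invr_ge0//; apply: Rintegral_ge0 => t _; exact: sqr_ge0. Qed.

End SupportFunction.
End L2.
#[global] Hint Resolve mitv finitv : core.

(** * The input-to-state map and its adjoint *)

Section Control.
Context {R : realType} {X U : hilbertType R}.
Local Notation mu := (@lebesgue_measure R).
Variables (S : R -> X -> X) (B : {linear U -> X}) (T : R).
Hypotheses (HS : C0_semigroup S) (HB : continuous B) (HT : 0 < T).
Local Notation I := (`]0, T[%classic : set R).
Local Notation integ := (integ I).
Local Notation L := (Lop S B T).
Local Notation Ls := (Ladj S B T).
Implicit Types (u v : R -> U) (p : X).

Let It t : I t -> 0 <= T - t /\ T - t <= T.
Proof.
by rewrite /= in_itv/= => /andP[t0 tT]; rewrite subr_ge0 lerBlDr lerDl !ltW.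
Qed.

Lemma control_bounded : exists2 C, 0 <= C & forall t, I t -> bounded_op (S (T - t) \o B) C.
Proof.
have [M M0 hM] := sg_bound HS T.
have [N N0 hN] := linear_bounded (linearP B) HB.
exists (M * N); first exact: mulr_ge0.
move=> t /It[t0 tT] x /=; apply: le_trans (hM _ t0 tT _) _.
by rewrite -mulrA ler_wpM2l.
Qed.

Lemma LadjP t x p : I t -> inner (S (T - t) (B x)) p = inner x (Ls p t).
Proof.
move=> /It[t0 _]; have [N N0 hN] := linear_bounded (linearP B) HB.
by rewrite (sg_adjointP HS)// (adjointP (linearP B) hN).
Qed.

Lemma LadjZ t a p : I t -> Ls (a *: p) t = a *: Ls p t.
Proof.
by move=> It'; apply: inner_ext => z; rewrite innerZr -!LadjP// innerZr.
Qed.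

Lemma Ladj_bounded : exists2 C, 0 <= C & forall t p, I t -> `|Ls p t| <= C * `|p|.
Proof.
have [M M0 hM] := sg_bound HS T.
have [N N0 hN] := linear_bounded (linearP B) HB.
exists (N * M); first exact: mulr_ge0.
move=> t p /It[t0 tT]; rewrite /Ladj -mulrA.
apply: le_trans (adjoint_bounded N0 (linearP B) hN _) _.
by rewrite ler_wpM2l// (sg_adjoint_bounded HS t0 M0)//; exact: hM.
Qed.

Lemma Ladj_sm p : strongly_measurable I (Ls p).
Proof.
have [N N0 hN] := linear_bounded (linearP B) HB.
apply: (sm_comp (h := adjoint B)).
  apply: bounded_op_continuous (adjoint_bounded N0 (linearP B) hN).
  exact: adjoint_linear (linearP B) hN.
by apply: (semigroup_sm (adjoint_semigroup HS)) => //; exact: sm_cst.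
Qed.

Lemma L2_Ladj p : L2 T (Ls p).
Proof.
have [C C0 hC] := Ladj_bounded.
by apply: (L2_bounded (c := C * `|p|)); [exact: Ladj_sm|move=> t; exact: hC].
Qed.

(** The duality that determines [L u], and through which alone it is handled below. *)
Lemma Lop_weak u p : L2 T u -> inner (L u) p = \int[mu]_(t in I) inner (u t) (Ls p t).
Proof.
move=> Lu; have [C C0 hC] := control_bounded.
have mg : strongly_measurable I (fun t => S (T - t) (B (u t))).
  by apply: semigroup_sm => //; apply: sm_comp HB (L2_sm Lu).
rewrite /Lop bochner_integral_weak//.
  by apply: Rint_eq => t It'; rewrite LadjP.
apply: (@integ_le _ I _ _ (fun t => C * `|u t|)) => //.
- exact: sm_norm.
- by move=> t It'; rewrite normr_id; exact: hC.
- by apply: integZ => //; exact: L2_integ_norm.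
Qed.

Lemma LopD a b u v : L2 T u -> L2 T v ->
  L (fun t => a *: u t + b *: v t) = a *: L u + b *: L v.
Proof.
move=> Lu Lv; apply: inner_ext => p.
have := Lop_weak p (L2D (L2Z a Lu) (L2Z b Lv)).
have := Lop_weak p Lu; have := Lop_weak p Lv.
move: (L (fun t => _)) (L u) (L v) => x y z ez ey ex.
rewrite !(innerC p) innerDl !innerZl ex ey ez.
have iu := L2_integ_inner Lu (L2_Ladj p); have iv := L2_integ_inner Lv (L2_Ladj p).
rewrite -!(RintZ (mitv T) _ iu) -!(RintZ (mitv T) _ iv) -RintD//; try exact: integZ.
by apply: Rint_eq => t _; rewrite innerDl !innerZl.
Qed.

End Control.

(** * Reaching the target from the dual inequality *)

Section Reachability.
Context {R : realType} {X U : hilbertType R}.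
Local Notation mu := (@lebesgue_measure R).
Variables (S : R -> X -> X) (B : {linear U -> X}) (T : R) (K : set U) (M : R).
Hypotheses (HS : C0_semigroup S) (HB : continuous B) (HT : 0 < T).
Hypothesis bK : convex_body K M.
Local Notation I := (`]0, T[%classic : set R).
Local Notation integ := (integ I).
Local Notation s := (support_fun K).
Local Notation L := (Lop S B T).
Local Notation Ls := (Ladj S B T).
Implicit Types (u v : R -> U) (a b : R -> R) (p y : X) (N : R).

(** A control [u] together with a measurable bound [a] of its gauge, of which the
    square has integral at most [N]; working with pairs replaces the gauge, which
    may be infinite, by real functions. *)
Definition admissible N u a := [/\ strongly_measurable I u,
  strongly_measurable I (a : R -> R^o),
  forall t, I t -> 0 <= a t /\ exists2 v, K v & u t = a t *: v,
  integ (fun t => a t ^+ 2) & \int[mu]_(t in I) a t ^+ 2 <= N].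

Lemma admissible_norm N u a t : admissible N u a -> I t -> `|u t| <= M * a t.
Proof.
move=> [_ _ ua _ _] It; have [a0 [v Kv ->]] := ua t It.
by rewrite normrZ ger0_norm// mulrC ler_wpM2r// (body_bound bK).
Qed.

Lemma admissible_L2 N u a : admissible N u a -> L2 T u.
Proof.
move=> ad; have [um _ _ ia _] := ad.
apply: (@L2_dom _ _ _ _ (fun t => M ^+ 2 * a t ^+ 2)) => //; first exact: integZ.
move=> t It; rewrite -exprMn ler_pXn2r ?nnegrE//; first exact: admissible_norm ad It.
by apply: le_trans (admissible_norm ad It).
Qed.

Lemma admissible_sq N u a : admissible N u a ->
  \int[mu]_(t in I) `|u t| ^+ 2 <= M ^+ 2 * N.
Proof.
move=> ad; have [um _ _ ia aN] := ad.
apply: (@le_trans _ _ (\int[mu]_(t in I) (M ^+ 2 * a t ^+ 2))).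
  apply: Rint_le => //; [exact: L2_sq (admissible_L2 ad)|exact: integZ|].
  move=> t It; rewrite -exprMn ler_pXn2r ?nnegrE//; first exact: admissible_norm ad It.
  by apply: le_trans (admissible_norm ad It).
by rewrite RintZ// ler_wpM2l// sqr_ge0.
Qed.

Lemma admissible0 N : 0 <= N -> admissible N (cst 0) (cst 0).
Proof.
have e : (fun t : R => (cst 0 t : R) ^+ 2) = cst 0.
  by apply/funext => t; rewrite /= expr0n.
move=> N0; split; [exact: sm_cst|exact: sm_cst| | |].
- by move=> t _; split=> //; exists 0; [case: bK|rewrite scaler0].
- by rewrite e; exact: integ_cst.
- by rewrite e Rintegral_cst// mul0r.
Qed.

Lemma admissible_convex N u a v b (l : R) : admissible N u a -> admissible N v b ->
  0 <= l -> l <= 1 -> admissible N (fun t => l *: u t + (1 - l) *: v t)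
    (fun t => l * a t + (1 - l) * b t).
Proof.
move=> [um ma ua ia aN] [mv mb vb ib bN] l0 l1.
have l1' : 0 <= 1 - l by rewrite subr_ge0.
have sq t : (l * a t + (1 - l) * b t) ^+ 2 <= l * a t ^+ 2 + (1 - l) * b t ^+ 2.
  rewrite -subr_ge0 (_ : _ - _ = l * (1 - l) * (a t - b t) ^+ 2); last by ring.
  by rewrite mulr_ge0 ?sqr_ge0// mulr_ge0.
have mab : strongly_measurable I (fun t => l * a t + (1 - l) * b t : R^o).
  by apply: (@smD _ _ R^o); apply: (@smZ _ _ R^o).
have iab : integ (fun t => l * a t ^+ 2 + (1 - l) * b t ^+ 2).
  by apply: integD => //; exact: integZ.
have ic : integ (fun t => (l * a t + (1 - l) * b t) ^+ 2).
  apply: integ_le iab => //.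
    apply: measurable_funX; apply: (@sm_measurable _ _ R^o id) mab => x; exact: cvg_id.
  by move=> t _; rewrite ger0_norm ?sqr_ge0.
split=> //.
- by apply: smD; apply: smZ.
- move=> t It; have [a0 [x Kx ->]] := ua t It; have [b0 [x' Kx' ->]] := vb t It.
  have la : 0 <= l * a t by exact: mulr_ge0.
  have lb : 0 <= (1 - l) * b t by exact: mulr_ge0.
  split; first exact: addr_ge0.
  rewrite !scalerA; move: (l * a t) ((1 - l) * b t) la lb => c d c0 d0.
  have [cd|cd] := eqVneq (c + d) 0.
    have -> : c = 0 by lra.
    have -> : d = 0 by lra.
    by exists 0; [case: bK|rewrite !scale0r scaler0 addr0].
  have cdp : 0 < c + d by rewrite lt_def cd addr_ge0.
  exists ((c / (c + d)) *: x + (1 - c / (c + d)) *: x').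
    apply: (body_convex bK) => //; first by rewrite divr_ge0// ltW.
    by rewrite ler_pdivrMr// mul1r lerDl.
  by vec.
- apply: le_trans (Rint_le (mitv T) ic iab _) _; first by move=> t _; exact: sq.
  rewrite RintD//; [|exact: integZ..].
  rewrite !RintZ//; apply: (@le_trans _ _ (l * N + (1 - l) * N)).
    by apply: lerD; rewrite ler_wpM2l.
  by rewrite -mulrDl addrC subrK mul1r.
Qed.

(** The controls [l * s (q_n t) *: v_n], with [q_n] simple approximations of the
    adjoint trajectory and [v_n] almost maximising [<q_n, v>] over [K], show that
    no hyperplane separates the target from the reachable set. *)
Lemma target_in_closure y (c : R) : 0 <= c -> cbound S B T K y c ->
  forall e, 0 < e -> exists u a, admissible (c ^+ 2 / 2) u a /\ `|y - L u| < e.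
Proof.
move=> c0 hc; pose N := c ^+ 2 / 2.
have N0 : 0 <= N by rewrite divr_ge0 ?sqr_ge0.
pose C := [set L u | u in [set u | exists a, admissible N u a]].
suff : closure C y.
  move=> /closure_normP h e e0; have [_ [u [a ad] <-] ?] := h e e0.
  by exists u, a.
apply: contrapT => /(separation _ _)[].
- move=> _ _ l [u [a ad] <-] [v [b bd] <-] l0 l1.
  exists (fun t => l *: u t + (1 - l) *: v t).
    by exists (fun t => l * a t + (1 - l) * b t); exact: admissible_convex.
  by rewrite LopD//; [exact: admissible_L2 ad|exact: admissible_L2 bd].
- by exists (L (cst 0)), (cst 0) => //; exists (cst 0); exact: admissible0.
move=> p [al [aly alC]].
pose q := Ls p; have Lq : L2 T q by exact: L2_Ladj.
pose r := sqrtF S B T K p.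
have r0 : 0 <= r by exact: sqrtr_ge0.
have r2 : \int[mu]_(t in I) s (q t) ^+ 2 = 2 * r ^+ 2.
  by rewrite /r /sqrtF sqr_sqrtr ?Fstar_ge0// /Fstar mulrA mulfV ?mul1r.
have al0 : 0 <= al.
  have C0 : C (L (cst 0)) by exists (cst 0) => //; exists (cst 0); exact: admissible0.
  apply: le_trans (alC _ C0).
  rewrite (Lop_weak HS HB HT p (admissible_L2 (admissible0 N0))).
  by rewrite (@Rint_eq _ _ _ (cst 0)) ?Rintegral_cst ?mul0r// => t _; rewrite inner0l.
have acr : al < c * r by exact: lt_le_trans aly (hc p).
have rp : 0 < r by rewrite lt_def r0 andbT; apply: contraTneq acr => ->; rewrite mulr0 -leNgt.
(* [l] has to exceed the first term for separation to fail, and to be less than the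
   second for the controls to be admissible: the midpoint is taken *)
pose l := (al / (2 * r ^+ 2) + c / (2 * r)) / 2.
have lE : l * (2 * r ^+ 2) = (al + c * r) / 2 by rewrite /l; field; rewrite gt_eqF.
have l1 : 2 * l * r < c.
  rewrite -(ltr_pM2r rp) (_ : _ * r * r = l * (2 * r ^+ 2)); last by ring.
  by rewrite lE; lra.
have l2 : al < l * (2 * r ^+ 2) by rewrite lE; lra.
have l0 : 0 <= l by rewrite /l divr_ge0// addr_ge0// divr_ge0// mulr_ge0// sqr_ge0.
clearbody l.
have [q_ [ss qc q2]] := sm_dominated_approx (mitv T) (L2_sm Lq).
have [Cq Cq0 hCq] := Ladj_bounded T HS HB.
pose Q := 2 * (Cq * `|p|).
have Q0 : 0 <= Q by rewrite /Q !mulr_ge0.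
have M0 := body_M_ge0 bK.
have qQ t : I t -> `|q t| <= Q.
  by move=> It; apply: le_trans (hCq t p It) _; rewrite /Q ler_peMl ?mulr_ge0// ler1n.
have q_Q n t : I t -> `|q_ n t| <= Q.
  by move=> It; apply: le_trans (q2 n t It) _; rewrite ler_pM2l//; exact: hCq.
have sQ x : `|x| <= Q -> 0 <= s x <= M * Q.
  move=> xQ; rewrite (support_ge0 bK)/=; apply: le_trans (support_le_norm bK x) _.
  by rewrite ler_wpM2l.
have sc t : I t -> s (q_ n t) @[n --> \oo] --> s (q t).
  by move=> It; apply: cvg_comp (qc t It) _; exact: (support_continuous bK).
(* the squared sizes of the controls converge to a value below the admissible one *)
have [_ An] : integ (fun t => s (q t) ^+ 2) /\
    \int[mu]_(t in I) s (q_ n t) ^+ 2 @[n --> \oo] --> \int[mu]_(t in I) s (q t) ^+ 2.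
  apply: (@Rint_dominated _ _ (mitv T) (fun n t => s (q_ n t) ^+ 2) _ (fun=> (M * Q) ^+ 2)).
  - by move=> n; apply: measurable_funX; exact: (simple_measurable s).
  - by move=> t It; rewrite !expr2; apply: cvgM; exact: sc.
  - exact: integ_cst.
  - move=> n t It; have /andP[h1 h2] := sQ _ (q_Q n t It).
    by rewrite ger0_norm ?sqr_ge0//; exact: sqr_le.
have /choice[v vP] (nx : nat * U) : exists v : U, K v /\ s nx.2 - nx.1.+1%:R^-1 < inner nx.2 v.
  have [|v Kv hv] := support_approx bK nx.2 (e := nx.1.+1%:R^-1); first by rewrite invr_gt0.
  by exists v.
pose u n t := (l * s (q_ n t)) *: v (n, q_ n t).
have iA n : integ (fun t => (l * s (q_ n t)) ^+ 2).
  apply: (@integ_bounded _ _ (mitv T) (finitv T) _ ((l * (M * Q)) ^+ 2)).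
    by apply: measurable_funX; apply: measurable_funM => //; exact: (simple_measurable s).
  move=> t It; have /andP[h1 h2] := sQ _ (q_Q n t It).
  by rewrite ger0_norm ?sqr_ge0//; apply: sqr_le; [exact: mulr_ge0|exact: ler_wpM2l].
have adm : \forall n \near \oo, admissible N (u n) (fun t => l * s (q_ n t)).
  have hlim : l ^+ 2 * \int[mu]_(t in I) s (q_ n t) ^+ 2 @[n --> \oo] -->
      l ^+ 2 * (2 * r ^+ 2) by rewrite -r2; apply: cvgM => //; exact: cvg_cst.
  have lN : l ^+ 2 * (2 * r ^+ 2) < N.
    rewrite /N ltr_pdivlMr// (_ : _ * 2 = (2 * l * r) ^+ 2); last by ring.
    have lr0 : 0 <= 2 * l * r by exact: mulr_ge0 (mulr_ge0 (ler0n _ 2) l0) r0.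
    by move: l1 lr0; move: (2 * l * r) => z z1 z0; nra.
  have := hlim; move/cvgrPdist_lt => /(_ (N - l ^+ 2 * (2 * r ^+ 2))).
  rewrite subr_gt0 => /(_ lN); apply: filterS => n; rewrite ltr_norml => /andP[h _].
  split.
  - by apply: simple_sm; exact: (simple_comp (fun x => (l * s x) *: v (n, x))).
  - by apply: simple_sm; exact: (simple_comp (fun x => l * s x : R^o)).
  - move=> t It; split; first by rewrite mulr_ge0// (support_ge0 bK).
    by exists (v (n, q_ n t)) => //; have [] := vP (n, q_ n t).
  - exact: iA.
  - have isq : integ (fun t => s (q_ n t) ^+ 2).
      apply: (@integ_bounded _ _ (mitv T) (finitv T) _ ((M * Q) ^+ 2)).
        by apply: measurable_funX; exact: (simple_measurable s).
      move=> t It; have /andP[h1 h2] := sQ _ (q_Q n t It).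
      by rewrite ger0_norm ?sqr_ge0//; exact: sqr_le.
    have -> : \int[mu]_(t in I) (l * s (q_ n t)) ^+ 2 =
        \int[mu]_(t in I) (l ^+ 2 * s (q_ n t) ^+ 2).
      by apply: Rint_eq => t _; rewrite exprMn.
    by rewrite (RintZ (mitv T) _ isq); lra.
(* a lower bound of the values of the separating functional *)
pose h n t := l * s (q_ n t) * (s (q_ n t) - 1 * n.+1%:R^-1 - M * `|q t - q_ n t|).
have hu n t : I t -> h n t <= inner (u n t) (q t).
  move=> It; rewrite /h /u innerZl.
  have /andP[h1 _] := sQ _ (q_Q n t It).
  rewrite ler_wpM2l ?mulr_ge0//; have [Kv hv] := vP (n, q_ n t).
  rewrite -[in leRHS](subrK (q_ n t) (q t)) innerDr (innerC _ (q_ n t)).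
  have : - (M * `|q t - q_ n t|) <= inner (v (n, q_ n t)) (q t - q_ n t).
    rewrite lerNl -innerNr; apply: le_trans (inner_le_norm _ _) _.
    by rewrite normrN ler_wpM2r// (body_bound bK).
  by move: hv => /=; rewrite mul1r; move: (n.+1%:R^-1) => i; lra.
have mh n : measurable_fun I (h n).
  have ms : measurable_fun I (fun t => s (q_ n t)) by exact: (simple_measurable s).
  apply: measurable_funM; first exact: measurable_funM.
  apply: measurable_funB; first exact: measurable_funB.
  apply: measurable_funM => //; apply: sm_norm; apply: smB; first exact: L2_sm.
  exact: simple_sm.
have hb n t : I t -> `|h n t| <= l * (M * Q) * (M * Q + 1 + M * (Q + Q)).
  move=> It; have /andP[h1 h2] := sQ _ (q_Q n t It).
  rewrite /h normrM ger0_norm ?mulr_ge0//.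
  apply: ler_pM => //; [by rewrite mulr_ge0|by rewrite ler_wpM2l|].
  apply: le_trans (ler_normB _ _) _; apply: lerD; last first.
    rewrite normrM (ger0_norm M0) normr_id ler_wpM2l//.
    by apply: le_trans (ler_normB _ _) _; apply: lerD; [exact: qQ|exact: q_Q].
  apply: le_trans (ler_normB _ _) _; apply: lerD; first by rewrite ger0_norm.
  by rewrite mul1r ger0_norm// invf_le1// ler1n.
have [_ hc'] : integ (fun t => l * s (q t) ^+ 2) /\
    \int[mu]_(t in I) h n t @[n --> \oo] --> \int[mu]_(t in I) (l * s (q t) ^+ 2).
  apply: (@Rint_dominated _ _ (mitv T) h _ (fun=> l * (M * Q) * (M * Q + 1 + M * (Q + Q)))).
  - exact: mh.
  - move=> t It; rewrite expr2 mulrA /h.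
    have -> : l * s (q t) * s (q t) = l * s (q t) * (s (q t) - 0 - M * 0).
      by rewrite mulr0 !subr0.
    apply: cvgM; first by apply: cvgM; [exact: cvg_cst|exact: sc].
    apply: cvgB; first by apply: cvgB; [exact: sc|exact: cvg_invn].
    apply: cvgM; first exact: cvg_cst.
    rewrite -(@normr0 _ U) -(subrr (q t)); apply: cvg_norm.
    by apply: cvgB; [exact: cvg_cst|exact: qc].
  - exact: integ_cst.
  - exact: hb.
have : \int[mu]_(t in I) (l * s (q t) ^+ 2) <= al.
  apply: ler_cvg_to hc' (cvg_cst al) _; apply: filterS adm => n ad.
  have Lu := admissible_L2 ad.
  have := alC (L (u n)) _; rewrite Lop_weak//.
  have b : C (L (u n)) by exists (u n) => //; exists (fun t => l * s (q_ n t)).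
  move=> /(_ b); apply: le_trans; apply: Rint_le => //; last exact: hu.
    exact: integ_bounded (hb n).
  exact: L2_integ_inner.
rewrite RintZ//; last exact: (support_sq_integ bK).
by rewrite r2 leNgt l2.
Qed.

Let energy u a := \int[mu]_(t in I) (`|u t| ^+ 2 + a t ^+ 2).

Let integ_energy N u a : admissible N u a -> integ (fun t => `|u t| ^+ 2 + a t ^+ 2).
Proof.
by move=> ad; apply: integD => //; [exact: L2_sq (admissible_L2 ad)|case: ad].
Qed.

Let energy_le N u a : admissible N u a -> energy u a <= (M ^+ 2 + 1) * N.
Proof.
move=> ad; have [_ _ _ ia aN] := ad.
rewrite /energy (RintD (mitv T) (L2_sq (admissible_L2 ad)) ia) mulrDl mul1r.
by rewrite lerD// (admissible_sq ad).
Qed.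

Let energy_parallelogram N u a v b : admissible N u a -> admissible N v b ->
  energy (fun t => u t - v t) (fun t => a t - b t) =
  2 * energy u a + 2 * energy v b -
  4 * energy (fun t => 2^-1 *: u t + (1 - 2^-1) *: v t)
             (fun t => 2^-1 * a t + (1 - 2^-1) * b t).
Proof.
move=> ad bd.
have half : (1 - 2^-1 : R) = 2^-1 by field.
have md := admissible_convex ad bd (l := 2^-1) ltac:(lra) ltac:(lra).
have iu := integ_energy ad; have iv := integ_energy bd; have im := integ_energy md.
have iu2 := integZ (mitv T) 2 iu; have iv2 := integZ (mitv T) 2 iv.
have im4 := integZ (mitv T) 4 im.
rewrite /energy -(RintZ (mitv T) 2 iu) -(RintZ (mitv T) 2 iv) -(RintZ (mitv T) 4 im).
rewrite -(RintD (mitv T) iu2 iv2) -(RintB (mitv T) (integD (mitv T) iu2 iv2) im4).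
apply: Rint_eq => t _; have := parallelogram 0 (u t) (v t).
by rewrite !sub0r !normrN half => ->; field.
Qed.

(** Pairs of nearly least energy among those steering within [1 / (n + 1)] of [y].  The
    least energies increase to a finite limit, and the midpoint of the pairs of indices
    [n <= m] competes at level [n]: the parallelogram law then bounds their distance. *)
Lemma minimising_sequence y N : 0 <= N ->
  (forall e : R, 0 < e -> exists u a, admissible N u a /\ `|y - L u| < e) ->
  exists (u_ : nat -> R -> U) (a_ : nat -> R -> R) (d : nat -> R),
    [/\ forall n, admissible N (u_ n) (a_ n),
    L (u_ n) @[n --> \oo] --> y, d @ \oo --> (0 : R) &
    forall n m, (n <= m)%N ->
      energy (fun t => u_ n t - u_ m t) (fun t => a_ n t - a_ m t) <= d n].
Proof.
move=> N0 near_y.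
pose C n := [set ua : (R -> U) * (R -> R) |
  admissible N ua.1 ua.2 /\ `|y - L ua.1| <= n.+1%:R^-1].
pose D n := [set energy ua.1 ua.2 | ua in C n].
have D_inf n : has_inf (D n).
  split.
    have [|u [a [ad yu]]] := near_y n.+1%:R^-1; first by rewrite invr_gt0.
    by exists (energy u a), (u, a) => //; split=> //=; exact: ltW.
  exists 0 => _ [ua [ad _] <-]; apply: Rintegral_ge0 => t _.
  by rewrite addr_ge0 ?sqr_ge0.
have C_sub n m : (n <= m)%N -> C m `<=` C n.
  move=> nm ua [ad h]; split=> //; apply: le_trans h _.
  by rewrite lef_pV2 ?posrE ?ler_nat.
pose r n := inf (D n).
have r_le n u a : C n (u, a) -> r n <= energy u a.
  by move=> Cua; apply: ge_inf; [case: (D_inf n)|exists (u, a)].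
have r_homo : nondecreasing_seq r.
  move=> n m nm; apply: lb_le_inf; first by case: (D_inf m).
  by move=> _ [[u a] /(C_sub _ _ nm) Cn <-]; exact: r_le.
have r_ub : has_ubound (range r).
  exists ((M ^+ 2 + 1) * N) => _ [n _ <-].
  have [e0 [[u a] Cua _]] : D n !=set0 by case: (D_inf n).
  by apply: le_trans (r_le _ _ _ Cua) _; apply: energy_le; case: Cua.
have rc := nondecreasing_is_cvgn r_homo r_ub.
have /choice[w wP] n : exists ua, C n ua /\ energy ua.1 ua.2 < r n + n.+1%:R^-1.
  have n0 : 0 < n.+1%:R^-1 :> R by rewrite invr_gt0.
  by have [e0 [ua Cua <-] h] := inf_adherent n0 (D_inf n); exists ua.
pose d n := 2 * (lim (r @ \oo) - r n) + 4 * n.+1%:R^-1.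
exists (fun n => (w n).1), (fun n => (w n).2), d; split.
- by move=> n; have [[]] := wP n.
- apply/cvgrPdist_le => e e0; have /cvgrPdist_lt /(_ e e0) := @cvg_invn R 1.
  apply: filterS => n; rewrite sub0r normrN mul1r ger0_norm// => h.
  by have [[_ h'] _] := wP n; apply: le_trans h' (ltW h).
- rewrite /d; have -> : (0 : R) = 2 * (lim (r @ \oo) - lim (r @ \oo)) + 0.
    by rewrite subrr mulr0 addr0.
  apply: cvgD; last exact: cvg_invn.
  by apply: cvgM; [exact: cvg_cst|apply: cvgB => //; exact: cvg_cst].
- move=> n m nm; have [Cn En] := wP n; have [Cm Em] := wP m.
  have Cm' := C_sub _ _ nm _ Cm.
  have [adn yn] := Cn; have [adm ym] := Cm'.
  rewrite (energy_parallelogram adn adm).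
  have mid : C n (fun t => 2^-1 *: (w n).1 t + (1 - 2^-1) *: (w m).1 t,
      fun t => 2^-1 * (w n).2 t + (1 - 2^-1) * (w m).2 t).
    split=> /=; first by apply: admissible_convex => //; lra.
    rewrite (LopD HS HB HT _ _ (admissible_L2 adn) (admissible_L2 adm)).
    move: yn ym; move: (L (w n).1) (L (w m).1) (n.+1%:R^-1) => x1 x2 e yn ym.
    have -> : y - (2^-1 *: x1 + (1 - 2^-1) *: x2) =
        2^-1 *: (y - x1) + (1 - 2^-1) *: (y - x2) by vec.
    apply: le_trans (ler_normD _ _) _; rewrite !normrZ !ger0_norm; [lra|lra|lra].
  have := r_le _ _ _ mid.
  have h1 : r m <= lim (r @ \oo) by exact: nondecreasing_cvgn_le.
  have h2 : r n <= r m by exact: r_homo.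
  have h3 : m.+1%:R^-1 <= n.+1%:R^-1 :> R by rewrite lef_pV2 ?posrE ?ler_nat.
  rewrite /d; move: En Em h1 h2 h3; move: (energy _ _) (energy _ _) (energy _ _).
  move=> E1 E2 E3; move: (n.+1%:R^-1) (m.+1%:R^-1) (lim _) (r n) (r m) => i1 i2 l r1 r2; lra.
Qed.

(* The elementary inequality [|f| <= e / 2 + f^2 / (2 e)] in place of Cauchy-Schwarz. *)
Let Rint_abs_of_sq (f : R -> R) (e : R) : 0 < e -> measurable_fun I f ->
  integ (fun t => f t ^+ 2) -> \int[mu]_(t in I) f t ^+ 2 <= e ^+ 2 ->
  integ (fun t => `|f t|) /\ \int[mu]_(t in I) `|f t| <= (T + 1) / 2 * e.
Proof.
move=> e0 mf if2 h.
have ig : integ (fun t => e / 2 + e^-1 / 2 * f t ^+ 2).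
  by apply: integD => //; [exact: integ_cst|exact: integZ].
have fg t : `|f t| <= e / 2 + e^-1 / 2 * f t ^+ 2.
  rewrite -real_normK ?num_real// -subr_ge0.
  rewrite (_ : _ - _ = e^-1 / 2 * (e - `|f t|) ^+ 2); last by field; rewrite gt_eqF.
  by rewrite mulr_ge0 ?sqr_ge0// divr_ge0// invr_ge0 ltW.
have if1 : integ (fun t => `|f t|).
  apply: integ_le ig => //; first exact: measurableT_comp.
  by move=> t _; rewrite normr_id.
split=> //; apply: le_trans (Rint_le (mitv T) if1 ig (fun t _ => fg t)) _.
rewrite (RintD (mitv T) (integ_cst (mitv T) (finitv T) (e / 2)) (integZ (mitv T) (e^-1 / 2) if2)).
rewrite (RintZ (mitv T) _ if2) Rintegral_cst//= lebesgue_measure_itv/= lte_fin HT -EFinD/=.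
rewrite subr0; apply: (@le_trans _ _ (e / 2 * T + e^-1 / 2 * e ^+ 2)).
  by rewrite lerD2l ler_wpM2l// divr_ge0// invr_ge0 ltW.
by rewrite le_eqVlt; apply/orP; left; apply/eqP; field; rewrite gt_eqF.
Qed.

(** A subsequence of the minimising sequence has consecutive differences of energy at most
    [4 ^- k], hence converges almost everywhere and in [L^1].  The constraints pass to
    the pointwise limit, the bound on [a] by Fatou's lemma, and [L^1] convergence of
    the controls yields weak convergence of the states, the functions [L^* p] being
    bounded. *)
Lemma target_reached y (c : R) : 0 <= c -> cbound S B T K y c ->
  exists u a, admissible (c ^+ 2 / 2) u a /\ L u = y.
Proof.
move=> c0 hc; pose N := c ^+ 2 / 2.
have N0 : 0 <= N by rewrite divr_ge0 ?sqr_ge0.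
have [u_ [a_ [d [ad Ly d0 ed]]]] := minimising_sequence N0 (target_in_closure c0 hc).
pose e k : R := 2^-1 ^+ k.
have e0 k : 0 < e k by rewrite exprn_gt0// invr_gt0.
have /choice[psi psiP] k : exists n0, forall n, (n0 <= n)%N -> d n <= e k ^+ 2.
  have /cvgrPdist_lt /(_ (e k ^+ 2)) := d0; rewrite exprn_gt0// => /(_ isT)[n0 _ h].
  exists n0 => n /h /=; rewrite sub0r normrN => h'.
  by apply: le_trans (ler_norm _) (ltW h').
pose phi k := (\sum_(i < k.+1) (psi i).+1)%N.
have phi_psi k : (psi k <= phi k)%N by rewrite /phi big_ord_recr /= (leq_trans (leqnSn _) (leq_addl _ _)).
have phi_homo k : (phi k <= phi k.+1)%N by rewrite /phi [X in (_ <= X)%N]big_ord_recr /= leq_addr.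
have phi_ge k : (k <= phi k)%N.
  rewrite /phi; apply: (@leq_trans (\sum_(i < k.+1) 1)%N); last exact: leq_sum.
  by rewrite sum_nat_const card_ord muln1 leqnSn.
pose w k := u_ (phi k); pose b k := a_ (phi k).
have Lw k : L2 T (w k) := admissible_L2 (ad _).
have mw k : strongly_measurable I (w k) by have [] := ad (phi k).
have mb k : strongly_measurable I (b k : R -> R^o) by have [] := ad (phi k).
have ib k : integ (fun t => b k t ^+ 2) by have [] := ad (phi k).
have mdb k : measurable_fun I (fun t => b k.+1 t - b k t).
  apply: (@sm_measurable _ _ R^o id (fun t => b k.+1 t - b k t : R^o)).
    by move=> x; exact: cvg_id.
  by apply: (@smB _ _ R^o).
have idb k : integ (fun t => (b k.+1 t - b k t) ^+ 2).
  apply: (@integ_le _ _ (mitv T) _ (fun t => 2 * b k.+1 t ^+ 2 + 2 * b k t ^+ 2)).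
  - exact: measurable_funX.
  - move=> t _; rewrite ger0_norm ?sqr_ge0//.
    by have := sqr_ge0 (b k.+1 t + b k t); nra.
  - by apply: integD => //; exact: integZ.
have idw k : integ (fun t => `|w k.+1 t - w k t| ^+ 2) by exact: L2_sq (L2B (Lw _) (Lw _)).
have energy_e k : \int[mu]_(t in I) (`|w k.+1 t - w k t| ^+ 2 + (b k.+1 t - b k t) ^+ 2)
    <= e k ^+ 2.
  apply: le_trans (psiP k _ (phi_psi k)).
  apply: le_trans (ed _ _ (phi_homo k)).
  rewrite le_eqVlt; apply/orP; left; apply/eqP; apply: Rint_eq => t _.
  by rewrite distrC -(sqrrN (b k.+1 t - b k t)) opprB.
have sumE k := RintD (mitv T) (idw k) (idb k).
have dw0 k : 0 <= \int[mu]_(t in I) `|w k.+1 t - w k t| ^+ 2.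
  by apply: Rintegral_ge0 => t _; exact: sqr_ge0.
have db0 k : 0 <= \int[mu]_(t in I) (b k.+1 t - b k t) ^+ 2.
  by apply: Rintegral_ge0 => t _; exact: sqr_ge0.
have step_w k : integ (fun t => `|w k.+1 t - w k t|) /\
    \int[mu]_(t in I) `|w k.+1 t - w k t| <= (T + 1) / 2 * e k.
  have [||||] := @Rint_abs_of_sq (fun t => `|w k.+1 t - w k t|) (e k) => //.
  - by apply: sm_norm; exact: smB.
  - by apply: le_trans (energy_e k); rewrite sumE lerDl.
  - move=> i1 i2; rewrite (@Rint_eq _ _ _ (fun t => `| `|w k.+1 t - w k t| |)).
      by split=> //; apply: (integ_eq (mitv T) _ i1) => t _; rewrite normr_id.
    by move=> t _; rewrite normr_id.
have step_b k : integ (fun t => `|b k.+1 t - b k t|) /\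
    \int[mu]_(t in I) `|b k.+1 t - b k t| <= (T + 1) / 2 * e k.
  apply: Rint_abs_of_sq => //.
  by apply: le_trans (energy_e k); rewrite sumE lerDr.
have [u' [mu' wu' du']] := fast_cauchy_ae (mitv T) mw (fun k => (step_w k).1) (fun k => (step_w k).2).
have [a' [ma' ba' _]] := @fast_cauchy_ae _ _ (mitv T) R^o b _ mb (fun k => (step_b k).1)
  (fun k => (step_b k).2).
have [Z [mZ Z0 hZ]] := aeD_null (aeD_imp2 (fun t _ h1 h2 => conj h1 h2) wu' ba').
pose u t := if t \in Z then 0 else u' t.
pose a t : R := if t \in Z then 0 else a' t.
have uc t : I t -> ~ Z t -> w k t @[k --> \oo] --> u t.
  by move=> It Zt; rewrite /u memNset//; have [] := hZ t It Zt.
have ac t : I t -> ~ Z t -> b k t @[k --> \oo] --> a t.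
  by move=> It Zt; rewrite /a memNset//; have [] := hZ t It Zt.
have um : strongly_measurable I u by apply: sm_if => //; exact: sm_cst.
have ma : strongly_measurable I (a : R -> R^o) by apply: (@sm_if _ _ R^o) => //; exact: sm_cst.
have ua t : I t -> 0 <= a t /\ exists2 v, K v & u t = a t *: v.
  move=> It; have [Zt|Zt] := pselect (Z t).
    rewrite /a /u mem_set//; split=> //.
    by exists 0; [case: bK|rewrite scaler0].
  have b0 k : 0 <= b k t by have [_ _ /(_ t It)[]] := ad (phi k).
  split; first by apply: ler_cvg_to (cvg_cst (0 : R)) (ac t It Zt) _; near=> k.
  apply: (scaled_lim bK b0 _ (uc t It Zt) (ac t It Zt)) => k.
  by have [_ _ /(_ t It)[]] := ad (phi k).
have [ia aN] : integ (fun t => a t ^+ 2) /\ \int[mu]_(t in I) a t ^+ 2 <= N.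
  apply: (@Rint_fatou _ _ (mitv T) (fun k t => b k t ^+ 2)) => //.
  - by apply: measurable_funX; apply: (@sm_measurable _ _ R^o id a) => // x; exact: cvg_id.
  - by move=> t _; exact: sqr_ge0.
  - by move=> k t _; exact: sqr_ge0.
  - apply: (null_aeD mZ Z0) => t It Zt; rewrite !expr2; apply: cvgM; exact: ac.
  - by move=> k; have [] := ad (phi k).
have adu : admissible N u a by [].
exists u, a; split=> //.
apply: inner_ext => p; rewrite !(innerC p).
have Lu := admissible_L2 adu.
have Lwp : inner (L (w k)) p @[k --> \oo] --> inner y p.
  apply: cvg_inner; last exact: cvg_cst.
  exact: (subseq_cvg (x := fun n => L (u_ n)) phi_ge Ly).
have [Cq Cq0 hCq] := Ladj_bounded T HS HB.
have bound k : `|inner (L u) p - inner (L (w k)) p| <=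
    Cq * `|p| * (2 * ((T + 1) / 2)) * 2^-1 ^+ k.
  have [idu du] := du' k.
  have iu := L2_integ_inner Lu (L2_Ladj HS HB HT p).
  have iw := L2_integ_inner (Lw k) (L2_Ladj HS HB HT p).
  rewrite (Lop_weak HS HB HT p Lu) (Lop_weak HS HB HT p (Lw k)) -(RintB (mitv T) iu iw).
  apply: le_trans (Rint_abs_le (mitv T) (integB (mitv T) iu iw)) _.
  apply: (@le_trans _ _ (\int[mu]_(t in I) (Cq * `|p| * `|u' t - w k t|))).
    apply: Rint_le_ae => //; [by apply: integ_norm => //; exact: integB|exact: integZ|].
    apply: (null_aeD mZ Z0) => t It Zt; rewrite /u memNset// -innerBl.
    apply: le_trans (abs_inner_le_norm _ _) _.
    by rewrite mulrC ler_wpM2r// hCq.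
  rewrite (RintZ (mitv T) _ idu) -[leRHS]mulrA; apply: ler_wpM2l => //.
  exact: mulr_ge0.
have Lup : inner (L (w k)) p @[k --> \oo] --> inner (L u) p.
  apply/cvgrPdist_le => eps eps0.
  have /cvgrPdist_le /(_ eps eps0) := @half_pow_cvg R (Cq * `|p| * (2 * ((T + 1) / 2))).
  apply: filterS => k; rewrite sub0r normrN => h.
  by apply: le_trans (bound k) (le_trans (ler_norm _) h).
exact: cvg_unique Lup Lwp.
Unshelve. all: end_near. Qed.

End Reachability.

(** * The subdifferential of the cost *)

Section Subdifferential.
Context {R : realType} {U : hilbertType R}.
Local Notation mu := (@lebesgue_measure R).
Variables (T : R) (K : set U) (M : R).
Hypothesis bK : convex_body K M.
Local Notation I := (`]0, T[%classic : set R).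
Local Notation integ := (integ I).
Local Notation s := (support_fun K).
Local Notation F := (Fstar T K).
Implicit Types (u v q : R -> U) (x y w d : U).

(** Membership in the subdifferential of [s ^ 2 / 2] at [x]. *)
Definition fenchel_pair x y :=
  (exists2 w, K w & y = s x *: w) /\ inner y x = s x ^+ 2.

Lemma FstarE q : L2 T q -> F q = \int[mu]_(t in I) (2^-1 * s (q t) ^+ 2).
Proof. by move=> Lq; rewrite (RintZ (mitv T) _ (support_sq_integ bK Lq)). Qed.

(** Pointwise, [<u, q> <= a * s q <= a ^ 2 / 2 + s q ^ 2 / 2]. *)
Lemma fenchel_young q u (a : R -> R) : L2 T q -> L2 T u ->
  integ (fun t => a t ^+ 2) ->
  aeD I (fun t => 0 <= a t /\ exists2 w, K w & u t = a t *: w) ->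
  \int[mu]_(t in I) inner (u t) (q t) <=
    2^-1 * \int[mu]_(t in I) a t ^+ 2 + F q.
Proof.
move=> Lq Lu ia ua; have iq := support_sq_integ bK Lq.
rewrite /Fstar -(RintZ (mitv T) _ ia) -(RintZ (mitv T) _ iq).
rewrite -(RintD (mitv T) (integZ (mitv T) _ ia) (integZ (mitv T) _ iq)).
apply: Rint_le_ae => //; first exact: L2_integ_inner.
  by apply: integD => //; exact: integZ.
apply: aeD_imp ua => t It [a0 [w Kw ->]]; rewrite innerZl innerC.
apply: (@le_trans _ _ (a t * s (q t))).
  by rewrite ler_wpM2l// (support_ge bK).
by have := sqr_ge0 (a t - s (q t)); nra.
Qed.

Lemma scaled_proj_sm q u : strongly_measurable I q -> strongly_measurable I u ->
  strongly_measurable I (fun t => scaled_proj K (s (q t)) (u t)).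
Proof.
move=> mq um.
pose h (a : R^o) (w : U) := scaled_proj K (Num.max 0 a) w.
apply: (@sm_eq _ _ _ (fun t => h (s (q t)) (u t))).
  by move=> t _; rewrite /h (max_idPr (support_ge0 bK _)).
apply: (@sm_comp2 _ _ R^o U U h (fun t => s (q t) : R^o) u) => //; last first.
  exact: (support_sm bK).
move=> t a w It ac wc; rewrite /h.
have m0 (b : R) : 0 <= Num.max 0 b by rewrite le_max lexx.
have max_cvg : Num.max 0 (a n) @[n --> \oo] --> Num.max 0 (s (q t)).
  have max_cont : continuous (fun b : R => Num.max 0 b).
    by move=> b; apply: (@continuous_max _ _ (cst 0) id); [exact: cvg_cst|exact: cvg_id].
  by apply: cvg_comp ac _; exact: max_cont.
apply/cvgrPdist_le => e e0.
have lim0 : `|u t - w n| + 2 * M * `|Num.max 0 (s (q t)) - Num.max 0 (a n)| @[n --> \oo] -->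
    (0 : R).
  rewrite -[X in _ --> X](_ : `|u t - u t| +
      2 * M * `|Num.max 0 (s (q t)) - Num.max 0 (s (q t))| = 0); last first.
    by rewrite !subrr !normr0 mulr0 addr0.
  apply: cvgD; first by apply: cvg_norm; apply: cvgB => //; exact: cvg_cst.
  apply: cvgM; first exact: cvg_cst.
  by apply: cvg_norm; apply: cvgB => //; exact: cvg_cst.
have /cvgrPdist_le /(_ e e0) := lim0; apply: filterS => n; rewrite sub0r normrN => hn.
apply: le_trans (scaled_proj_lip bK _ _ (m0 _) (m0 _)) _.
exact: le_trans (ler_norm _) hn.
Qed.

Lemma Rint_le0_ae (f : R -> R) : integ f -> aeD I (fun t => 0 <= f t) ->
  \int[mu]_(t in I) f t <= 0 -> aeD I (fun t => f t = 0).
Proof.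
move=> fi f0 h; have fni := integ_norm fi.
have : aeD I (fun t => `|f t| = 0).
  apply: Rint_eq0_ae => //; rewrite (Rint_eq_ae (mitv T) fni fi)//.
  by apply: aeD_imp f0 => t _ f0t; rewrite ger0_norm.
by apply: aeD_imp => t _ /eqP; rewrite normr_eq0 => /eqP.
Qed.

(** The subdifferential of the integral functional is computed pointwise.  Given [u]
    in it, the functional is tested in the direction of the measurable function
    [x = u - z], [z t] being the projection of [u t] onto [s (q t) *: K]: the
    inequality obtained forces [x = 0] almost everywhere. *)
Lemma subdiffP q u : L2 T q ->
  subdiff T F q u <-> L2 T u /\ aeD I (fun t => fenchel_pair (q t) (u t)).
Proof.
move=> Lq; have iq := support_sq_integ bK Lq; split; last first.
  move=> [Lu hu]; split=> // q' Lq'.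
  have iq' := support_sq_integ bK Lq'.
  have Ld := L2B Lq' Lq; have id := L2_integ_inner Lu Ld.
  have i1 := integZ (mitv T) 2^-1 iq; have i2 := integZ (mitv T) 2^-1 iq'.
  rewrite (FstarE Lq) (FstarE Lq') /L2_inner -(RintD (mitv T) i1 id).
  apply: Rint_le_ae => //; first exact: integD.
  apply: aeD_imp hu => t It [[w Kw uE] uq]; rewrite innerBr uq uE innerZl.
  have h1 := support_ge bK (q' t) Kw; have h2 := support_ge0 bK (q t).
  rewrite (innerC w); have := ler_wpM2l h2 h1.
  by have := sqr_ge0 (s (q t) - s (q' t)); nra.
move=> [Lu hu]; split=> //.
pose f t := s (q t).
have f0 t : 0 <= f t by exact: (support_ge0 bK).
have mf : measurable_fun I f by apply: (support_measurable bK); exact: L2_sm.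
pose z t := scaled_proj K (f t) (u t); pose x t := u t - z t.
have mz : strongly_measurable I z by apply: scaled_proj_sm; exact: L2_sm.
have zK t : exists2 w, K w & z t = f t *: w.
  by exists (proj K ((f t)^-1 *: u t)) => //; have [] := body_projP bK ((f t)^-1 *: u t).
have M0 := body_M_ge0 bK.
have Lz : L2 T z.
  apply: (@L2_dom _ _ _ _ (fun t => M ^+ 2 * f t ^+ 2)) => //; first exact: integZ.
  move=> t _; have [w Kw ->] := zK t; rewrite -exprMn; apply: sqr_le => //.
  by rewrite normrZ ger0_norm// mulrC ler_wpM2r// (body_bound bK).
have Lx : L2 T x by exact: L2B.
have isx := support_sq_integ bK Lx.
have iux := L2_integ_inner Lu Lx.
have ifx : integ (fun t => f t * s (x t)).
  apply: (@integ_le _ _ (mitv T) _ (fun t => f t ^+ 2 + s (x t) ^+ 2)).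
  - by apply: measurable_funM => //; apply: (support_measurable bK); exact: L2_sm.
  - move=> t _; rewrite ger0_norm ?mulr_ge0 ?(support_ge0 bK)//.
    by have := sqr_ge0 (f t - s (x t)); have := sqr_ge0 (f t + s (x t)); nra.
  - exact: integD.
have test : \int[mu]_(t in I) inner (u t) (x t) <= \int[mu]_(t in I) (f t * s (x t)).
  rewrite -subr_le0.
  apply: (@quadratic_le0 _ _ (2^-1 * \int[mu]_(t in I) s (x t) ^+ 2)) => l l0 _.
  have Lqx : L2 T (fun t => q t + l *: x t) by apply: L2D => //; exact: L2Z.
  have := hu _ Lqx; rewrite /L2_inner.
  have -> : \int[mu]_(t in I) inner (u t) (q t + l *: x t - q t) =
      l * \int[mu]_(t in I) inner (u t) (x t).
    rewrite -(RintZ (mitv T) _ iux); apply: Rint_eq => t _.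
    by rewrite addrAC subrr add0r innerZr.
  have i1 := integZ (mitv T) 2^-1 iq; have i2 := integZ (mitv T) l ifx.
  have i3 := integZ (mitv T) (l ^+ 2 / 2) isx.
  have i12 := integD (mitv T) i1 i2.
  have : F (fun t => q t + l *: x t) <= F q + l * \int[mu]_(t in I) (f t * s (x t)) +
      l ^+ 2 / 2 * \int[mu]_(t in I) s (x t) ^+ 2.
    rewrite (FstarE Lqx) (FstarE Lq) -(RintZ (mitv T) l ifx) -(RintZ (mitv T) _ isx).
    rewrite -(RintD (mitv T) i1 i2) -(RintD (mitv T) i12 i3).
    apply: Rint_le => //; [by apply: integZ => //; exact: (support_sq_integ bK)|exact: integD|].
    move=> t _; have h1 := supportD bK (q t) (l *: x t).
    rewrite (supportZ bK _ (ltW l0)) in h1.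
    have := sqr_le (support_ge0 bK _) h1; rewrite -/(f t).
    by move: (s (q t + _)) (s (x t)) (f t) => c1 c2 c3; nra.
  move: (\int[mu]_(t in I) inner _ _) (\int[mu]_(t in I) (f t * _)) (\int[mu]_(t in I) s (x t) ^+ 2).
  move: (F _) (F _) => F1 F2 i4 i5 i6 h1 h2.
  by rewrite -(ler_pM2l l0); lra.
have x_eq0 : aeD I (fun t => `|x t| ^+ 2 = 0).
  apply: Rint_eq0_ae => //; first exact: L2_sq.
  have ixx := L2_sq Lx.
  have : \int[mu]_(t in I) (`|x t| ^+ 2 + f t * s (x t)) <= \int[mu]_(t in I) inner (u t) (x t).
    apply: Rint_le => //; first exact: integD.
    move=> t _; have -> : inner (u t) (x t) = `|x t| ^+ 2 + inner (z t) (x t).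
      by rewrite -inner_norm -innerDl /x subrK.
    rewrite lerD2l.
    have := f0 t; rewrite le_eqVlt => /orP[/eqP ft0|fp].
      by have [w _ ->] := zK t; rewrite -ft0 mul0r scale0r inner0l.
    rewrite mulrC -ler_pdivlMr//; apply: (support_le bK) => v Kv.
    rewrite ler_pdivlMr// mulrC -innerZr -subr_le0 (innerC (z t)) -innerBr.
    exact: (scaled_projP bK).
  rewrite (RintD (mitv T) ixx ifx) => h; move: (le_trans h test).
  by rewrite gerDr.
have uK : aeD I (fun t => exists2 w, K w & u t = f t *: w).
  apply: aeD_imp x_eq0 => t It /eqP; rewrite sqrf_eq0 normr_eq0 subr_eq0 => /eqP ->.
  exact: zK.
have iuq := L2_integ_inner Lu Lq.
have test2 : \int[mu]_(t in I) (f t ^+ 2 - inner (u t) (q t)) <= 0.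
  rewrite (RintB (mitv T) iq iuq).
  apply: (@quadratic_le0 _ _ (2^-1 * \int[mu]_(t in I) f t ^+ 2)) => l l0 l1.
  have l1' : 0 <= 1 - l by rewrite subr_ge0.
  have Lq' : L2 T (fun t => (1 - l) *: q t) by exact: L2Z.
  have := hu _ Lq'; rewrite /L2_inner.
  have -> : \int[mu]_(t in I) inner (u t) ((1 - l) *: q t - q t) =
      - l * \int[mu]_(t in I) inner (u t) (q t).
    rewrite -(RintZ (mitv T) _ iuq); apply: Rint_eq => t _.
    by rewrite innerBr innerZr; ring.
  have -> : F (fun t => (1 - l) *: q t) = (1 - l) ^+ 2 * F q.
    rewrite /Fstar mulrCA -(RintZ (mitv T) _ iq); congr (_ * _); apply: Rint_eq => t _.
    by rewrite (supportZ bK)// exprMn.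
  rewrite /Fstar -/(f _).
  rewrite (_ : \int[mu]_(t in I) s (q t) ^+ 2 = \int[mu]_(t in I) f t ^+ 2)//.
  move: (\int[mu]_(t in I) f t ^+ 2) (\int[mu]_(t in I) inner _ _) => a b h.
  by rewrite -(ler_pM2l l0); nra.
have uq : aeD I (fun t => f t ^+ 2 - inner (u t) (q t) = 0).
  apply: Rint_le0_ae => //; first exact: integB.
  apply: aeD_imp uK => t It [w Kw ->]; rewrite innerZl subr_ge0 expr2 ler_wpM2l//.
  by rewrite innerC (support_ge bK).
apply: aeD_imp2 uK uq => t It uKt /eqP; rewrite subr_eq0 => /eqP uqt.
by split=> //; rewrite -uqt.
Qed.

End Subdifferential.

(** * Uniqueness of the control and its values *)

Section Uniqueness.
Context {R : realType} {U : hilbertType R}.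
Local Notation mu := (@lebesgue_measure R).
Variables (T : R) (K : set U) (M : R).
Hypothesis bK : convex_body K M.
Local Notation I := (`]0, T[%classic : set R).
Local Notation s := (support_fun K).
Local Notation dF q := (subdiff T (Fstar T K) q).
Local Notation singular x := ((sing K `&` ~` polar (cone K)) x).
Implicit Types (u v q : R -> U) (x y w d : U).

Lemma fenchel_zero x y : s x = 0 -> fenchel_pair K x y -> y = 0.
Proof. by move=> sx0 [[w _ ->] _]; rewrite sx0 scale0r. Qed.

Lemma fenchel_pos x y : 0 < s x -> fenchel_pair K x y ->
  exists w, [/\ K w, y = s x *: w & inner x w = s x].
Proof.
move=> sp [[w Kw ->] h]; exists w; split=> //.
move: h; rewrite innerZl expr2 innerC => h.
by apply/eqP; rewrite -subr_eq0 -(mulrI_eq0 _ (mulfI (lt0r_neq0 sp))) mulrBr h subrr.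
Qed.

Lemma support_pos x : ~ polar (cone K) x -> 0 < s x.
Proof.
move=> px; rewrite lt_def (support_ge0 bK) andbT; apply/eqP => s0; apply: px.
exact/(support_eq0 bK).
Qed.

(** Outside the polar cone the maximiser is unique; on it the scale [s x] is [0]. *)
Lemma fenchel_unique x y y' : ~ singular x -> fenchel_pair K x y -> fenchel_pair K x y' ->
  y = y'.
Proof.
move=> nx xy xy'; have := support_ge0 bK x; rewrite le_eqVlt => /orP[/eqP s0|sp].
  by rewrite (fenchel_zero (esym s0) xy) (fenchel_zero (esym s0) xy').
have [w [Kw -> xw]] := fenchel_pos sp xy; have [w' [Kw' -> xw']] := fenchel_pos sp xy'.
congr (_ *: _); apply: contrapT => ww'; apply: nx; split; first by exists w, w'.
by move=> /(support_eq0 bK) s0; rewrite s0 ltxx in sp.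
Qed.

Lemma nonsingular_unique q u : L2 T q -> aeD I (fun t => ~ singular (q t)) ->
  dF q u -> ex_unique_ae T (dF q).
Proof.
move=> Lq nq uq; exists u => // v vq.
have [_ hu] := (subdiffP bK _ Lq).1 uq; have [_ hv] := (subdiffP bK _ Lq).1 vq.
have h := aeD_imp2 (fun t _ h1 h2 => conj h1 h2) hu hv.
apply: aeD_imp2 nq h => t It nqt [ut vt].
exact: fenchel_unique nqt vt ut.
Qed.

(** If the unique maximiser is a proper convex combination of two points of [K], these
    are maximisers as well. *)
Lemma nonsingular_ext x w : ~ singular x -> 0 < s x -> K w -> inner x w = s x -> ext K w.
Proof.
move=> nx sp Kw xw; have px : ~ polar (cone K) x.
  by move=> /(support_eq0 bK) s0; rewrite s0 ltxx in sp.
have uniq w' : K w' -> inner x w' = s x -> w' = w.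
  by move=> Kw' xw'; apply: contrapT => ww'; apply: nx; split=> //; exists w', w.
split=> // a b l Ka Kb l0 l1 wE.
have ha := support_ge bK x Ka; have hb := support_ge bK x Kb.
have h : l * inner x a + (1 - l) * inner x b = s x by rewrite -xw wE !innerE.
by split; apply: uniq => //; apply/eqP; rewrite eq_le; apply/andP; split=> //; nra.
Qed.

Lemma nonsingular_values (V : set U) q u : L2 T q -> aeD I (fun t => ~ singular (q t)) ->
  V 0 -> ext K `<=` V -> dF q u -> aeD I (fun t => cone V (u t)).
Proof.
move=> Lq nq V0 KV uq; have [_ hu] := (subdiffP bK _ Lq).1 uq.
apply: aeD_imp2 nq hu => t It nqt ut.
have := support_ge0 bK (q t); rewrite le_eqVlt => /orP[/eqP s0|sp].
  exists 0 => //; exists 1 => //.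
  by rewrite (fenchel_zero (esym s0) ut) scaler0.
have [w [Kw -> qw]] := fenchel_pos sp ut; exists w; last by exists (s (q t)).
by apply: KV; exact: nonsingular_ext nqt sp Kw qw.
Qed.

Lemma proj_continuous : continuous (proj K).
Proof.
move=> w; apply/cvgrPdist_le => e e0.
have h : w' @[w' --> w] --> w by exact: cvg_id.
have /cvgrPdist_le /(_ e e0) := h; apply: filterS => w' /=.
exact: le_trans (is_proj_lip (body_projP bK w) (body_projP bK w')).
Qed.

Lemma face_proj_sm d q : strongly_measurable I q ->
  strongly_measurable I (fun t => face_proj K d (q t)).
Proof.
move=> mq; apply: (@sm_lim _ _ (mitv T) _ (fun n t => tikhonov K d (q t) n)).
  move=> n; apply: (@sm_comp _ _ _ _ (proj K)); first exact: proj_continuous.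
  by apply: smD; [exact: sm_cst|exact: smZ].
by move=> t It; exact: (tikhonov_cvg bK).
Qed.

(** Each vector [d] selects measurably, in the face of [K] exposed by [q t], the point
    closest to [d]. *)
Lemma face_proj_subdiff d q : L2 T q -> dF q (fun t => s (q t) *: face_proj K d (q t)).
Proof.
move=> Lq; apply/(subdiffP bK _ Lq); split; last first.
  apply: aeD_forall => t It; split.
    by exists (face_proj K d (q t)) => //; exact: (face_proj_in bK).
  by rewrite innerZl innerC (face_proj_max bK) expr2.
apply: (@L2_dom _ _ _ _ (fun t => M ^+ 2 * s (q t) ^+ 2)).
- apply: (@sm_comp2 _ _ R^o U U (fun a w => a *: w) (fun t => s (q t) : R^o)).
  + by move=> t a w It ac wc; exact: cvgZ.
  + by apply: (support_sm bK); exact: L2_sm.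
  + by apply: face_proj_sm; exact: L2_sm.
- by apply: integZ => //; exact: (support_sq_integ bK).
- move=> t It; rewrite -exprMn; apply: sqr_le => //.
  rewrite normrZ ger0_norm ?(support_ge0 bK)// mulrC ler_wpM2r ?(support_ge0 bK)//.
  by apply: (body_bound bK); exact: (face_proj_in bK).
Qed.

(** Two distinct maximisers at time [t] are separated by the selections attached to two
    vectors of a countable dense set. *)
Lemma unique_nonsingular q : separable_space U -> L2 T q -> ex_unique_ae T (dF q) ->
  aeD I (fun t => ~ singular (q t)).
Proof.
move=> [D /countable_injP[f f_inj] Dd] Lq [u uq hu].
pose g n := xget 0 [set x | D x /\ f x = n].
have gD x : D x -> exists n, g n = x.
  move=> Dx; exists (f x); have [Dg fg] := @xgetPex _ 0 [set y | D y /\ f y = f x]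
    (ex_intro _ x (conj Dx erefl)).
  by apply: f_inj => //; apply/mem_set.
have dense_norm x (e : R) : 0 < e -> exists n, `|x - g n| < e.
  move=> e0; have [] := Dd (ball x e); [by exists x; exact: ballxx|exact: ball_open|].
  move=> y [By Dy]; have [n gn] := gD y Dy; exists n; rewrite gn.
  by move: By; rewrite -ball_normE.
have h := aeD_all (fun n => hu _ (face_proj_subdiff (g n) Lq)).
apply: aeD_imp h => t It ht [[v [w [Kv Kw vw xv xw]]] px].
have sp := support_pos px.
have vw0 : 0 < `|v - w| / 2 by rewrite divr_gt0// normr_gt0 subr_eq0; exact/eqP.
have [n hn] := dense_norm v _ vw0; have [m hm] := dense_norm w _ vw0.
have same : face_proj K (g n) (q t) = face_proj K (g m) (q t).
  by apply: (scalerI (lt0r_neq0 sp)); rewrite (ht n) (ht m).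
have h1 := face_proj_near bK (g n) Kv xv; have h2 := face_proj_near bK (g m) Kw xw.
have := ler_distD (face_proj K (g n) (q t)) v w.
rewrite leNgt => /negP; apply; rewrite [ltRHS](splitr `|v - w|).
apply: ltrD; first exact: le_lt_trans h1 hn.
by rewrite same distrC; exact: le_lt_trans h2 hm.
Qed.

End Uniqueness.

(** * Gauges of controls *)

Section Gauge.
Context {R : realType} {U : hilbertType R}.
Local Notation mu := (@lebesgue_measure R).
Variables (T : R) (K : set U) (M : R).
Hypothesis bK : convex_body K M.
Local Notation I := (`]0, T[%classic : set R).
Implicit Types (u : R -> U) (a : R -> R).

(** The sublevel set of level [r >= 0] is that of the points fixed by the projection
    onto [r *: K]. *)
Lemma gauge_measurable u : strongly_measurable I u ->
  measurable_fun I (fun t => gauge K (u t)).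
Proof.
move=> um mI; apply: (measurability _ (ErealGenOInfty.measurableE R)) => //.
move=> _ [_ [r ->] <-].
have [r0|r0] := ltP r 0.
  rewrite (_ : _ `&` _ = I)//; apply/seteqP; split=> [t []//|t It]; split=> //=.
  by rewrite in_itv/= andbT (lt_le_trans _ (gauge_ge0 _ _))// lte_fin.
pose z t := scaled_proj K r (u t).
have mz : strongly_measurable I z.
  apply: (sm_comp (h := scaled_proj K r)) => // w.
  apply/cvgrPdist_le => e e0; have h : w' @[w' --> w] --> w by exact: cvg_id.
  have /cvgrPdist_le /(_ e e0) := h; apply: filterS => w' /= ww'.
  apply: le_trans (scaled_proj_lip bK w w' r0 r0) _.
  by rewrite subrr normr0 mulr0 addr0.
have -> : I `&` (fun t => gauge K (u t)) @^-1` `]r%:E, +oo[%classic =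
    I `&` [set t | 0 < `|u t - z t|].
  apply/seteqP; split=> t [It] /= h; split=> //=; last first.
    rewrite in_itv/= andbT ltNge; apply/negP => /(gauge_leP bK _ r0)[v Kv uE].
    have := scaled_projP bK (u t) r0 Kv; rewrite -uE -/(z t) inner_norm leNgt.
    by rewrite exprn_gt0.
  move: h; rewrite in_itv/= andbT normr_gt0 subr_eq0 => h.
  apply: contraTneq h => uz; rewrite -leNgt.
  apply/(gauge_leP bK _ r0); exists (proj K (r^-1 *: u t)); last by rewrite {1}uz.
  by have [] := body_projP bK (r^-1 *: u t).
have mn := sm_norm (smB um mz).
have := measurable_fun_ltr (@measurable_cst _ _ _ _ I (0 : R)) mn mI (Y := [set true]).
by apply.
Qed.

Lemma measurable_sqre (g : R -> \bar R) : measurable_fun I g ->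
  @measurable_fun _ _ (measurableTypeR R) _ I (fun t => (g t ^+ 2)%E).
Proof. by move=> mg; exact: emeasurable_funM. Qed.

Lemma L2_gauge_of u a : strongly_measurable I u -> measurable_fun I a ->
  (forall t, I t -> 0 <= a t /\ exists2 v, K v & u t = a t *: v) ->
  integ I (fun t => a t ^+ 2) -> L2_gauge T K u.
Proof.
move=> um ma ua ia.
have au t : I t -> (gauge K (u t) <= (a t)%:E)%E.
  by move=> It; have [a0 uE] := ua t It; exact/(gauge_leP bK _ a0).
have mg := gauge_measurable um.
split=> //.
- apply: (@L2_dom _ _ _ _ (fun t => M ^+ 2 * a t ^+ 2)) => //; first exact: integZ.
  move=> t It; have [a0 [v Kv ->]] := ua t It; rewrite -exprMn; apply: sqr_le => //.
  by rewrite normrZ ger0_norm// mulrC ler_wpM2r// (body_bound bK).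
- apply: (@le_lt_trans _ _ (\int[mu]_(t in I) (a t ^+ 2)%:E)%E); last first.
    by rewrite (Rint_EFin (mitv T) ia) ltry.
  apply: ge0_le_integral => //.
  + by move=> t _; rewrite expe_ge0// (gauge_ge0 K).
  + exact: measurable_sqre.
  + exact: measurable_EFin (integ_measurable ia).
  + move=> t It; have [a0 _] := ua t It.
    by rewrite EFin_expe lee_sqr ?lee_fin ?gauge_ge0// au.
Qed.

(** The bound is the gauge itself, finite almost everywhere as its square is
    integrable. *)
Lemma L2_gauge_bound u : L2_gauge T K u -> exists a,
  integ I (fun t => a t ^+ 2) /\
  aeD I (fun t => 0 <= a t /\ exists2 v, K v & u t = a t *: v).
Proof.
move=> [Lu mg ig]; pose a t := fine (gauge K (u t)).
have a0 t : 0 <= a t by rewrite fine_ge0// gauge_ge0.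
have ma : measurable_fun I a by apply: measurableT_comp => //; exact: measurable_fine.
have msq : measurable_fun I (fun t => a t ^+ 2) by exact: measurable_funX.
have igsq : mu.-integrable I (fun t => gauge K (u t) ^+ 2)%E.
  apply/integrableP; split; first exact: measurable_sqre.
  rewrite (@eq_integral _ _ _ mu I (fun t => gauge K (u t) ^+ 2)%E)// => t _.
  by rewrite gee0_abs// expe_ge0// gauge_ge0.
exists a; split.
  apply: integ_ge0P => //; first by move=> t _; exact: sqr_ge0.
  apply: le_lt_trans ig; apply: ge0_le_integral => //.
  - by move=> t _; rewrite lee_fin sqr_ge0.
  - exact: measurable_EFin.
  - exact: measurable_sqre.
  - move=> t _; rewrite EFin_expe lee_sqr ?lee_fin ?gauge_ge0// /a.
    by case: (gauge K (u t)) (gauge_ge0 K (u t)) => [r| |] //= _; rewrite leey.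
have := @integrable_ae _ _ _ mu I (mitv T) _ igsq.
apply: (@aeD_imp _ I (fun t => (gauge K (u t) ^+ 2)%E \is a fin_num)) => t It gf.
split=> //; apply/(gauge_leP bK _ (a0 t)); rewrite /a.
by case: (gauge K (u t)) (gauge_ge0 K (u t)) gf => [r| |].
Qed.

End Gauge.

(** * Minimisers of a positively 2-homogeneous functional minus a linear form *)

Section Homogeneous.
Context {R : realType} {X : hilbertType R}.
Variable F : X -> R.
Hypotheses (F_ge0 : forall p, 0 <= F p)
  (FZ : forall l p, 0 <= l -> F (l *: p) = l ^+ 2 * F p).
Variable y : X.
Implicit Types p q : X.
Local Notation r p := (Num.sqrt (F p)).

Definition sqrt_bound (c : R) := forall p, inner y p <= c * r p.

Definition least p := forall q, F p - inner y p <= F q - inner y q.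

Definition ratio p : \bar R :=
  let a := inner y p in
  if r p == 0 then
    if a == 0 then 0%E else if 0 < a then +oo%E else -oo%E
  else (a / r p)%:E.

Let r_sq p : r p ^+ 2 = F p.
Proof. by rewrite sqr_sqrtr. Qed.

Let r_ge0 p : 0 <= r p.
Proof. exact: sqrtr_ge0. Qed.

Let rZ l p : 0 <= l -> r (l *: p) = l * r p.
Proof.
by move=> l0; rewrite FZ// sqrtrM ?sqr_ge0// sqrtr_sqr ger0_norm.
Qed.

(** The quadratic bound, used on each ray, yields the bound by the square root. *)
Lemma sqrt_bound_of_quadratic (c : R) : 0 <= c -> (forall p, inner y p <= c + F p) ->
  sqrt_bound (c + 1).
Proof.
move=> c0 h p; have r0 := r_ge0 p.
have hl l : 0 < l -> l * inner y p <= c + l ^+ 2 * r p ^+ 2.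
  by move=> l0; rewrite -innerZr r_sq -(FZ _ (ltW l0)).
have [rp0|rp0] := eqVneq (r p) 0.
  rewrite rp0 mulr0; apply: (@quadratic_le0 _ _ c) => l l0 _.
  have := hl l^-1; rewrite invr_gt0 => /(_ l0); rewrite rp0 expr0n mulr0 addr0.
  by rewrite ler_pdivrMl.
have rp : 0 < r p by rewrite lt_def rp0.
have := hl (r p)^-1; rewrite invr_gt0 => /(_ rp).
by rewrite ler_pdivrMl// -exprMn mulVf// expr1n mulrC.
Qed.

(** Stationarity along the ray of [p], at the scale [1]. *)
Lemma least_optimality p : least p -> inner y p = 2 * F p.
Proof.
move=> hp.
have h l : 0 <= l -> F p - inner y p <= l ^+ 2 * F p - l * inner y p.
  by move=> l0; have := hp (l *: p); rewrite FZ// innerZr.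
apply/eqP; rewrite eq_le; apply/andP; split; rewrite -subr_le0;
    apply: (@quadratic_le0 _ _ (F p)) => l l0 l1.
  by rewrite -(ler_pM2l l0); have := h (1 + l) ltac:(lra); nra.
by rewrite -(ler_pM2l l0); have := h (1 - l) ltac:(lra); nra.
Qed.

(** On the ray of [q] the optimal scale is [r p / r q]; when [r q = 0] the pairing with [y]
    must be nonpositive for the functional to be bounded below. *)
Lemma least_sqrt_bound p : least p -> sqrt_bound (2 * r p).
Proof.
move=> hp q; have opt := least_optimality hp.
have rp := r_ge0 p; have rq := r_ge0 q.
have h l : 0 <= l -> l * inner y q <= r p ^+ 2 + l ^+ 2 * r q ^+ 2.
  move=> l0; have := hp (l *: q); rewrite FZ// innerZr opt !r_sq; lra.
have [q0|q0] := eqVneq (r q) 0.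
  rewrite q0 mulr0; apply: (@quadratic_le0 _ _ (r p ^+ 2)) => l l0 _.
  have := h l^-1; rewrite invr_ge0 => /(_ (ltW l0)); rewrite q0 expr0n mulr0 addr0.
  by rewrite ler_pdivrMl.
have qp : 0 < r q by rewrite lt_def q0.
have [p0|p0] := eqVneq (r p) 0.
  rewrite p0 mulr0 mul0r; apply: (@quadratic_le0 _ _ (r q ^+ 2)) => l l0 _.
  have := h l (ltW l0); rewrite p0 expr0n add0r expr2 -mulrA.
  by rewrite (ler_pM2l l0).
have pp : 0 < r p by rewrite lt_def p0.
have := h (r p / r q); rewrite divr_ge0// => /(_ isT).
rewrite -exprMn divfK// (_ : r p / r q * inner y q = r p * (inner y q / r q)); last by ring.
have -> : r p ^+ 2 + r p ^+ 2 = r p * (2 * r p) by ring.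
by rewrite ler_pM2l// ler_pdivrMr.
Qed.

Section Attainment.
Hypothesis bound : exists2 c, 0 < c & sqrt_bound c.

Let degenerate p : r p = 0 -> inner y p <= 0.
Proof. by move=> rp; have [c _ /(_ p)] := bound; rewrite rp mulr0. Qed.

Lemma ratio_le p (c : R) : 0 <= c -> inner y p <= c * r p -> (ratio p <= c%:E)%E.
Proof.
move=> c0 h; rewrite /ratio; have [rp|rp] := eqVneq (r p) 0.
  case: eqVneq => [_|yp]; first by rewrite lee_fin.
  by rewrite ltNge degenerate//= leNye.
by rewrite lee_fin ler_pdivrMr// lt_def rp r_ge0.
Qed.

Lemma le_ratio p (c : R) : (ratio p <= c%:E)%E -> inner y p <= c * r p.
Proof.
rewrite /ratio; have [rp|rp] := eqVneq (r p) 0; first by rewrite rp mulr0 degenerate.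
by rewrite lee_fin ler_pdivrMr// lt_def rp r_ge0.
Qed.

Lemma ratio_lt0 p : (ratio p < 0%:E)%E -> inner y p < 0.
Proof.
rewrite /ratio; have [rp|rp] := eqVneq (r p) 0.
  have [->|yp] := eqVneq (inner y p) 0; first by rewrite /= !ltxx.
  by rewrite [inner y p < 0]lt_neqAle yp degenerate.
by rewrite lte_fin pmulr_llt0// invr_gt0 lt_def rp r_ge0.
Qed.

Lemma ratio_sqrt_bound (c : R) : (forall q, `|q| = 1 -> (ratio q <= c%:E)%E) ->
  sqrt_bound c.
Proof.
move=> h p; have [->|p0] := eqVneq p 0.
  by rewrite inner0r -(scale0r (0 : X)) rZ// mul0r mulr0.
have np : 0 < `|p| by rewrite normr_gt0.
have n1 : `| `|p|^-1 *: p| = 1 by rewrite normrZ normfV normr_id mulVf// gt_eqF.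
have := le_ratio (h _ n1); rewrite innerZr rZ ?invr_ge0// mulrCA.
by rewrite ler_pM2l// invr_gt0.
Qed.

(** The ratio at a minimiser [p] is the bound [2 * r p].  When [r p = 0] the bound is [0],
    so that [y = 0] and every unit vector is optimal, provided there is one. *)
Lemma least_ratio_attained : (exists x : X, x != 0) -> (exists p, least p) ->
  exists2 p, `|p| = 1 & forall q, `|q| = 1 -> (ratio q <= ratio p)%E.
Proof.
move=> [x x0] [p hp]; have hc := least_sqrt_bound hp; have opt := least_optimality hp.
have unit q : q != 0 -> `| `|q|^-1 *: q| = 1.
  by move=> q0; rewrite normrZ normfV normr_id mulVf// normr_eq0.
have [rp|rp] := eqVneq (r p) 0.
  have y0 : y = 0.
    apply/eqP; rewrite -normr_eq0 -sqrf_eq0 -inner_norm eq_le.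
    by have := hc y; rewrite rp mulr0 mul0r => ->; rewrite inner_norm sqr_ge0.
  exists (`|x|^-1 *: x); first exact: unit.
  move=> q _; rewrite /ratio y0 !inner0l !eqxx !mul0r.
  by do 2 case: ifP => _.
have rpp : 0 < r p by rewrite lt_def rp r_ge0.
have p0 : p != 0.
  by apply: contraNneq rp => ->; rewrite -(scale0r (0 : X)) rZ// mul0r.
exists (`|p|^-1 *: p); first exact: unit.
have opt2 : inner y p = 2 * r p ^+ 2 by rewrite r_sq.
move=> q _; have -> : ratio (`|p|^-1 *: p) = (2 * r p)%:E.
  have n0 : `|p|^-1 != 0 by rewrite invr_eq0 normr_eq0.
  rewrite /ratio rZ ?invr_ge0// mulf_eq0 (negbTE n0) (negbTE rp) /= innerZr opt2.
  by congr EFin; move: (r p) rp => z z0; field; rewrite z0 normr_eq0 p0.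
by apply: ratio_le => //; rewrite mulr_ge0// ltW.
Qed.

(** If the maximal ratio [k] is attained at [p], the minimum of [l^2 F p - l <y, p>] over
    [l >= 0] is [- k^2 / 4], a lower bound of the functional. *)
Lemma ratio_attained_least :
  (exists2 p, `|p| = 1 & forall q, `|q| = 1 -> (ratio q <= ratio p)%E) ->
  exists p, least p.
Proof.
move=> [p p1 hp].
have pN q : `|q| = 1 -> `| - q| = 1 by rewrite normrN.
have zero_min : y = 0 -> exists p, least p.
  move=> y0; exists 0 => q; rewrite y0 !inner0l !subr0.
  by rewrite -{1}(scale0r (0 : X)) FZ// expr0n mul0r.
have [c cp hc] := bound; have qp := ratio_le (ltW cp) (hc p).
(* the values of the ratio at opposite vectors are not both negative *)
have [q0|q0] := ltP (ratio p) 0%E.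
  have negq q : `|q| = 1 -> inner y q < 0.
    by move=> q1; apply: ratio_lt0; exact: le_lt_trans (hp q q1) q0.
  have := negq p p1; have := negq (- p) (pN p p1); rewrite innerNr; lra.
case E : (ratio p) q0 qp => [k| |]//; rewrite lee_fin => k0 _.
have hk : sqrt_bound k by apply: ratio_sqrt_bound => q q1; rewrite -E; exact: hp.
have [rp|rp] := eqVneq (r p) 0.
  apply: zero_min; apply/eqP; rewrite -normr_eq0 -sqrf_eq0 -inner_norm eq_le.
  have -> : 0 <= inner y y by rewrite inner_norm sqr_ge0.
  move: E; rewrite /ratio rp eqxx; case: ifP => [_ [k_eq0]|_]; last by case: ifP.
  by have := hk y; rewrite -k_eq0 mul0r => ->.
have rpp : 0 < r p by rewrite lt_def rp r_ge0.
have yp : inner y p = k * r p.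
  by move: E; rewrite /ratio (negbTE rp) => -[<-]; rewrite divfK.
(* the minimum of the functional along the ray through p *)
exists ((k / (2 * r p)) *: p) => q.
have l0 : 0 <= k / (2 * r p) by rewrite divr_ge0// mulr_ge0// ltW.
rewrite (FZ _ l0) innerZr yp; have := hk q.
move: (r_sq p) (r_sq q) rp; move: (r p) (r q) => z w <- <- z0 aw.
move: (inner y q) aw => a aw.
rewrite (_ : _ - _ = - (k ^+ 2 / 4)); last by field.
by have := sqr_ge0 (w - k / 2); rewrite sqrrB; lra.
Qed.

End Attainment.
End Homogeneous.

(** * The dual functional of the control problem *)

Section DualFunctional.
Context {R : realType} {X U : hilbertType R}.
Local Notation mu := (@lebesgue_measure R).
Variables (S : R -> X -> X) (B : {linear U -> X}) (T : R) (K : set U) (M : R).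
Hypotheses (HS : C0_semigroup S) (HB : continuous B) (HT : 0 < T).
Hypothesis bK : convex_body K M.
Local Notation I := (`]0, T[%classic : set R).
Local Notation s := (support_fun K).
Local Notation L := (Lop S B T).
Local Notation Ls := (Ladj S B T).
Local Notation F := (fun p => Fstar T K (Ls p)).
Implicit Types (u v : R -> U) (p q y : X).

Lemma Fstar_LadjZ l p : 0 <= l -> Fstar T K (Ls (l *: p)) = l ^+ 2 * Fstar T K (Ls p).
Proof.
move=> l0; have iq := support_sq_integ bK (L2_Ladj HS HB HT p).
have e : \int[mu]_(t in I) s (Ls (l *: p) t) ^+ 2 =
    l ^+ 2 * \int[mu]_(t in I) s (Ls p t) ^+ 2.
  rewrite -(RintZ (mitv T) _ iq); apply: Rint_eq => t It.
  by rewrite (LadjZ HS HB)// (supportZ bK)// exprMn.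
by rewrite /Fstar e; move: (Rintegral _ _ _) => z; ring.
Qed.

(** A control with square-integrable gauge bounds [<y, p>] by a constant plus [F p]. *)
Lemma reachable_cbound y u : L2_gauge T K u -> L u = y ->
  exists2 c, 0 < c & cbound S B T K y c.
Proof.
move=> gu uy; have [a [ia ua]] := L2_gauge_bound bK gu.
have [Lu _ _] := gu.
have A0 : 0 <= \int[mu]_(t in I) a t ^+ 2 by apply: Rintegral_ge0 => t _; exact: sqr_ge0.
exists (2^-1 * \int[mu]_(t in I) a t ^+ 2 + 1); first by rewrite ltr_wpDl// mulr_ge0.
apply: (@sqrt_bound_of_quadratic _ _ F) => [p|l p l0||p].
- exact: Fstar_ge0.
- exact: Fstar_LadjZ.
- by rewrite mulr_ge0.
- rewrite -uy (Lop_weak HS HB HT p Lu).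
  have Lp := L2_Ladj HS HB HT p.
  exact: (fenchel_young bK Lp Lu ia ua).
Qed.

Lemma cbound_reachable y (c : R) : 0 <= c -> cbound S B T K y c ->
  exists u, [/\ L2_gauge T K u, ae_on T (fun t => cone K (u t)) & L u = y].
Proof.
move=> c0 /(target_reached HS HB HT bK c0)[u [a [ad Lu]]].
have [um ma ua ia _] := ad; exists u; split=> //.
  apply: (L2_gauge_of bK um _ ua ia).
  by apply: (@sm_measurable _ _ R^o id a) ma => x; exact: cvg_id.
apply: aeD_forall => t It; have [a0 [v Kv ->]] := ua t It.
move: a0; rewrite le_eqVlt => /orP[/eqP <-|a0]; last by exists v => //; exists (a t).
by exists 0; [case: bK|exists 1 => //; rewrite scale0r scaler0].
Qed.

(** The bound by [2 * sqrt (F p)] provides a control of cost at most [F p]; by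
    [<y, p> = 2 F p] it realises equality in Fenchel's inequality. *)
Lemma minimiser_control y p : minimiser S B T K y p ->
  exists2 u, subdiff T (Fstar T K) (Ls p) u & L u = y.
Proof.
move=> hp.
have F0 q : 0 <= F q by exact: Fstar_ge0.
have opt : inner y p = 2 * Fstar T K (Ls p) := least_optimality Fstar_LadjZ hp.
have hc : cbound S B T K y (2 * sqrtF S B T K p) := least_sqrt_bound F0 Fstar_LadjZ hp.
have r2 : sqrtF S B T K p ^+ 2 = Fstar T K (Ls p) by exact: sqr_sqrtr.
have c0 : 0 <= 2 * sqrtF S B T K p by rewrite mulr_ge0// sqrtr_ge0.
have [u [a [ad uy]]] := target_reached HS HB HT bK c0 hc.
have Lu := admissible_L2 bK ad; have [_ _ ua ia aN] := ad.
have Lp := L2_Ladj HS HB HT p.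
exists u => //; split=> // q Lq.
have iq := L2_integ_inner Lu Lq; have ip := L2_integ_inner Lu Lp.
have -> : L2_inner T u (fun t => q t - Ls p t) =
    \int[mu]_(t in I) inner (u t) (q t) - inner y p.
  rewrite -uy (Lop_weak HS HB HT p Lu) -(RintB (mitv T) iq ip).
  by apply: Rint_eq => t _; rewrite innerBr.
have := fenchel_young bK Lq Lu ia (aeD_forall ua).
have {aN} : \int[mu]_(t in I) a t ^+ 2 <= 2 * Fstar T K (Ls p).
  by apply: le_trans aN _; rewrite -r2 exprMn; move: (sqrtF _ _ _ _ _ ^+ 2) => z; lra.
rewrite opt; move: (\int[mu]_(t in I) _) (\int[mu]_(t in I) _) (Fstar _ _ _) (Fstar _ _ _).
by move=> i1 i2 f1 f2; lra.
Qed.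

Lemma cstar_lty y : (cstar S B T K y < +oo)%E <->
  exists2 c, 0 < c & cbound S B T K y c.
Proof.
split=> [/ereal_inf_lt[_ [c [c0 hc] <-] _]|[c c0 hc]].
  exists (c + 1); first by rewrite ltr_wpDl.
  by move=> p; apply: le_trans (hc p) _; rewrite ler_wpM2r ?sqrtr_ge0// lerDl.
apply: (@le_lt_trans _ _ c%:E); last by rewrite ltry.
by apply: ereal_inf_lbound; exists c => //; split=> //; exact: ltW.
Qed.

Lemma minimiser_cstar_attained y : (exists2 c, 0 < c & cbound S B T K y c) ->
  (exists x : X, x != 0) ->
  (exists p, minimiser S B T K y p) <-> cstar_attained S B T K y.
Proof.
move=> star X0; have F0 q : 0 <= F q by exact: Fstar_ge0.
split; first exact: (least_ratio_attained F0 Fstar_LadjZ star X0).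
exact: (ratio_attained_least F0 Fstar_LadjZ star).
Qed.

End DualFunctional.

(** * The closed convex hull of a bounded set *)

Section ClosedConvexHull.
Context {R : realType} {V : hilbertType R}.
Implicit Types A : set V.

Lemma convex_setP A : @convex_set R V A <-> convex_subset A.
Proof.
split=> [h x y l Ax Ay l0 l1|h x y l /set_mem Ax /set_mem Ay].
  have := h x y (Itv01 l0 l1) (mem_set Ax) (mem_set Ay).
  by move/set_mem.
by apply/mem_set; apply: h.
Qed.

Lemma closed_convex_hull_body A : bounded_set A -> A 0 ->
  exists M, convex_body (closed_convex_hull A) M.
Proof.
move=> [N [_ hN]] A0.
have [M AM] : exists M : R, forall v, A v -> `|v| <= M.
  by exists (N + 1) => v Av; apply: (hN (N + 1)) => //; rewrite ltrDl.
exists M; split.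
- exact: closed_closure.
- apply: convex_closure => x y l hx hy l0 l1 C [Cc AC].
  by have /convex_setP := Cc; apply => //; [apply: hx|apply: hy].
- by apply: subset_closure => C [_]; apply.
- move=> v /closure_normP hv; apply/ler_addgt0Pr => e e0.
  have [w hw vw] := hv e e0.
  have wM : `|w| <= M.
    apply: (hw [set w : V | `|w| <= M]); split=> // ; apply/convex_setP => x y l xM yM l0 l1.
    rewrite /=; apply: le_trans (ler_normD _ _) _; rewrite !normrZ !ger0_norm ?subr_ge0//.
    by move: xM yM => /=; nra.
  by have := ler_distD w v 0; rewrite !subr0; lra.
Qed.

End ClosedConvexHull.

Theorem theorem1p2 (R : realType) (X U : hilbertType R)
    (DA : set X) (A : X -> X) (S : R -> X -> X) (B : {linear U -> X})
    (T : R) (Ucal : set U) (y0 yf : X)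
    (HS : C0_semigroup S) (HA : generator S DA A) (HB : continuous B)
    (HT : 0 < T) (Hbounded : bounded_set Ucal) (H0 : Ucal 0) :
  let Ur := closed_convex_hull Ucal in
  let P := cone Ucal in
  let Pr := cone Ur in
  let ytilde := yf - S T y0 in
  let star := exists2 c : R, 0 < c & cbound S B T Ur ytilde c in
  [/\ reachable S B T Pr Ur y0 yf <-> star,
      star <-> (cstar S B T Ur ytilde < +oo)%E &
      star ->
      ((exists x : X, x != 0) ->
        ((exists p, minimiser S B T Ur ytilde p) <->
         cstar_attained S B T Ur ytilde)) /\
      forall p, minimiser S B T Ur ytilde p ->
        let dF := subdiff T (Fstar T Ur) (Ladj S B T p) in
        [/\ exists2 u, dF u & steers S B T y0 yf u,
            condH S B T Ur p -> ex_unique_ae T dF,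
            separable_space U -> ex_unique_ae T dF -> condH S B T Ur p &
            condH S B T Ur p -> ext Ur `<=` Ucal ->
              forall u, dF u -> ae_on T (fun t => P (u t))]].
Proof.
move=> Ur P Pr ytilde star.
have [M bK] := closed_convex_hull_body Hbounded H0.
have reachL u : steers S B T y0 yf u <-> Lop S B T u = ytilde.
  by rewrite /steers /mild_solution /ytilde; split=> [<-|->];
    [rewrite addrC addKr|rewrite addrC subrK].
have q2 p := L2_Ladj HS HB HT p.
split.
- split=> [[u [gu _ /reachL Lu]]|[c c0 hc]].
    exact: (reachable_cbound HS HB HT bK gu Lu).
  have [u [gu uP Lu]] := cbound_reachable HS HB HT bK (ltW c0) hc.
  by exists u; split=> //; apply/reachL.
- by rewrite (cstar_lty _ _ _ _ _).
- move=> st; split; first exact: (minimiser_cstar_attained HS HB HT bK st).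
  move=> p hp dF.
  have [u0 u0F u0L] := minimiser_control HS HB HT bK hp.
  split.
  + by exists u0 => //; apply/reachL.
  + by move=> hH; exact: (nonsingular_unique bK (q2 p) hH u0F).
  + by move=> sep uniq; exact: (unique_nonsingular bK sep (q2 p) uniq).
  + by move=> hH ext u uF; exact: (nonsingular_values bK (q2 p) hH H0 ext uF).
Qed.
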